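(* Let $\alpha,L>0$ and consider the sparse graphon model with $W_0\in\Sigma(\alpha,L)$ and $4/n<\rho_n\le 1$; put $f_0=\rho_nW_0$. Fix $$k=\Big\lceil(\rho_n^{1/2}n)^{\frac{1}{1+\alpha\wedge1}}\Big\rceil\ \text{ if }\rho_n\ge n^{(\alpha\wedge1)-1},\qquad k=\Big\lceil(\rho_n n)^{\frac{1}{2(\alpha\wedge1)}}\Big\rceil\ \text{ if }\rho_n<n^{(\alpha\wedge1)-1}.$$ (i) Assume that $\rho_n\ge n^{-\frac{2(\alpha\wedge1)}{1+2(\alpha\wedge1)}}\big(\log(n\rho_n)\big)^{\frac{2(1+\alpha\wedge1)}{1+2(\alpha\wedge1)}}$ and that there exists an integer $n_0\ge2$ such that $k=\lfloor n/n_0\rfloor$. Then there exists a positive constant $C_1$ depending only on $L$ and $\alpha$ such that the least squares graphon estimator $\widehat f$ constructed with this choice of $k$ and $n_0$ satisfies $$\mathbb E\left[\delta^2(\widehat f,f_0)\right]\le C_1\left\{\rho_n^{\frac{2+\alpha\wedge1}{1+\alpha\wedge1}}n^{-\frac{2(\alpha\wedge1)}{1+\alpha\wedge1}}+\frac{\rho_n\log(\rho_n n)}{n}+\frac{\rho_n^2}{n^{\alpha\wedge1}}\right\}.$$ (ii) Assume that $1\ge r\ge\rho_n\ge c_0n^{-1}$, where $c_0>0$ is an absolute constant. Then there exists a positive constant $C_2$ depending only on $L$ and $\alpha$ (and $c_0$) such that the restricted least squares graphon estimator $\widehat f_r$ with this choice of $k$ satisfies $$\mathbb E\left[\delta^2(\widehat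 f_r,f_0)\right]\le C_2\left\{r^{\frac{2+\alpha\wedge1}{1+\alpha\wedge1}}n^{-\frac{2(\alpha\wedge1)}{1+\alpha\wedge1}}+\frac{r\log(\rho_n n)}{n}+\frac{\rho_n^2}{n^{\alpha\wedge1}}\right\}.$$
   Context: A graphon is a symmetric measurable function $W:[0,1]^2\to[0,1]$. Sparse graphon model: $W_0$ is a graphon, $\xi_1,\dots,\xi_n$ are unobserved i.i.d. uniform on $[0,1]$, $\boldsymbol\Theta_0$ is the symmetric $n\times n$ matrix with zero diagonal and $(\boldsymbol\Theta_0)_{ij}=\rho_nW_0(\xi_i,\xi_j)$ for $j<i$. Conditionally on $(\xi_i)$, the observations $\boldsymbol A'=(\boldsymbol A_{ij},1\le j<i\le n)$ are independent Bernoulli with parameters $(\boldsymbol\Theta_0)_{ij}$. $\mathbb E$ is expectation over the joint distribution. Hölder class: $\Sigma(\alpha,L)$ is the set of $W:[0,1]^2\to[0,1]$ such that $|W(x',y')-\mathcal P_{\ell}((x,y),(x'-x,y'-y))|\le L(|x'-x|^{\alpha-\ell}+|y'-y|^{\alpha-\ell})$ for all $(x',y'),(x,y)\in[0,1]^2$, where $\ell$ is the maximal integer strictly less than $\alpha$ and $(x',y')\mapsto\mathcal P_\ell((x,y),(x'-x,y'-y))$ is the Taylor polynomial of $W$ of degree $\ell$ at $(x,y)$. Every such $W$ satisfies $|W(x',y')-W(x,y)|\le M(|x'-x|^{\alpha\wedge1}+|y'-y|^{\alpha\wedge1})$ with $M$ depending only on $\alpha,L$. Matrix estimators: $\mathcal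 Z_{n,k,n_0}$ is the set of maps $z:\{1,\dots,n\}\to\{1,\dots,k\}$ all of whose fibers have at least $n_0$ elements; $\mathcal Z_{n,k}=\mathcal Z_{n,k,1}$. Let $L(\boldsymbol Q,z)=\sum_{1\le j<i\le n}(\boldsymbol A_{ij}-\boldsymbol Q_{z(i)z(j)})^2$. Least squares estimator $\widehat{\boldsymbol\Theta}$: take a minimizer $(\widehat{\boldsymbol Q},\hat z)$ of $L$ over symmetric real $k\times k$ matrices $\boldsymbol Q$ and $z\in\mathcal Z_{n,k,n_0}$, and let $\widehat{\boldsymbol\Theta}$ be the symmetric matrix with zero diagonal and $\widehat{\boldsymbol\Theta}_{ij}=\widehat{\boldsymbol Q}_{\hat z(i)\hat z(j)}$, $i>j$. Restricted least squares estimator $\widehat{\boldsymbol\Theta}^r$, $r\in(0,1]$: the same with the minimum over symmetric $\boldsymbol Q$ with $\max_{a,b}|\boldsymbol Q_{ab}|\le r$ and $z\in\mathcal Z_{n,k}$. Graphon estimators: for an $n\times n$ matrix $\boldsymbol\Theta$, the empirical graphon is $\widetilde f_{\boldsymbol\Theta}(x,y)=\boldsymbol\Theta_{\lceil nx\rceil,\lceil ny\rceil}$ for $x,y\in(0,1]$; $\widehat f=\widetilde f_{\widehat{\boldsymbol\Theta}}$ and $\widehat f_r=\widetilde f_{\widehat{\boldsymbol\Theta}^r}$. Loss: $\delta^2(\check f,f_0)=\inf_\tau\iint_{(0,1)^2}|f_0(\tau(x),\tau(y))-\check f(x,y)|^2\,dx\,dy$, the infimum over all measure-preserving bijections $\tau:[0,1]\to[0,1]$.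 $\lfloor\cdot\rfloor$, $\lceil\cdot\rceil$ are the usual floor and ceiling; $a\wedge b=\min(a,b)$. *)

(* Defs.v *)
From HB Require Import structures.
From mathcomp Require Import all_boot all_order all_algebra.
From mathcomp Require Import all_classical all_reals all_analysis.

Set Implicit Arguments.
Unset Strict Implicit.
Unset Printing Implicit Defensive.

Import Order.TTheory GRing.Theory Num.Theory.
Import numFieldNormedType.Exports.

Local Open Scope classical_set_scope.
Local Open Scope ring_scope.

Section Graphons.
Context {R : realType}.

(* Functions on [0,1]^2 are total functions on R * R of which only the values
   on the unit square are ever constrained or used. *)
Definition unit_square : set (R * R) := `[0, 1] `*` `[0, 1].

Definition unit_valued (W : R * R -> R) : Prop :=
  forall z, unit_square z -> 0 <= W z <= 1.

Definition graphon (W : R * R -> R) : Prop :=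
  [/\ unit_valued W,
      measurable_fun unit_square W &
      forall x y, unit_square (x, y) -> W (x, y) = W (y, x)].

(* Derivative of g at x relative to [0,1]: one-sided at 0 and at 1. *)
Definition unit_derivative (g : R -> R) (x l : R) : Prop :=
  (fun t => (g t - g x) / (t - x)) @ within `[0, 1] x^' --> l.

(* D i j is the partial derivative of W on [0,1]^2 of order i in the first
   variable and j in the second one, for all i + j <= l. *)
Definition partial_derivatives (l : nat) (W : R * R -> R)
    (D : nat -> nat -> R * R -> R) : Prop :=
  (forall z, unit_square z -> D 0%N 0%N z = W z) /\
  (forall i j, (i + j < l)%N -> forall x y, unit_square (x, y) ->
     unit_derivative (fun t => D i j (t, y)) x (D i.+1 j (x, y)) /\
     unit_derivative (fun t => D i j (x, t)) y (D i j.+1 (x, y))).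

Definition taylor_polynomial (l : nat) (D : nat -> nat -> R * R -> R)
    (z h : R * R) : R :=
  \sum_(i < l.+1) \sum_(j < l.+1 | (i + j <= l)%N)
    D i j z / (i`! * j`!)%:R * h.1 ^+ i * h.2 ^+ j.

(* The maximal integer strictly less than alpha, for alpha > 0. *)
Definition holder_order (alpha : R) : nat := (absz (Num.ceil alpha)).-1.

Definition holder_class (alpha L : R) (W : R * R -> R) : Prop :=
  let l := holder_order alpha in
  unit_valued W /\
  exists2 D, partial_derivatives l W D &
    forall x y x' y', unit_square (x, y) -> unit_square (x', y') ->
      `|W (x', y') - taylor_polynomial l D (x, y) (x' - x, y' - y)|
      <= L * (`|x' - x| `^ (alpha - l%:R) + `|y' - y| `^ (alpha - l%:R)).

(* Ordinals of 'I_n start at 0, so the cell (i, j) is the set of (x, y) with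
   ceil (n x) = i + 1 and ceil (n y) = j + 1; the value is 0 outside (0,1]^2. *)
Definition empirical_graphon n (Theta : 'M[R]_n) (z : R * R) : R :=
  \sum_(i < n) \sum_(j < n)
    if (Num.ceil (n%:R * z.1) == Posz i.+1) &&
       (Num.ceil (n%:R * z.2) == Posz j.+1)
    then Theta i j else 0.

Definition measure_preserving_bijection (tau : R -> R) : Prop :=
  [/\ set_bij `[0, 1] `[0, 1] tau,
      measurable_fun (`[0, 1] : set R) tau &
      forall B : set R, measurable B -> B `<=` `[0, 1] ->
        lebesgue_measure (`[0, 1] `&` tau @^-1` B) = lebesgue_measure B].

Definition open_unit_square : set (R * R) := `]0, 1[ `*` `]0, 1[.

Definition delta2 (f f0 : R * R -> R) : \bar R :=
  ereal_inf [set (\int[(lebesgue_measure \x lebesgue_measure)%E]_(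
                     z in open_unit_square)
                   (`|f0 (tau z.1, tau z.2) - f z| ^+ 2)%:E)%E
            | tau in measure_preserving_bijection].

End Graphons.

(* The symmetric matrix with entries g i j for j < i and diagonal x0. *)
Definition sym_mx (T : Type) (x0 : T) n (g : 'I_n -> 'I_n -> T) : 'M[T]_n :=
  \matrix_(i, j) if (j < i)%N then g i j else
                 if (i < j)%N then g j i else x0.

Section Model.
Context {R : realType} {d : measure_display} {Omega : measurableType d}.
Variable P : probability Omega R.

Definition mutually_independent d' (T : measurableType d') n
    (X : 'I_n -> {RV P >-> T}) : Prop :=
  forall (J : {set 'I_n}) (B : 'I_n -> set T),
    (forall i, i \in J -> measurable (B i)) ->
    P [set w | forall i, i \in J -> B i (X i w)]
    = (\prod_(i in J) P (X i @^-1` B i))%E.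

Definition generated_sigma_algebra n (X : 'I_n -> {RV P >-> R}) :
    set (set Omega) :=
  <<s \bigcup_(i in [set: 'I_n])
        preimage_set_system setT (X i) measurable >>.

Definition Theta0 n (rho : R) (W0 : R * R -> R) (xi : 'I_n -> {RV P >-> R})
    (w : Omega) : 'M[R]_n :=
  sym_mx 0 (fun i j => rho * W0 (xi i w, xi j w)).

(* Only the A i j with j < i are observed. The last clause says that, for all
   binary values a, the conditional probability of {A i j = a i j, j < i} given
   the sigma-algebra of xi is the product of the Bernoulli(Theta0 i j) masses. *)
Definition sparse_graphon_model n (rho : R) (W0 : R * R -> R)
    (xi : 'I_n -> {RV P >-> R}) (A : 'I_n -> 'I_n -> {RV P >-> bool}) : Prop :=
  [/\ forall i w, 0 <= xi i w <= 1,
      forall i (B : set R), measurable B ->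
        distribution P (xi i) B = uniform_prob (@ltr01 R) B,
      mutually_independent xi &
      forall E, generated_sigma_algebra xi E -> forall a : 'I_n -> 'I_n -> bool,
        P (E `&` [set w | forall i j : 'I_n, (j < i)%N -> A i j w = a i j])
        = (\int[P]_(w in E)
             (\prod_(i < n) \prod_(j < n | (j < i)%N)
                bernoulli_pmf (Theta0 rho W0 xi w i j) (a i j))%:E)%E].

Definition adjacency n (A : 'I_n -> 'I_n -> {RV P >-> bool}) (w : Omega) :
    'M[bool]_n :=
  sym_mx false (fun i j => A i j w).

End Model.

Section Estimators.
Context {R : realType}.

Definition ls_loss n k (a : 'M[bool]_n) (Q : 'M[R]_k) (z : 'I_n -> 'I_k) : R :=
  \sum_(i < n) \sum_(j < n | (j < i)%N) ((a i j)%:R - Q (z i) (z j)) ^+ 2.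

Definition block_maps n k (n0 : nat) (z : 'I_n -> 'I_k) : Prop :=
  forall b : 'I_k, (n0 <= #|[pred i | z i == b]|)%N.

Definition ls_fit n k (S : 'M[R]_k -> Prop) (n0 : nat) (a : 'M[bool]_n)
    (Theta : 'M[R]_n) : Prop :=
  exists (Q : 'M[R]_k) (z : 'I_n -> 'I_k),
    [/\ S Q, block_maps n0 z,
        forall Q' z', S Q' -> block_maps n0 z' ->
          ls_loss a Q z <= ls_loss a Q' z' &
        Theta = sym_mx 0 (fun i j => Q (z i) (z j))].

(* An estimator maps the data to a matrix; the minimizer may be selected in an
   arbitrary way among all of them. *)
Definition least_squares_estimator n (k n0 : nat)
    (est : 'M[bool]_n -> 'M[R]_n) : Prop :=
  forall a, ls_fit (fun Q : 'M[R]_k => Q^T = Q) n0 a (est a).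

Definition restricted_least_squares_estimator n (k : nat) (r : R)
    (est : 'M[bool]_n -> 'M[R]_n) : Prop :=
  forall a, ls_fit
    (fun Q : 'M[R]_k => Q^T = Q /\ forall b c, `|Q b c| <= r) 1 a (est a).

Definition block_number (alpha rho : R) (n : nat) : nat :=
  let a := Num.min alpha 1 in
  absz (Num.ceil
    (if n%:R `^ (a - 1) <= rho then (Num.sqrt rho * n%:R) `^ (1 + a)^-1
     else (rho * n%:R) `^ (2 * a)^-1)).

End Estimators.

(* Main.v *)
(* Conditionally on the sample xi, the least squares estimator satisfies an
   oracle inequality over the block constant matrices: its squared error is at
   most that of any fixed competitor plus the supremum, over the k^n labellings,
   of the correlation of the noise with the block constant matrices.  For a
   fixed labelling the exponential moments of this supremum are bounded by
   12^(number of blocks), which gives the variance r (n log k + k^2).  Without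
   the bound r on the entries, the fitted values are block averages, and blocks
   with an average much larger than rho are ruled out by a union bound over all
   pairs of vertex sets of size at least n0.  The competitor assigns to vertex i
   the block of its rank among the sample; the same ranks define the
   rearrangement of cells tau that aligns the empirical graphon with f_0.  Both
   approximations reduce to the distance between xi_i and (rank of xi_i) / n,
   whose squares sum to O(1) in expectation: they have the same sum as the
   squared deviations of the empirical distribution function. *)

Require Import Defs.
From HB Require Import structures.
From mathcomp Require Import all_boot all_order all_algebra.
From mathcomp Require Import all_classical all_reals all_analysis.
From mathcomp Require Import fingroup perm measurable_realfun.
From mathcomp Require Import ring lra zify.

Set Implicit Arguments.
Unset Strict Implicit.
Unset Printing Implicit Defensive.

Import Order.TTheory GRing.Theory Num.Theory.
Import numFieldNormedType.Exports.

Local Open Scope classical_set_scope.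
Local Open Scope ring_scope.

(** * Bernoulli noise *)

Section BernoulliProduct.
Context {R : realType} {I : finType}.
Implicit Types (theta V : I -> R) (F G : {ffun I -> bool} -> R).

(** The variance scales with [r] because a centred Bernoulli variable of parameter p has moment
    generating function at most exp(p t^2) for |t| <= 1/4. Deviations of at most 2 r then allow the
    multiplier 1 / (8 r), used throughout: at it, the noise minus one eighth of the squared norm has
    exponential moment at most 1.

    Fitted entries range over a continuum and depend on the data. In place of a net, a weighted sum
    over finitely many deterministic slopes dominates the supremum in each block; 12 is twice the
    bound 6 on the total weight, once for each sign.

    The loss is an infimum over uncountably many bijections, and the sorting permutation is chosen
    outcome by outcome. Both occur in pointwise bounds only: what is finally integrated depends on
    the sample through [Theta0] and [discrepancy], which are measurable.

    Hölder exponents enter through (n x^2)^a <= 1 + n x^2, which turns powers of distances into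
    squares at the price of a factor n^(-a). The two formulas for k are a single one, the ceiling of
    the smaller of the two expressions. *)

Definition Ex theta F : R :=
  \sum_(a : {ffun I -> bool}) (\prod_i bernoulli_pmf (theta i) (a i)) * F a.

Lemma Ex_prod theta (g : I -> bool -> R) :
  Ex theta (fun a => \prod_i g i (a i)) =
  \prod_i (theta i * g i true + (1 - theta i) * g i false).
Proof.
transitivity (\sum_(a : {ffun I -> bool})
    \prod_i (bernoulli_pmf (theta i) (a i) * g i (a i))).
  by apply: eq_bigr => a _; rewrite big_split.
rewrite -(bigA_distr_bigA (fun i b => bernoulli_pmf (theta i) b * g i b)) /=.
by apply: eq_bigr => i _; rewrite big_bool /bernoulli_pmf.
Qed.

Lemma Ex_cst theta c : Ex theta (fun=> c) = c.
Proof.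
rewrite /Ex -mulr_suml -[RHS]mul1r; congr (_ * _).
have := Ex_prod theta (fun _ _ => 1); rewrite [RHS]big1 => [h|i _ /=]; last by lra.
by rewrite -[RHS]h; apply: eq_bigr => a _; rewrite [X in _ * X]big1 ?mulr1.
Qed.

Lemma Ex_le theta F G : (forall i, 0 <= theta i <= 1) ->
  (forall a, F a <= G a) -> Ex theta F <= Ex theta G.
Proof.
move=> t01 FG; apply: ler_sum => a _; apply: ler_wpM2l => //.
by apply: prodr_ge0 => i _; apply: bernoulli_pmf_ge0.
Qed.

Lemma ExD theta F G : Ex theta (fun a => F a + G a) = Ex theta F + Ex theta G.
Proof. by rewrite /Ex -big_split /=; apply: eq_bigr => a _; rewrite mulrDr. Qed.

Lemma ExZ theta c F : Ex theta (fun a => c * F a) = c * Ex theta F.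
Proof. by rewrite /Ex mulr_sumr; apply: eq_bigr => a _; rewrite mulrCA. Qed.

Lemma Ex_sum theta (T : finType) (F : T -> {ffun I -> bool} -> R) (P : pred T) :
  Ex theta (fun a => \sum_(t | P t) F t a) = \sum_(t | P t) Ex theta (F t).
Proof.
rewrite /Ex exchange_big /=; apply: eq_bigr => a _.
by rewrite mulr_sumr.
Qed.

Definition noise theta (a : {ffun I -> bool}) i : R := (a i)%:R - theta i.

Definition noise_dot theta a V : R := \sum_i noise theta a i * V i.

Lemma Ex_coord theta i : Ex theta (fun a => (a i)%:R) = theta i.
Proof.
transitivity (Ex theta (fun a => \prod_j (if j == i then (a j)%:R else 1))).
  congr (Ex theta); apply/funext => a.
  by rewrite -big_mkcond big_pred1_eq.
rewrite (Ex_prod theta (fun j b => if j == i then b%:R else 1)).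
rewrite (bigD1 i) //= eqxx mulr1 mulr0 addr0 big1 ?mulr1 // => j /negbTE ->.
lra.
Qed.

Lemma Ex_noise_dot theta V : Ex theta (fun a => noise_dot theta a V) = 0.
Proof.
rewrite (Ex_sum theta (fun i a => noise theta a i * V i)) big1 // => i _.
rewrite (_ : (fun _ => _) =
    (fun a : {ffun I -> bool} => V i * (a i)%:R + - (V i * theta i))).
  by rewrite ExD ExZ Ex_cst Ex_coord subrr.
by apply/funext => a; rewrite /noise; ring.
Qed.

(** For t <= 0 the bound exp t <= 1 / (1 - t) suffices, as (1 - t)(1 + t + t^2) = 1 - t^3 >= 1. For
    t > 0 that reciprocal is too large; (1 - t / 2)^-2 has second order coefficient 3/4 < 1 and
    works as long as 1 - 3 t + t^2 >= 0, in particular up to 1/4. *)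
Lemma expR_le_quadratic (t : R) : `|t| <= 1 / 4 -> expR t <= 1 + t + t ^+ 2.
Proof.
rewrite ler_norml => /andP[t1 t2].
have e0 := expR_gt0 t.
have [t0|t0] := leP t 0.
  have := expR_ge1Dx (- t); rewrite expRN => h.
  have h1 : (1 - t) * expR t <= 1 by rewrite -ler_pdivlMr // mul1r.
  have : (1 - t) * expR t <= (1 - t) * (1 + t + t ^+ 2).
    apply: le_trans h1 _; rewrite -subr_ge0.
    have -> : (1 - t) * (1 + t + t ^+ 2) - 1 = (- t) * t ^+ 2 by ring.
    by rewrite mulr_ge0 ?sqr_ge0 // oppr_ge0.
  by rewrite ler_pM2l //; lra.
have [e eE] : exists e : R, e = expR (- (t / 2)) by eexists.
have := expR_ge1Dx (- (t / 2)); rewrite -eE => h.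
have ee : e ^+ 2 * expR t = 1.
  by rewrite eE expr2 -!expRD -[RHS]expR0; congr expR; lra.
have h2 : (1 - t / 2) ^+ 2 <= e ^+ 2.
  by rewrite ler_sqr ?nnegrE //; [lra | lra].
have h1 : (1 - t / 2) ^+ 2 * expR t <= 1 by rewrite -[leRHS]ee ler_pM2r.
have : (1 - t / 2) ^+ 2 * expR t <= (1 - t / 2) ^+ 2 * (1 + t + t ^+ 2).
  apply: le_trans h1 _; rewrite -subr_ge0.
  have -> : (1 - t / 2) ^+ 2 * (1 + t + t ^+ 2) - 1
    = t ^+ 2 / 4 * (1 - 3 * t + t ^+ 2) by field.
  by rewrite mulr_ge0 ?divr_ge0 ?sqr_ge0 //; nra.
by rewrite ler_pM2l // exprn_gt0 //; lra.
Qed.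

(** Factoring out exp(- p t) leaves 1 + p (exp t - 1), and 1 + x <= exp x keeps the factor p in the
    exponent. A bound of Hoeffding type, blind to p, would lose the sparsity. *)
Lemma bernoulli_mgf_le (p t : R) : 0 <= p <= 1 -> `|t| <= 1 / 4 ->
  p * expR ((1 - p) * t) + (1 - p) * expR (- p * t) <= expR (p * t ^+ 2).
Proof.
move=> p01 t1; have := expR_le_quadratic t1 => et.
have -> : p * expR ((1 - p) * t) + (1 - p) * expR (- p * t)
    = (1 + p * (expR t - 1)) * expR (- p * t).
  by rewrite (_ : (1 - p) * t = t + - p * t) ?expRD; ring.
apply: (@le_trans _ _ (expR (p * (expR t - 1)) * expR (- p * t))).
  by rewrite ler_pM2r ?expR_gt0 // expR_ge1Dx.
rewrite -expRD ler_expR; nra.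
Qed.

(** The multiplier l = 1 / (8 r) is calibrated twice: |V i| <= 2 r puts l V i in [-1/4, 1/4], and
    theta i <= r makes the variance term theta i (l V i)^2 at most l (V i)^2 / 8, which the penalty
    cancels coordinate by coordinate. *)
Lemma Ex_expR_noise_le1 theta V rho r : (forall i, 0 <= theta i <= rho) ->
  rho <= 1 -> 0 < r -> rho <= r -> (forall i, `|V i| <= 2 * r) ->
  Ex theta (fun a => expR ((8 * r)^-1 *
     (noise_dot theta a V - 8^-1 * \sum_i V i ^+ 2))) <= 1.
Proof.
move=> t0 rho1 r0 rr Vr; set l := (8 * r)^-1.
have l0 : 0 < l by rewrite invr_gt0; lra.
pose g i (b : bool) := expR ((b%:R - theta i) * (l * V i))
   * expR (- (8^-1 * l * V i ^+ 2)).
rewrite (_ : (fun _ => _) = fun a : {ffun I -> bool} => \prod_i g i (a i)); last first.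
  apply/funext => a; rewrite /g big_split /= -!expR_sum -expRD; congr expR.
  rewrite mulrBr /noise_dot !mulr_sumr -sumrN; congr (_ + _);
    by apply: eq_bigr => i _; rewrite /noise; ring.
rewrite Ex_prod; apply: Num.Theory.prodr_ile1 => i _; have /andP[ti0 ti1] := t0 i.
apply/andP; split.
  by rewrite addr_ge0 // mulr_ge0 ?mulr_ge0 ?expR_ge0 //; lra.
have lV : `|l * V i| <= 1 / 4.
  rewrite normrM gtr0_norm // /l mulrC ler_pdivrMr; last lra.
  by have := Vr i; lra.
have h : theta i * expR ((1 - theta i) * (l * V i)) +
   (1 - theta i) * expR (- theta i * (l * V i)) <= expR (theta i * (l * V i) ^+ 2).
  by apply: bernoulli_mgf_le => //; lra.
have -> : theta i * g i true + (1 - theta i) * g i false =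
    (theta i * expR ((1 - theta i) * (l * V i)) +
     (1 - theta i) * expR (- theta i * (l * V i))) *
    expR (- (8^-1 * l * V i ^+ 2)).
  by rewrite /g sub0r; ring.
apply: (@le_trans _ _ (expR (theta i * (l * V i) ^+ 2) *
                       expR (- (8^-1 * l * V i ^+ 2)))).
  by rewrite ler_pM2r ?expR_gt0.
rewrite -expRD expR_le1.
have -> : theta i * (l * V i) ^+ 2 - 8^-1 * l * V i ^+ 2 =
   (l * V i ^+ 2) * (theta i * l - 8^-1) by ring.
rewrite mulr_ge0_le0 //; first by rewrite mulr_ge0 ?sqr_ge0 ?ltW.
rewrite subr_le0 /l ler_pdivrMr; last lra.
lra.
Qed.
End BernoulliProduct.

(** The quadratic bound at 1/4 gives e <= (21/16)^4 < 4. This lets ln (rho n) absorb additive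
    constants. *)
Lemma ln4_ge1 (R : realType) (x : R) : 4 <= x -> 1 <= ln x.
Proof.
move=> x4; rewrite -ler_expR lnK ?posrE; last lra.
apply: le_trans x4; have h := @expR_le_quadratic R (1 / 4).
have {}h : expR (1 / 4) <= 21 / 16 :> R.
  by apply: le_trans (h _) _; rewrite ?ger0_norm //; lra.
have -> : expR 1 = expR (1 / 4) ^+ 4 :> R by rewrite -expRM_natl; congr expR; lra.
apply: (@le_trans _ _ ((21 / 16) ^+ 4)); last by lra.
by rewrite lerXn2r // ?nnegrE ?expR_ge0 //; lra.
Qed.


(** * Exponential moments of block constant fits *)

Section Mixture.
Context {R : realType}.

(** For an empty block m = 0, and division by zero makes every level 0. *)
Definition level (lam r m : R) (j : nat) : R :=
  Num.min (2 * r) (Num.sqrt (8 * j%:R / (lam * m))).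

(** Summable, yet weight j * exp j = exp((j + 1) / 2) still dominates exp(u / 2) for all u < j + 1.
    Halving the exponent in [expR_slope_le_mixture] is the price of this summability. *)
Definition weight (j : nat) : R := expR (1 / 2 - j%:R / 2).

Lemma sum_weight_le N : \sum_(j < N) weight j <= 6.
Proof.
have e1 : expR (1 / 2 : R) <= 2.
  have := expR_ge1Dx (- (1 / 2) : R); rewrite expRN => h.
  have e0 := expR_gt0 (1 / 2 : R).
  rewrite -[leLHS]invrK invf_ple ?posrE ?invr_gt0 //; lra.
have e2 : expR (- (1 / 2) : R) <= 2 / 3.
  have := expR_ge1Dx (1 / 2 : R) => h; have e0 := expR_gt0 (1 / 2 : R).
  rewrite expRN invf_ple ?posrE //; lra.
have -> : \sum_(j < N) weight j = expR (1 / 2) * \sum_(j < N) expR (- (1 / 2)) ^+ j.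
  rewrite mulr_sumr; apply: eq_bigr => j _; rewrite /weight -expRM_natl -expRD.
  by congr expR; field.
have : \sum_(j < N) expR (- (1 / 2) : R) ^+ j <= 3.
  apply: (@le_trans _ _ (3 - 3 * (2 / 3) ^+ N)); last first.
    by rewrite gerBl mulr_ge0 // exprn_ge0 //; lra.
  elim: N => [|N IH]; first by rewrite big_ord0 expr0; lra.
  rewrite big_ord_recr /=.
  have : expR (- (1 / 2) : R) ^+ N <= (2 / 3) ^+ N.
    by rewrite lerXn2r // ?nnegrE ?expR_ge0 //; lra.
  rewrite exprS; move: IH; set x := _ ^+ N; set y := _ ^+ N; lra.
have : 0 <= \sum_(j < N) expR (- (1 / 2) : R) ^+ j.
  by apply: sumr_ge0 => j _; rewrite exprn_ge0 // expR_ge0.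
move: e1 (expR_gt0 (1 / 2 : R)); set x := expR _; set y := \sum_(_ < _) _.
nra.
Qed.

Lemma level_ge0 (lam r m : R) j : 0 < r -> 0 <= level lam r m j.
Proof. by move=> r0; rewrite le_min sqrtr_ge0 andbT; lra. Qed.

Lemma level_le (lam r m : R) j : level lam r m j <= 2 * r.
Proof. by rewrite ge_min lexx. Qed.

(* The function q |-> c / q + m q / 8 is minimal on ]0, 2 r] at the level of c,
   so whichever slope q exceeds c, the slope at this level does. *)
Lemma level_slope (lam r m : R) (j : nat) (S q : R) : 0 < lam -> 0 < m -> 0 < q <= 2 * r ->
  j%:R / lam <= S * q - m * q ^+ 2 / 8 ->
  j%:R / lam <= S * level lam r m j - m * level lam r m j ^+ 2 / 8.
Proof.
move=> lam0 m0 /andP[q0 qr]; set c := j%:R / lam.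
have c0 : 0 <= c by rewrite divr_ge0 // ltW.
have r0 : 0 < r by lra.
have := level_ge0 lam m j r0.
have sE : Num.sqrt (8 * j%:R / (lam * m)) ^+ 2 = 8 * c / m.
  rewrite sqr_sqrtr; last by rewrite !divr_ge0 ?mulr_ge0 // ltW.
  by rewrite /c; field; rewrite !gt_eqF.
have s0 := sqrtr_ge0 (8 * j%:R / (lam * m)).
rewrite /level; move: sE s0; set s := Num.sqrt _ => sE s0.
have smE : m * s ^+ 2 / 8 = c by rewrite sE; field; rewrite gt_eqF.
set L := Num.min _ _ => L0 h.
(* Comparison of c / q + m q / 8 with its value at L, cleared of denominators because L may be 0. If
   q <= L <= s, then m L q / 8 <= m s^2 / 8 = c; if L < q <= 2 r, the cap is not active and L =
   s. *)
have key : 0 <= (L - q) * (c - m * L * q / 8).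
  have [qL|Lq] := leP q L.
    apply: mulr_ge0; first by rewrite subr_ge0.
    have Ls : L <= s by rewrite /L ge_min lexx orbT.
    rewrite subr_ge0 -smE; have : L * q <= s ^+ 2.
      by rewrite expr2; apply: ler_pM => //; [exact: ltW | lra].
    by nra.
  have Ls : L = s.
    by move: Lq; rewrite /L; case: (leP (2 * r) s) => _ Lq; lra.
  rewrite mulr_le0 // subr_le0; first exact: ltW.
  rewrite -smE -Ls; have : 0 <= m * L * (q - L).
    by rewrite !mulr_ge0 // ?subr_ge0 ltW.
  by lra.
have : 0 <= q * (S * L - m * L ^+ 2 / 8 - c).
  have : L * (c + m * q ^+ 2 / 8) <= L * (S * q).
    by apply: ler_wpM2l => //; lra.
  have e : (L - q) * (c - m * L * q / 8) =
    L * (c + m * q ^+ 2 / 8) - q * (c + m * L ^+ 2 / 8) by field.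
  by rewrite e in key; lra.
by rewrite pmulr_rge0 // subr_ge0.
Qed.

(** Finite substitute for the supremum over a data dependent slope: [t.1] selects a magnitude and
    [t.2] a sign, both fixed before the noise S is seen. *)
Definition mixture (lam r m S : R) N : R :=
  \sum_(t : 'I_N * bool) weight t.1 *
    expR (lam * (S * ((-1) ^+ t.2 * level lam r m t.1)
                 - m * ((-1) ^+ t.2 * level lam r m t.1) ^+ 2 / 8)).

(* The term whose level is the integer part of lam (S q - m q^2 / 8) dominates;
   it has a slope that does not depend on S, so its expectation is computable. *)
Lemma expR_slope_le_mixture (lam r m S q : R) N : 0 < lam -> 0 < r -> 0 <= m ->
  (m = 0 -> S = 0) -> `|q| <= 2 * r -> lam * (2 * r * `|S|) < N%:R ->
  expR (lam / 2 * (S * q - m * q ^+ 2 / 8)) <= mixture lam r m S N.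
Proof.
move=> lam0 r0 m0 mS qr SN.
have N0 : (0 < N)%N.
  by rewrite -(ltr_nat R); apply: le_lt_trans SN; rewrite !mulr_ge0 // ltW.
have pos (t : 'I_N * bool) : 0 <= weight t.1 *
    expR (lam * (S * ((-1) ^+ t.2 * level lam r m t.1)
                 - m * ((-1) ^+ t.2 * level lam r m t.1) ^+ 2 / 8)).
  by rewrite mulr_ge0 ?expR_ge0.
have term (t : 'I_N * bool) : weight t.1 *
    expR (lam * (S * ((-1) ^+ t.2 * level lam r m t.1)
                 - m * ((-1) ^+ t.2 * level lam r m t.1) ^+ 2 / 8)) <=
    mixture lam r m S N.
  by rewrite /mixture (bigD1 t) //= lerDl sumr_ge0.
set u := lam * (S * q - m * q ^+ 2 / 8).
have -> : lam / 2 * (S * q - m * q ^+ 2 / 8) = u / 2 by rewrite /u; field.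
(* Below 1 the term of level 0 is enough: it equals [weight 0], that is exp(1 / 2), which is where
   the normalisation of the weights comes from. *)
have [u1|u1] := ltP u 1.
  apply: le_trans (term (Ordinal N0, false)) => /=.
  have -> : level lam r m 0 = 0.
    by rewrite /level mulr0 mul0r sqrtr0; apply/min_idPr; lra.
  rewrite /weight mulr0 expr0n /= !(mulr0, mul0r, subr0) expR0 mulr1.
  by rewrite ler_expR; lra.
have uS : u <= lam * (2 * r * `|S|).
  rewrite /u ler_pM2l //; apply: (@le_trans _ _ (S * q)).
    by rewrite gerBl divr_ge0 // mulr_ge0 // sqr_ge0.
  by rewrite (le_trans (ler_norm _)) // normrM mulrC ler_wpM2r.
have {}m0 : 0 < m.
  rewrite lt_def m0 andbT; apply/eqP => /[dup] /mS S0 mm.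
  by move: u1; rewrite /u S0 mm !mul0r subrr mulr0; lra.
have q0 : q != 0.
  apply/eqP => qq; move: u1; rewrite /u qq expr0n /= !mulr0 mul0r subrr mulr0.
  lra.
have /andP[ju uj] := truncn_itv (le_trans ler01 u1).
set j := Num.truncn u in ju uj.
have jN : (j < N)%N.
  by rewrite -(ltr_nat R); apply: le_lt_trans (le_lt_trans uS SN).
set b := q < 0.
have qE : q = (-1) ^+ b * `|q|.
  by rewrite {1}(numEsign q).
have bb : ((-1) ^+ b) ^+ 2 = 1 :> R by rewrite sqrr_sign.
apply: le_trans (term (Ordinal jN, b)) => /=.
have : j%:R / lam <= (S * (-1) ^+ b) * level lam r m j - m * level lam r m j ^+ 2 / 8.
  apply: (@level_slope _ _ _ _ _ `|q|) => //; first by rewrite normr_gt0 q0.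
  rewrite ler_pdivrMr // -[_ * _ * `|q|]mulrA -qE real_normK ?num_real //.
  by rewrite mulrC.
rewrite ler_pdivrMr // -[_ * _ * level _ _ _ _]mulrA => hL.
rewrite exprMn bb mul1r /weight -expRD ler_expR.
move: hL uj; rewrite -natr1 mulrC => hL uj.
lra.
Qed.

End Mixture.

Section BlockMixture.
Context {R : realType} {I J : finType}.
Variables (theta : I -> R) (rho r : R).
Hypothesis theta0 : forall i, 0 <= theta i <= rho.
Hypotheses (rho1 : rho <= 1) (r0 : 0 < r) (rr : rho <= r).

Definition block_size (B : I -> J) b : R := #|[pred i | B i == b]|%:R.

Definition block_noise (B : I -> J) a b : R :=
  \sum_(i | B i == b) noise theta a i.

Lemma noise_dot_block (B : I -> J) a (q : J -> R) :
  noise_dot theta a (fun i => q (B i)) = \sum_b block_noise B a b * q b.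
Proof.
rewrite /noise_dot (partition_big B xpredT) //=; apply: eq_bigr => b _.
by rewrite /block_noise mulr_suml; apply: eq_bigr => i /eqP ->.
Qed.

Lemma sum_block (B : I -> J) (q : J -> R) :
  \sum_i q (B i) = \sum_b block_size B b * q b.
Proof.
rewrite (partition_big B xpredT) //=; apply: eq_bigr => b _.
rewrite (eq_bigr (fun=> q b)) => [|i /eqP -> //].
by rewrite sumr_const /block_size mulr_natl.
Qed.

Lemma noise_le1 a i : `|noise theta a i| <= 1.
Proof.
have /andP[h1 h2] := theta0 i.
by rewrite /noise ler_norml; case: (a i) => /=; apply/andP; split; move: rho1; lra.
Qed.

Lemma block_noise_le (B : I -> J) a b : `|block_noise B a b| <= block_size B b.
Proof.
apply: le_trans (ler_norm_sum _ _ _) _.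
rewrite /block_size -sumr_const; apply: ler_sum => i _; exact: noise_le1.
Qed.

Definition block_mixture (B : I -> J) N a : R :=
  \prod_b mixture (8 * r)^-1 r (block_size B b) (block_noise B a b) N.

(** Expanding the product of sums gives one term for each choice f of a level and a sign in every
    block. Such an f is a deterministic block constant vector bounded by 2 r, so its exponential
    moment is at most 1. The weights that remain factorise into [#|J|] sums, each at most 2 * 6. *)
Lemma Ex_block_mixture (B : I -> J) N :
  Ex theta (block_mixture B N) <= 12 ^+ #|J|.
Proof.
set lam := (8 * r)^-1.
pose q b (t : 'I_N * bool) : R := (-1) ^+ t.2 * level lam r (block_size B b) t.1.
have E a : block_mixture B N a = \sum_(f : {ffun J -> 'I_N * bool})
   (\prod_b weight (f b).1) *
   expR (lam * (noise_dot theta a (fun i => q (B i) (f (B i)))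
      - 8^-1 * \sum_i q (B i) (f (B i)) ^+ 2)).
  rewrite /block_mixture /mixture.
  rewrite (bigA_distr_bigA (fun b (t : 'I_N * bool) => weight t.1 *
    expR (lam * (block_noise B a b * q b t - block_size B b * q b t ^+ 2 / 8)))).
  apply: eq_bigr => f _; rewrite big_split /=; congr (_ * _).
  rewrite -expR_sum; congr expR.
  rewrite (noise_dot_block B a (fun b => q b (f b))).
  rewrite (sum_block B (fun b => q b (f b) ^+ 2)).
  rewrite mulr_sumr -sumrB mulr_sumr; apply: eq_bigr => b _; ring.
rewrite (funext E).
rewrite (Ex_sum theta (fun (f : {ffun J -> 'I_N * bool}) a => (\prod_b weight (f b).1) *
   expR (lam * (noise_dot theta a (fun i => q (B i) (f (B i)))
      - 8^-1 * \sum_i q (B i) (f (B i)) ^+ 2)))).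
apply: (@le_trans _ _ (\sum_(f : {ffun J -> 'I_N * bool}) \prod_b weight (f b).1)).
  apply: ler_sum => f _; rewrite ExZ ler_piMr //.
    by apply: prodr_ge0 => b _; exact: expR_ge0.
  apply: (Ex_expR_noise_le1 theta0 rho1 r0 rr) => i.
  by rewrite /q normrM normr_sign mul1r ger0_norm ?level_ge0 // level_le.
rewrite -(bigA_distr_bigA (fun (_ : J) (t : 'I_N * bool) => weight t.1)) /=.
rewrite prodr_const; apply: lerXn2r.
- by rewrite nnegrE; apply: sumr_ge0 => t _; exact: expR_ge0.
- by rewrite nnegrE.
have := pair_bigA _ (fun (j : 'I_N) (b : bool) => weight (R := R) j) => /= <-.
under eq_bigr do rewrite big_bool /=.
by rewrite big_split /=; have := sum_weight_le (R := R) N; lra.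
Qed.

End BlockMixture.

(** * Oracle inequality *)

Section Oracle.
Context {R : realType} {I J Z : finType}.
Variables (theta : I -> R) (rho r : R).
Hypothesis theta0 : forall i, 0 <= theta i <= rho.
Hypotheses (rho1 : rho <= 1) (r0 : 0 < r) (rr : rho <= r).

Definition block_mean (B : I -> J) b : R :=
  (\sum_(i | B i == b) theta i) / block_size B b.

Lemma block_size_ge0 (B : I -> J) b : 0 <= block_size B b :> R.
Proof. by rewrite ler0n. Qed.

Lemma block_mean_mulr (B : I -> J) b :
  block_size B b * block_mean B b = \sum_(i | B i == b) theta i.
Proof.
rewrite /block_mean mulrC; have [s0|s0] := eqVneq (block_size B b : R) 0.
  rewrite s0 mulr0 big_pred0 // => i.
  move/eqP: s0; rewrite /block_size pnatr_eq0 => /eqP/card0_eq/(_ i).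
  by rewrite !inE.
by rewrite mulfVK.
Qed.

(** The maximum with 0 covers an empty index type, where nothing forces [rho] to be nonnegative
    while the mean of an empty block is 0 by convention. *)
Lemma block_mean_itv (B : I -> J) b : 0 <= block_mean B b <= Num.max rho 0.
Proof.
have s0 := block_size_ge0 B b.
apply/andP; split.
  by rewrite divr_ge0 // sumr_ge0 // => i _; case/andP: (theta0 i).
rewrite /block_mean; have [->|s1] := eqVneq (block_size B b : R) 0.
  by rewrite invr0 mulr0 le_max lexx orbT.
rewrite ler_pdivrMr ?lt_def ?s1 //.
rewrite /block_size mulrC mulr_natl -sumr_const; apply: ler_sum => i _.
by rewrite le_max; case/andP: (theta0 i) => _ ->.
Qed.

(** Bias of the labelling, with the sign for which fit - theta = (fit - block mean) + centre. This
    decomposition is orthogonal. *)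
Definition centre (B : I -> J) i : R := block_mean B (B i) - theta i.

Lemma centre_le (B : I -> J) i : `|centre B i| <= 2 * r.
Proof.
have /andP[t0 t1] := theta0 i; have /andP[m0] := block_mean_itv B (B i).
have -> : Num.max rho 0 = rho by apply/max_idPl; lra.
by move=> m1; rewrite /centre ler_norml; apply/andP; split; move: rr r0; lra.
Qed.

Lemma sum_centre_block (B : I -> J) (q : J -> R) :
  \sum_i q (B i) * centre B i = 0.
Proof.
rewrite (partition_big B xpredT) //= big1 // => b _.
rewrite (eq_bigr (fun i => q b * (block_mean B b - theta i))); last first.
  by move=> i /eqP Bi; rewrite /centre Bi.
rewrite -mulr_sumr sumrB -(block_mean_mulr B b) sumr_const mulr_natl.
by rewrite subrr mulr0.
Qed.

Lemma block_noise_eq0 (B : I -> J) a b :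
  block_size B b = 0 :> R -> block_noise theta B a b = 0.
Proof.
move=> s0; have := block_noise_le theta0 rho1 B a b.
by rewrite s0 normr_le0 => /eqP.
Qed.

(** Tangent inequality in the role of Jensen's: it is linear in exp x, so it can be averaged, and a
    mean of exp x at most exp K yields a mean of x at most K + 1. *)
Lemma le_expR_shift (x K : R) : x <= K + expR (- K) * expR x.
Proof. by have := expR_ge1Dx (x - K); rewrite addrC expRD mulrC; lra. Qed.

(** The error D splits into Sh, inside the block constant vectors, and the bias Sc. The coefficients
    of the first depend on the data, hence the mixture, with a sum over Z and a factor 12 per block
    (K1); the second depends on the labelling only, and a sum over Z suffices (K2). Each correlation
    costs one eighth of its squared norm and enters the basic inequality twice, so a quarter of D
    moves to the left and 3/4 remain. Slopes beyond 2 r are set to 0 and charged to [bad]. *)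
Theorem least_squares_oracle (B : Z -> I -> J) (zh : {ffun I -> bool} -> Z)
    (qh : {ffun I -> bool} -> J -> R) (tstar : I -> R)
    (bad : {ffun I -> bool} -> R) :
  let q' a b := qh a b - block_mean (B (zh a)) b in
  (forall a : {ffun I -> bool}, \sum_i ((a i)%:R - qh a (B (zh a) i)) ^+ 2 <=
             \sum_i ((a i)%:R - tstar i) ^+ 2) ->
  (forall a, \sum_(b | 2 * r < `|q' a b|)
      block_noise theta (B (zh a)) a b * q' a b <= bad a) ->
  3 / 4 * Ex theta (fun a => \sum_i (qh a (B (zh a) i) - theta i) ^+ 2) <=
  \sum_i (tstar i - theta i) ^+ 2
  + 32 * r * (ln #|Z|%:R + #|J|%:R * ln 12 + 1)
  + 16 * r * (ln #|Z|%:R + 1) + 2 * Ex theta bad.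
Proof.
move=> q' opt badP.
have Z0 : 0 < #|Z|%:R :> R.
  by rewrite ltr0n; apply/card_gt0P; exists (zh [ffun=> false]).
set K2 := ln #|Z|%:R; set K1 := K2 + #|J|%:R * ln 12.
have expK2 : expR K2 = #|Z|%:R by rewrite /K2 lnK // posrE.
have expK1 : expR K1 = #|Z|%:R * 12 ^+ #|J|.
  by rewrite expRD expK2 expRM_natl lnK // posrE.
pose lam := (8 * r)^-1.
have lam0 : 0 < lam by rewrite invr_gt0 mulr_gt0.
pose G a := \sum_z block_mixture theta r (B z) #|I|.+1 a.
pose H a := \sum_z expR (lam * (noise_dot theta a (centre (B z))
                            - 8^-1 * \sum_i centre (B z) i ^+ 2)).
have key a : 3 / 4 * \sum_i (qh a (B (zh a) i) - theta i) ^+ 2 <=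
    (\sum_i (tstar i - theta i) ^+ 2 + 32 * r * K1 + 16 * r * K2)
    + (32 * r * expR (- K1)) * G a + (16 * r * expR (- K2)) * H a
    + 2 * bad a + (- 2) * noise_dot theta a (fun i => tstar i - theta i).
  set z := zh a; set D := \sum_i _.
  set T := \sum_i (tstar i - theta i) ^+ 2.
  set Nh := \sum_b block_noise theta (B z) a b * q' a b.
  set Nc := noise_dot theta a (centre (B z)).
  set Nt := noise_dot theta a _.
  set Sh := \sum_b block_size (B z) b * q' a b ^+ 2.
  set Sc := \sum_i centre (B z) i ^+ 2.
  have hE i : qh a (B z i) - theta i = q' a (B z i) + centre (B z) i.
    by rewrite /q' /centre addrA subrK.
  have DE : D = Sh + Sc.
    transitivity (\sum_i (q' a (B z i) ^+ 2 + centre (B z) i ^+ 2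
                          + 2 * (q' a (B z i) * centre (B z) i))).
      by apply: eq_bigr => i _; rewrite hE; ring.
    rewrite !big_split /= -mulr_sumr sum_centre_block mulr0 addr0.
    by rewrite (sum_block (B z) (fun b => q' a b ^+ 2)).
  have basic : D <= T + 2 * (Nh + Nc) - 2 * Nt.
    have -> : Nh + Nc = noise_dot theta a (fun i => qh a (B z i) - theta i).
      rewrite /Nh -noise_dot_block /Nc /noise_dot -big_split /=.
      by apply: eq_bigr => i _; rewrite -mulrDr hE.
    rewrite /D /T /Nt /noise_dot !mulr_sumr -big_split /= -sumrB.
    have := opt a; rewrite -subr_ge0 -sumrB => h.
    rewrite -subr_ge0. rewrite -sumrB; apply: le_trans h _.
    by apply: ler_sum => i _; rewrite /noise le_eqVlt; apply/orP; left; apply/eqP; ring.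
  have h1 : Nh - 8^-1 * Sh <= 16 * r * (K1 + expR (- K1) * G a) + bad a.
    pose q'' b := if 2 * r < `|q' a b| then 0 else q' a b.
    have q''r b : `|q'' b| <= 2 * r.
      rewrite /q''; case: ltP => // _; rewrite normr0; move: r0; lra.
    set X := \sum_b (block_noise theta (B z) a b * q'' b
                     - block_size (B z) b * q'' b ^+ 2 / 8).
    have NX : Nh - 8^-1 * Sh <= X + bad a.
      apply: le_trans (lerD (lexx _) (badP a)).
      rewrite [in leRHS]big_mkcond /= /Nh /Sh mulr_sumr -sumrB -big_split /=.
      apply: ler_sum => b _; rewrite /q''.
      have s0 : 0 <= block_size (B z) b * q' a b ^+ 2.
        by rewrite mulr_ge0 ?block_size_ge0 ?sqr_ge0.
      case: ltP => _; last by lra.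
      by rewrite -/z expr0n /= !(mulr0, mul0r); lra.
    have XG : expR (lam / 2 * X) <= G a.
      apply: (@le_trans _ _ (block_mixture theta r (B z) #|I|.+1 a)); last first.
        rewrite /G (bigD1 z) //= lerDl sumr_ge0 // => z' _.
        apply: prodr_ge0 => b _; apply: sumr_ge0 => t _.
        by rewrite mulr_ge0 ?expR_ge0.
      rewrite /X mulr_sumr expR_sum; apply: ler_prod => b _.
      rewrite expR_ge0 /=; apply: expR_slope_le_mixture => //.
      - exact: block_noise_eq0.
      have := block_noise_le theta0 rho1 (B z) a b.
      have : block_size (B z) b <= #|I|%:R :> R by rewrite ler_nat max_card.
      (* A quarter of the block noise is at most #|I| / 4, so [#|I|.+1] levels suffice for every
         block. *)
      have -> : (8 * r)^-1 * (2 * r * `|block_noise theta (B z) a b|) =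
         `|block_noise theta (B z) a b| / 4.
        by field; rewrite gt_eqF.
      rewrite -[(#|I|.+1)%:R]natr1; have := normr_ge0 (block_noise theta (B z) a b); lra.
    apply: le_trans NX _; rewrite lerD2r.
    have := le_expR_shift (lam / 2 * X) K1.
    have : expR (- K1) * expR (lam / 2 * X) <= expR (- K1) * G a.
      by rewrite ler_pM2l ?expR_gt0.
    move=> h h'; have : lam / 2 * X <= K1 + expR (- K1) * G a by lra.
    have -> : lam / 2 * X = X / (16 * r) by rewrite /lam; field; rewrite gt_eqF.
    by rewrite ler_pdivrMr ?mulr_gt0 // mulrC.
  have h2 : Nc - 8^-1 * Sc <= 8 * r * (K2 + expR (- K2) * H a).
    have XH : expR (lam * (Nc - 8^-1 * Sc)) <= H a.
      by rewrite /H (bigD1 z) //= lerDl sumr_ge0 // => z' _; exact: expR_ge0.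
    have := le_expR_shift (lam * (Nc - 8^-1 * Sc)) K2.
    have : expR (- K2) * expR (lam * (Nc - 8^-1 * Sc)) <= expR (- K2) * H a.
      by rewrite ler_pM2l ?expR_gt0.
    move=> h h'; have : lam * (Nc - 8^-1 * Sc) <= K2 + expR (- K2) * H a by lra.
    rewrite /lam mulrC ler_pdivrMr ?mulr_gt0 // => h''.
    lra.
  by move: basic h1 h2; rewrite DE; lra.
have t01 i : 0 <= theta i <= 1.
  by have /andP[-> h] := theta0 i; rewrite (le_trans h).
have := Ex_le t01 key.
rewrite !ExD !ExZ Ex_noise_dot !Ex_cst.
have EG : expR (- K1) * Ex theta G <= 1.
  rewrite expRN expK1 mulrC ler_pdivrMr ?mulr_gt0 ?exprn_gt0 // mul1r.
  rewrite Ex_sum -[#|Z|%:R]/(1 *+ #|Z|) -mulr_natl mulr1 mulr_natl -sumr_const.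
  by apply: ler_sum => z _; exact: (Ex_block_mixture theta0 rho1 r0 rr).
have EH : expR (- K2) * Ex theta H <= 1.
  rewrite expRN expK2 mulrC ler_pdivrMr // mul1r.
  rewrite (Ex_sum theta (fun z a => expR (lam * (noise_dot theta a (centre (B z))
                            - 8^-1 * \sum_i centre (B z) i ^+ 2)))).
  rewrite -[leRHS]/(1 *+ #|Z|) -sumr_const; apply: ler_sum => z _.
  exact: (Ex_expR_noise_le1 theta0 rho1 r0 rr (centre_le (B z))).
have EG' : 32 * r * expR (- K1) * Ex theta G <= 32 * r.
  by rewrite -mulrA ler_piMr // mulr_ge0 // ltW.
have EH' : 16 * r * expR (- K2) * Ex theta H <= 16 * r.
  by rewrite -mulrA ler_piMr // mulr_ge0 // ltW.
lra.
Qed.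

End Oracle.

(** * Networks *)

Section LowerPairs.
Variable n : nat.

Definition lower_pair : predArgType := {p : 'I_n * 'I_n | (p.2 < p.1)%N}.

Lemma big_lower_pair (T : Type) (idx : T) (op : Monoid.com_law idx)
    (F : 'I_n -> 'I_n -> T) :
  \big[op/idx]_(i < n) \big[op/idx]_(j < n | (j < i)%N) F i j =
  \big[op/idx]_(p : lower_pair) F (val p).1 (val p).2.
Proof.
rewrite pair_big_dep /=.
rewrite (reindex_omap (val : lower_pair -> _) insub) /=; last first.
  by move=> p pl; rewrite insubT.
by apply: eq_bigl => p; rewrite valK (valP p) eqxx.
Qed.

Definition lower_config (a : {ffun lower_pair -> bool}) (i j : 'I_n) : bool :=
  if insub (i, j) is Some p then a p else false.

Lemma lower_configE (a : {ffun lower_pair -> bool}) (p : lower_pair) :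
  lower_config a (val p).1 (val p).2 = a p.
Proof.
case: p => -[i j] /= ij; rewrite /lower_config insubT //=.
Qed.

Lemma sym_mxE (T : Type) (x0 : T) (g : 'I_n -> 'I_n -> T) (p : lower_pair) :
  sym_mx x0 g (val p).1 (val p).2 = g (val p).1 (val p).2.
Proof. by rewrite /sym_mx mxE (valP p). Qed.

Variable k : nat.

(** For a symmetric Q the entries at (x, y) and (y, x) are one parameter, so both orientations
    belong to the same block, represented by its nonincreasing pair. The strictly increasing labels
    are empty blocks. *)
Definition sort_pair (x y : 'I_k) : 'I_k * 'I_k :=
  if (y <= x)%N then (x, y) else (y, x).

Definition label (z : {ffun 'I_n -> 'I_k}) (p : lower_pair) : 'I_k * 'I_k :=
  sort_pair (z (val p).1) (z (val p).2).

Lemma sort_pair_sym (T : Type) (Q : 'M[T]_k) x y : Q^T = Q ->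
  Q (sort_pair x y).1 (sort_pair x y).2 = Q x y.
Proof. by move=> QT; rewrite /sort_pair; case: ifP => //= _; rewrite -{1}QT mxE. Qed.

Lemma sort_pairC x y : sort_pair x y = sort_pair y x.
Proof.
rewrite /sort_pair; case: (ltngtP x y) => // /val_inj -> //.
Qed.

End LowerPairs.

Section NetworkOracle.
Context {R : realType}.
Variables (n k n0 : nat) (S : 'M[R]_k -> Prop) (est : 'M[bool]_n -> 'M[R]_n).
Hypothesis S_sym : forall Q, S Q -> Q^T = Q.
Hypothesis est_fit : forall a, ls_fit S n0 a (est a).
Variables (theta : 'I_n -> 'I_n -> R) (rho r : R).
Hypothesis theta0 : forall i j : 'I_n, (j < i)%N -> 0 <= theta i j <= rho.
Hypotheses (rho1 : rho <= 1) (r0 : 0 < r) (rr : rho <= r).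

Let I := lower_pair n.
Let J : finType := ('I_k * 'I_k)%type.
Let Z : finType := {ffun 'I_n -> 'I_k}.

Let th (p : I) : R := theta (val p).1 (val p).2.

Definition config_mx (a : {ffun I -> bool}) : 'M[bool]_n :=
  sym_mx false (lower_config a).

Lemma config_mxE (a : {ffun I -> bool}) (p : I) :
  config_mx a (val p).1 (val p).2 = a p.
Proof. by rewrite /config_mx sym_mxE lower_configE. Qed.

Let th0 p : 0 <= th p <= rho.
Proof. exact: theta0 (valP p). Qed.

Definition square_loss (T : 'M[R]_n) : R :=
  \sum_(i < n) \sum_(j < n | (j < i)%N) (T i j - theta i j) ^+ 2.

Lemma ls_loss_label (a : {ffun I -> bool}) (Q : 'M[R]_k) (z : Z) : Q^T = Q ->
  ls_loss (config_mx a) Q z =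
  \sum_p ((a p)%:R - Q (label z p).1 (label z p).2) ^+ 2.
Proof.
move=> QT; rewrite /ls_loss big_lower_pair; apply: eq_bigr => p _.
by rewrite config_mxE /label sort_pair_sym.
Qed.

(** Common reduction for both estimators, S being the constraint on Q. The bound by [bad] is asked
    only when Q is optimal for its own labelling, which for mere symmetry makes Q a matrix of block
    averages. *)
Lemma least_squares_network (bad : {ffun I -> bool} -> R)
    (Qs : 'M[R]_k) (zs : Z) :
  S Qs -> block_maps n0 zs ->
  (forall a (Q : 'M[R]_k) (z : Z), S Q -> block_maps n0 z ->
     (forall Q', S Q' -> ls_loss (config_mx a) Q z <= ls_loss (config_mx a) Q' z) ->
     \sum_(b : J | 2 * r < `|Q b.1 b.2 - block_mean th (label z) b|)
        block_noise th (label z) a b * (Q b.1 b.2 - block_mean th (label z) b)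
     <= bad a) ->
  3 / 4 * Ex th (fun a => square_loss (est (config_mx a))) <=
  \sum_(i < n) \sum_(j < n | (j < i)%N) (Qs (zs i) (zs j) - theta i j) ^+ 2
  + 32 * r * (n%:R * ln k%:R + k%:R ^+ 2 * ln 12 + 1)
  + 16 * r * (n%:R * ln k%:R + 1) + 2 * Ex th bad.
Proof.
move=> SQs zsP badP.
have /choice[f fP] : forall a : {ffun I -> bool}, exists Qz : 'M[R]_k * Z,
    [/\ S Qz.1, block_maps n0 Qz.2,
      forall Q' (z' : Z), S Q' -> block_maps n0 z' ->
        ls_loss (config_mx a) Qz.1 Qz.2 <= ls_loss (config_mx a) Q' z' &
      est (config_mx a) = sym_mx 0 (fun i j => Qz.1 (Qz.2 i) (Qz.2 j))].
  move=> a; have [Q [z [SQ zP opt E]]] := est_fit (config_mx a).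
  have zz : (finfun z : _ -> _) = z by apply/funext => i; rewrite ffunE.
  by exists (Q, finfun z); split => //=; rewrite ?zz // => Q' z'; exact: opt.
have lossE : (fun a => square_loss (est (config_mx a))) =
    fun a => \sum_p ((f a).1 (label (f a).2 p).1 (label (f a).2 p).2 - th p) ^+ 2.
  apply/funext => a; rewrite /square_loss big_lower_pair; apply: eq_bigr => p _.
  have [SQ _ _ ->] := fP a; rewrite sym_mxE /label sort_pair_sym //.
  exact: S_sym.
rewrite lossE.
have cZ : #|Z| = (k ^ n)%N by rewrite card_ffun !card_ord.
have cJ : #|J| = (k ^ 2)%N by rewrite card_prod card_ord.
have lnZ : ln #|Z|%:R = n%:R * ln k%:R :> R.
  rewrite cZ natrX; case: (posnP n) => [->|n_gt0].
    by rewrite expr0 ln1 mul0r.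
  (* With vertices but no block, both sides are 0 by the convention ln 0 = 0. *)
  have [k0|k_gt0] := posnP k; last by rewrite lnXn ?ltr0n // mulr_natl.
  by rewrite k0 expr0n (gtn_eqF n_gt0) /= ln0 // mulr0.
rewrite -natrX -cJ -lnZ big_lower_pair.
have -> : \sum_(p : I) (Qs (zs (val p).1) (zs (val p).2) - theta (val p).1 (val p).2) ^+ 2
   = \sum_p (Qs (label zs p).1 (label zs p).2 - th p) ^+ 2.
  by apply: eq_bigr => p _; rewrite /label sort_pair_sym //; exact: S_sym.
apply: (least_squares_oracle th0 rho1 r0 rr (B := @label n k)
  (zh := fun a => (f a).2) (qh := fun a b => (f a).1 b.1 b.2)
  (tstar := fun p => Qs (label zs p).1 (label zs p).2)).
- move=> a; have [SQ zP opt _] := fP a.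
  by rewrite -!ls_loss_label; [exact: opt| exact: S_sym..].
- move=> a; have [SQ zP opt _] := fP a.
  by apply: badP => // Q' SQ'; apply: opt.
Qed.

End NetworkOracle.

(** * Bounds for the restricted and the unrestricted least squares fit *)

Section NetworkEstimators.
Context {R : realType}.
Variables (n k : nat) (est : 'M[bool]_n -> 'M[R]_n).
Variables (theta : 'I_n -> 'I_n -> R) (rho : R).
Hypothesis theta0 : forall i j : 'I_n, (j < i)%N -> 0 <= theta i j <= rho.
Hypotheses (rho0 : 0 < rho) (rho1 : rho <= 1).

Let I := lower_pair n.
Let th (p : I) : R := theta (val p).1 (val p).2.
Let th0 p : 0 <= th p <= rho.
Proof. exact: theta0 (valP p). Qed.

(** Entries at most r and block means at most rho <= r give slopes at most 2 r: no block is bad. *)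
Lemma restricted_network (r : R) (Qs : 'M[R]_k) (zs : {ffun 'I_n -> 'I_k}) :
  rho <= r -> restricted_least_squares_estimator k r est ->
  Qs^T = Qs -> (forall b c, `|Qs b c| <= r) -> block_maps 1 zs ->
  3 / 4 * Ex th (fun a => square_loss theta (est (config_mx a))) <=
  \sum_(i < n) \sum_(j < n | (j < i)%N) (Qs (zs i) (zs j) - theta i j) ^+ 2
  + 32 * r * (n%:R * ln k%:R + k%:R ^+ 2 * ln 12 + 1)
  + 16 * r * (n%:R * ln k%:R + 1).
Proof.
move=> rr estP QsT Qsr zsP.
have r0 : 0 < r by apply: lt_le_trans rr.
have := least_squares_network (bad := fun=> 0) (Qs := Qs) (zs := zs) _ estP theta0
  rho1 r0 rr.
rewrite Ex_cst mulr0 addr0; apply => //; first by move=> Q [].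
move=> a Q z [QT Qr] _ _; rewrite big_pred0 // => b.
apply/negbTE; rewrite -leNgt (le_trans (ler_normB _ _)) // mulr_natl mulr2n lerD //.
have /andP[m0 m1] := block_mean_itv th0 (label z) b.
rewrite ger0_norm // (le_trans m1) //.
by rewrite (_ : Num.max rho 0 = rho) //; apply/max_idPl/ltW.
Qed.

(** * Unrestricted fits: blocks with too large an average *)

Section BlockAverages.
Variables (n0 : nat).
Hypothesis n0_ge2 : (2 <= n0)%N.

Definition between (U V : {set 'I_n}) (p : I) : bool :=
  (((val p).1 \in U) && ((val p).2 \in V)) ||
  (((val p).1 \in V) && ((val p).2 \in U)).

(** The sets may overlap: an unordered pair counts at most twice as an ordered one, and the diagonal
    removes at most #|U| <= #|U| #|V| / 2 couples. If U = V were a singleton there would be no pair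
    at all, hence the minimal size 2. *)
Lemma card_between (U V : {set 'I_n}) : (2 <= #|V|)%N ->
  (#|U| * #|V| <= 4 * #|between U V|)%N.
Proof.
move=> V2.
have h1 : (\sum_(i < n) \sum_(j < n | j != i) ((i \in U) && (j \in V)) <=
           2 * #|between U V|)%N.
  have -> : (\sum_(i < n) \sum_(j < n | j != i) ((i \in U) && (j \in V)) =
    \sum_(i < n) \sum_(j < n | (j < i)%N) ((i \in U) && (j \in V)) +
    \sum_(i < n) \sum_(j < n | (j < i)%N) ((j \in U) && (i \in V)))%N.
    rewrite [X in (_ + X)%N](exchange_big_dep xpredT) //= -big_split /=.
    apply: eq_bigr => i _; rewrite (bigID (fun j : 'I_n => (j < i)%N)) /=.
    congr (_ + _)%N; apply: eq_bigl => j.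
      by rewrite -val_eqE; case: ltngtP.
    by rewrite -val_eqE; case: ltngtP.
  rewrite (big_lower_pair _ (fun i j => nat_of_bool ((i \in U) && (j \in V)))).
  rewrite (big_lower_pair _ (fun i j => nat_of_bool ((j \in U) && (i \in V)))).
  rewrite -sum1_card big_distrr /= -big_split /= [leqRHS]big_mkcond /=.
  refine (@leq_sum _ _ _ _ _ _) => p _; rewrite -[p \in _]/(between U V p) /between.
  by do 4!case: (_ \in _).
have h2 : (#|U| * #|V| <=
    \sum_(i < n) \sum_(j < n | j != i) ((i \in U) && (j \in V)) + #|U|)%N.
  rewrite -[in leqLHS]sum1_card -[X in (_ <= _ + X)%N]sum1_card.
  rewrite big_distrl /= [X in (X <= _)%N]big_mkcond [X in (_ <= _ + X)%N]big_mkcond.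
  rewrite -big_split /=; apply: leq_sum => i _; case: (i \in U) => //=.
  rewrite mul1n -sum1_card big_mkcond (bigD1 i) //= addnC leq_add //.
  by case: (_ \in _).
have : (2 * #|U| <= #|U| * #|V|)%N by rewrite mulnC leq_mul2l V2 orbT.
lia.
Qed.

Lemma sum_expr_card (x : R) :
  \sum_(U : {set 'I_n}) x ^+ #|U| = (1 + x) ^+ n.
Proof.
transitivity (\prod_(i < n) (x + 1)); last by rewrite prodr_const card_ord addrC.
rewrite (bigA_distr _ _ (fun=> x) (fun=> 1)) /=; apply: eq_bigr => U _.
by rewrite -big_mkcond /= prodr_const.
Qed.

(* 2304 = 2 * 12 * 96: since rho n0 >= ln n / 12, a block of m pairs between sets
   of sizes u and v has r m / 12 >= 2 (u + v) ln n, which pays for the at most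
   n^(u + v) choices of these sets. *)
Variable r : R.
Hypothesis rE : r = 2304 * rho.

Let r0 : 0 < r.
Proof. by rewrite rE; have := rho0; lra. Qed.

Let rr : rho <= r.
Proof. by rewrite rE; have := rho0; lra. Qed.

(** Chernoff bound for the event that the noise between U and V exceeds 2 r per pair, summed over
    sets fixed in advance. The factor in front bounds what a block can contribute to the correlation
    of its noise with the fit. *)
Definition large_block (a : {ffun I -> bool}) : R :=
  \sum_(U : {set 'I_n} | (n0 <= #|U|)%N) \sum_(V : {set 'I_n} | (n0 <= #|V|)%N)
    #|between U V|%:R *
    expR ((noise_dot th a (fun p => (between U V p)%:R)
           - 2 * r * #|between U V|%:R) / 4).

Hypotheses (n_ge5 : (5 <= n)%N) (ln_n : ln n%:R <= 12 * (rho * n0%:R)).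

(** The exponent r m / 4 is cut into three equal parts x. One absorbs m, as m exp(- x) <= 12 / r;
    one yields the weight n^(- 2 (u + v)) that pays for the sets; one yields 18 rho^2, from exp x >=
    x^2 / 2 and x >= 1 / (3 rho). The resulting constant is 12 * 18 / 2304 < 1 / 9. *)
Lemma large_block_term (u v : nat) (m : R) : (n0 <= u)%N -> (n0 <= v)%N ->
  u%:R * v%:R <= 4 * m ->
  m * expR (- (r * m / 4)) <= rho / 9 * ((n%:R ^- 2) ^+ u * (n%:R ^- 2) ^+ v).
Proof.
move=> n0u n0v uvm; set w := _ ^+ u * _.
have n5 : 5 <= n%:R :> R by rewrite ler_nat.
have n00 : 2 <= n0%:R :> R by rewrite ler_nat.
have u0 : n0%:R <= u%:R :> R by rewrite ler_nat.
have v0 : n0%:R <= v%:R :> R by rewrite ler_nat.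
have l1 : 1 <= ln n%:R :> R by apply: ln4_ge1; lra.
have rn := ln_n; set l := ln n%:R in l1 rn.
set x := r * m / 12.
have uv0 : n0%:R * (u%:R + v%:R) <= 2 * (u%:R * v%:R) :> R by nra.
have hA : 2 * l * (u%:R + v%:R) <= x.
  have : l * (u%:R + v%:R) <= 12 * (rho * n0%:R) * (u%:R + v%:R).
    by rewrite ler_wpM2r //; lra.
  have : rho * (n0%:R * (u%:R + v%:R)) <= rho * (2 * (4 * m)).
    by rewrite ler_pM2l //; lra.
  rewrite /x rE; lra.
have hB : 1 / (3 * rho) <= x.
  have h1 : n0%:R ^+ 2 <= 4 * m :> R by rewrite expr2; apply: le_trans uvm; nra.
  have h2 : 1 <= (12 * (rho * n0%:R)) ^+ 2.
    by rewrite -[leLHS](expr1n _ 2) lerXn2r ?nnegrE //; lra.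
  rewrite ler_pdivrMr ?mulr_gt0 // /x rE.
  have : rho ^+ 2 * n0%:R ^+ 2 <= rho ^+ 2 * (4 * m) by rewrite ler_pM2l ?exprn_gt0.
  move: h2; rewrite !exprMn; lra.
have m0 : 0 <= m by move: uvm; nra.
have x0 : 0 <= x by rewrite divr_ge0 // mulr_ge0 // ltW.
have -> : expR (- (r * m / 4)) = expR (- x) * expR (- x) * expR (- x).
  by rewrite -!expRD; congr expR; rewrite /x; field.
have e1 : m * expR (- x) <= 12 / r.
  have -> : m = 12 / r * x by rewrite /x; field; rewrite gt_eqF.
  rewrite -[_ * x * _]mulrA ler_piMr ?divr_ge0 //; first exact: ltW.
  rewrite expRN ler_pdivrMr ?expR_gt0 // mul1r.
  by have := expR_ge1Dx x; lra.
have e2 : expR (- x) <= w.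
  rewrite /w -exprD -exprVn -exprM.
  have -> : (n%:R^-1 : R) = expR (- l) by rewrite expRN lnK ?posrE //; lra.
  by rewrite -expRM_natl ler_expR natrM natrD; lra.
have e3 : expR (- x) <= 18 * rho ^+ 2.
  have := @expR_ge1Dxn R x 1 x0; rewrite (_ : 2`!%:R = 2) // => h.
  have h2 : (1 / (3 * rho)) ^+ 2 <= x ^+ 2.
    by rewrite lerXn2r ?nnegrE // divr_ge0 // mulr_ge0 // ltW.
  rewrite expRN -[leRHS]invrK lef_pV2 ?posrE ?expR_gt0 ?invr_gt0 ?mulr_gt0 ?exprn_gt0 //.
  have -> : (18 * rho ^+ 2)^-1 = (1 / (3 * rho)) ^+ 2 / 2 by field; rewrite gt_eqF.
  by lra.
have w0 : 0 <= w by rewrite mulr_ge0 // exprn_ge0 // invr_ge0 exprn_ge0.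
rewrite [m * (_ * _ * _)]mulrA [m * (_ * _)]mulrA.
apply: (@le_trans _ _ (12 / r * w * (18 * rho ^+ 2))).
  apply: ler_pM e3; rewrite ?expR_ge0 //; first by rewrite !mulr_ge0 ?expR_ge0.
  by apply: ler_pM e1 e2; rewrite ?expR_ge0 // mulr_ge0 // expR_ge0.
have -> : 12 / r * w * (18 * rho ^+ 2) = rho * w * (12 * 18 / 2304).
  rewrite rE; field; by rewrite gt_eqF.
have : 0 <= rho * w by rewrite mulr_ge0 // ltW.
lra.
Qed.

(** The weights of all subsets sum to (1 + n^-2)^n <= exp(1 / n) <= 3, so pairs of sets cost at most
    9, which cancels the 1 / 9 of [large_block_term]. *)
Lemma Ex_large_block : Ex th large_block <= rho.
Proof.
have n5 : 5 <= n%:R :> R by rewrite ler_nat.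
pose w (U : {set 'I_n}) : R := (n%:R ^- 2) ^+ #|U|.
have w0 U : 0 <= w U by rewrite exprn_ge0 // invr_ge0 exprn_ge0.
have sw : \sum_(U : {set 'I_n} | (n0 <= #|U|)%N) w U <= 3.
  apply: (@le_trans _ _ (\sum_U w U)).
    by rewrite [leRHS](bigID (fun U : {set 'I_n} => (n0 <= #|U|)%N)) /= lerDl sumr_ge0.
  rewrite sum_expr_card.
  apply: (@le_trans _ _ (expR (n%:R ^- 2) ^+ n)).
    by rewrite lerXn2r ?nnegrE ?expR_ge0 ?expR_ge1Dx // addr_ge0 // invr_ge0 exprn_ge0.
  rewrite -expRM_natl (_ : n%:R * n%:R ^- 2 = n%:R^-1); last first.
    by field; rewrite gt_eqF //; lra.
  have i4 : n%:R^-1 <= 1 / 4 :> R by rewrite -[leRHS]invrK lef_pV2 ?posrE; lra.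
  apply: le_trans (expR_le_quadratic _) _.
    by rewrite ger0_norm // invr_ge0.
  have : 0 <= n%:R^-1 :> R by rewrite invr_ge0.
  nra.
pose F (U V : {set 'I_n}) (a : {ffun I -> bool}) : R := #|between U V|%:R *
    expR ((noise_dot th a (fun p => (between U V p)%:R)
           - 2 * r * #|between U V|%:R) / 4).
have FE (U V : {set 'I_n}) : (n0 <= #|U|)%N -> (n0 <= #|V|)%N ->
    Ex th (F U V) <= rho / 9 * (w U * w V).
  move=> nU nV; set m : R := #|between U V|%:R.
  (* Scaled to the largest admissible entry 2 r, so that the multiplier 1 / (8 r) puts the factor
     1/4 on the noise; the penalty uses r m / 16 of the available r m / 2. *)
  pose X (p : I) : R := 2 * r * (between U V p)%:R.
  have sX : \sum_p X p ^+ 2 = 4 * r ^+ 2 * m.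
    rewrite /m -sum1_card natr_sum mulr_sumr [RHS]big_mkcond /=.
    apply: eq_bigr => p _; rewrite -[p \in _]/(between U V p) /X.
    by case: (between U V p) => /=; ring.
  have dX a : noise_dot th a X =
      2 * r * noise_dot th a (fun p => (between U V p)%:R).
    by rewrite /noise_dot mulr_sumr; apply: eq_bigr => p _; rewrite /X; ring.
  have -> : F U V = fun a => m * expR (- (7 / 16 * r * m)) *
      expR ((8 * r)^-1 * (noise_dot th a X - 8^-1 * \sum_p X p ^+ 2)).
    apply/funext => a; rewrite /F -/m -[RHS]mulrA -expRD; congr (_ * expR _).
    by rewrite dX sX; field; rewrite gt_eqF.
  rewrite ExZ; apply: (@le_trans _ _ (m * expR (- (7 / 16 * r * m)))).
    rewrite ler_piMr ?mulr_ge0 ?expR_ge0 //.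
    apply: (Ex_expR_noise_le1 th0 rho1 r0 rr) => p.
    rewrite /X ger0_norm ?mulr_ge0 ?(ltW r0) //.
    by rewrite ler_piMr ?lern1 ?leq_b1 // mulr_ge0 // ltW.
  have m0 : 0 <= m by rewrite ler0n.
  apply: (@le_trans _ _ (m * expR (- (r * m / 4)))).
    apply: ler_wpM2l => //; rewrite ler_expR lerN2.
    have : 0 <= r * m by rewrite mulr_ge0 // ltW.
    by lra.
  apply: large_block_term => //.
  by rewrite -!natrM ler_nat card_between // (leq_trans n0_ge2).
have -> : Ex th large_block = \sum_(U : {set 'I_n} | (n0 <= #|U|)%N)
    \sum_(V : {set 'I_n} | (n0 <= #|V|)%N) Ex th (F U V).
  rewrite /large_block (Ex_sum th (fun U a =>
    \sum_(V : {set 'I_n} | (n0 <= #|V|)%N) F U V a)).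
  by apply: eq_bigr => U _; rewrite (Ex_sum th (F U)).
apply: (@le_trans _ _ (\sum_(U : {set 'I_n} | (n0 <= #|U|)%N)
    \sum_(V : {set 'I_n} | (n0 <= #|V|)%N) rho / 9 * (w U * w V))).
  by apply: ler_sum => U nU; apply: ler_sum => V nV; exact: FE.
under eq_bigr do rewrite -mulr_sumr -mulr_sumr.
rewrite -mulr_sumr -mulr_suml.
have s0 : 0 <= \sum_(U : {set 'I_n} | (n0 <= #|U|)%N) w U by rewrite sumr_ge0.
move: sw s0; set s := \sum_(U | _) w U => sw s0.
have : s * s <= 3 * 3 by rewrite ler_pM.
have := rho0; nra.
Qed.

(** The block averages of the data form a symmetric matrix, and by Pythagoras the loss of Q exceeds
    theirs by a weighted squared distance. Optimality makes it vanish on nonempty blocks; on an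
    empty block both sides are 0. *)
Lemma block_averageE (a : {ffun I -> bool}) (Q : 'M[R]_k)
    (z : {ffun 'I_n -> 'I_k}) (b : 'I_k * 'I_k) : Q^T = Q ->
  (forall Q' : 'M[R]_k, Q'^T = Q' ->
     ls_loss (config_mx a) Q z <= ls_loss (config_mx a) Q' z) ->
  block_size (label z) b * (Q b.1 b.2 - block_mean th (label z) b) =
  block_noise th (label z) a b.
Proof.
move=> QT opt; set B := label z.
pose av := block_mean (fun p => (a p)%:R : R) B.
pose Qav : 'M[R]_k := \matrix_(x, y) av (sort_pair x y).
have QavT : Qav^T = Qav by apply/matrixP => x y; rewrite !mxE sort_pairC.
have := opt _ QavT; rewrite !ls_loss_label //.
have -> : \sum_p ((a p)%:R - Qav (B p).1 (B p).2) ^+ 2 =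
    \sum_p centre (fun p => (a p)%:R : R) B p ^+ 2.
  apply: eq_bigr => p _; rewrite /B /label sort_pair_sym // mxE.
  by rewrite /centre -/av -[RHS]sqrrN opprB.
have -> : \sum_p ((a p)%:R - Q (B p).1 (B p).2) ^+ 2 =
    \sum_p centre (fun p => (a p)%:R : R) B p ^+ 2
    + \sum_b block_size B b * (Q b.1 b.2 - av b) ^+ 2.
  rewrite -(sum_block B (fun b => (Q b.1 b.2 - av b) ^+ 2)).
  have := sum_centre_block (fun p => (a p)%:R : R) B (fun b => Q b.1 b.2 - av b).
  move=> h.
  transitivity (\sum_p (centre (fun p => (a p)%:R : R) B p ^+ 2 +
     (Q (B p).1 (B p).2 - av (B p)) ^+ 2 +
     2 * ((Q (B p).1 (B p).2 - av (B p)) * centre (fun p => (a p)%:R : R) B p))).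
    by apply: eq_bigr => p _; rewrite /centre -/av; ring.
  by rewrite !big_split /= -mulr_sumr h mulr0 addr0.
rewrite gerDl => s0.
have t0 b' : 0 <= block_size B b' * (Q b'.1 b'.2 - av b') ^+ 2.
  by rewrite mulr_ge0 ?sqr_ge0 ?block_size_ge0.
have /eqP : \sum_b block_size B b * (Q b.1 b.2 - av b) ^+ 2 = 0.
  by apply/eqP; rewrite eq_le s0 sumr_ge0.
rewrite psumr_eq0 // => /allP/(_ b); rewrite mem_index_enum => /(_ isT) /=.
have bn : block_noise th B a b = block_size B b * (av b - block_mean th B b).
  by rewrite mulrBr !block_mean_mulr -sumrB.
rewrite bn mulf_eq0 => /orP[/eqP->|]; first by rewrite !mul0r.
by rewrite expf_eq0 /= subr_eq0 => /eqP ->.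
Qed.

(** The block is given by one of its pairs [p0]: a strictly increasing label is never attained,
    although there may be pairs between the corresponding vertex sets. *)
Lemma between_label (z : {ffun 'I_n -> 'I_k}) (p0 p : I) :
  between [set i | z i == (label z p0).1]%SET [set i | z i == (label z p0).2]%SET p
  = (label z p == label z p0).
Proof.
rewrite /between !inE.
have yx : ((label z p0).2 <= (label z p0).1)%N.
  by rewrite /label /sort_pair; case: (leqP (z (val p0).2)) => //= /ltnW.
case: (label z p0) yx => x y /= yx; rewrite /label /sort_pair.
case: leqP => h; rewrite xpair_eqE /=.
  apply/orP/idP => [[//|/andP[/eqP e1 /eqP e2]]|->]; last by left.
  move: h; rewrite e1 e2 => xy.
  have -> : x = y by apply/val_inj/eqP; rewrite eqn_leq xy yx.
  by rewrite !eqxx.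
apply/orP/idP => [[/andP[/eqP e1 /eqP e2]|/andP[-> ->//]]|/andP[-> ->]]; last by right.
by move: h; rewrite e1 e2 ltnNge yx.
Qed.

(** A slope is s / m with |s| <= m, so a bad block contributes at most m; and s > 2 r m makes the
    exponential of its two vertex sets at least 1. Each of the k^2 blocks is thus bounded by one
    term of [large_block]. *)
Lemma large_block_bad (a : {ffun I -> bool}) (Q : 'M[R]_k)
    (z : {ffun 'I_n -> 'I_k}) : Q^T = Q -> block_maps n0 z ->
  (forall Q' : 'M[R]_k, Q'^T = Q' ->
     ls_loss (config_mx a) Q z <= ls_loss (config_mx a) Q' z) ->
  \sum_(b : 'I_k * 'I_k | 2 * r < `|Q b.1 b.2 - block_mean th (label z) b|)
     block_noise th (label z) a b * (Q b.1 b.2 - block_mean th (label z) b)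
  <= k%:R ^+ 2 * large_block a.
Proof.
move=> QT zn0 opt.
have L0 : 0 <= large_block a.
  by apply: sumr_ge0 => U _; apply: sumr_ge0 => V _; rewrite mulr_ge0 ?expR_ge0.
apply: (@le_trans _ _ (\sum_(b : 'I_k * 'I_k) large_block a)); last first.
  by rewrite sumr_const card_prod card_ord -natrX -[leLHS]mulr_natl.
rewrite big_mkcond /=; apply: ler_sum => b _; case: ifPn => // big.
set q := Q b.1 b.2 - _; rewrite -/q in big.
have := block_averageE b QT opt; rewrite -/q.
set m := block_size _ _; set s := block_noise _ _ _ _ => ms.
have sm : `|s| <= m by exact: block_noise_le th0 rho1 _ _ _.
have m0 : 0 <= m by exact: block_size_ge0.
have [m00|m_neq0] := eqVneq m 0.
  by rewrite -ms m00 !mul0r.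
have {}m0 : 0 < m by rewrite lt_def m_neq0.
have qs : q = s / m by rewrite -ms mulrC mulKf.
(* Data averages are nonnegative and block means at most rho, so only upper deviations can be
   large. *)
have s_ge : - (2 * r * m) <= s.
  have -> : s = (\sum_(p | label z p == b) (a p)%:R) - m * block_mean th (label z) b.
    by rewrite /m block_mean_mulr -sumrB.
  have /andP[h0 h1] := block_mean_itv th0 (label z) b.
  have h2 : Num.max rho 0 = rho by apply/max_idPl/ltW.
  rewrite h2 in h1.
  have h3 : 0 <= \sum_(p | label z p == b) (a p)%:R :> R by rewrite sumr_ge0.
  have : m * block_mean th (label z) b <= m * (2 * r).
    by rewrite ler_pM2l // (le_trans h1) //; have := rr; have := rho0; lra.
  lra.
have s_gt : 2 * r * m < s.
  move: big; rewrite qs normrM normfV (gtr0_norm m0) ltr_pdivlMr //.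
  by case: (ger0P s) => // _; lra.
have s_le : s <= m by apply: le_trans (ler_norm _) sm.
have s_gt0 : 0 < s by apply: le_lt_trans s_gt; rewrite !mulr_ge0 // ltW.
have qm : s * q <= m.
  rewrite qs mulrA ler_pdivrMr //; nra.
apply: le_trans qm _.
have [p0 p0b] : exists p, label z p == b.
  move: m_neq0; rewrite /m /block_size pnatr_eq0 -lt0n.
  by case/card_gt0P => p; rewrite inE => pb; exists p.
pose U : {set 'I_n} := [set i | z i == b.1]%SET.
pose V : {set 'I_n} := [set i | z i == b.2]%SET.
have UVE p : between U V p = (label z p == b).
  by rewrite /U /V -(eqP p0b) between_label.
have mE : m = #|between U V|%:R.
  by rewrite /m /block_size; congr (_%:R); apply: eq_card => p; rewrite inE -UVE.
have sE : s = noise_dot th a (fun p => (between U V p)%:R).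
  rewrite /s /block_noise /noise_dot big_mkcond; apply: eq_bigr => p _.
  by rewrite UVE; case: ifP; rewrite ?mulr1 ?mulr0.
have n0U : (n0 <= #|U|)%N.
  by rewrite cardsE; exact: zn0.
have n0V : (n0 <= #|V|)%N.
  by rewrite cardsE; exact: zn0.
apply: (@le_trans _ _ (#|between U V|%:R *
    expR ((noise_dot th a (fun p => (between U V p)%:R)
           - 2 * r * #|between U V|%:R) / 4))).
  rewrite -mE -sE ler_peMr ?(ltW m0) //.
  rewrite -[leLHS]expR0 ler_expR divr_ge0 // subr_ge0 ltW //.
rewrite /large_block (bigD1 U) //= (bigD1 V) //= -addrA lerDl addr_ge0 //.
  by apply: sumr_ge0 => V' _; rewrite mulr_ge0 ?expR_ge0.
by apply: sumr_ge0 => U' _; apply: sumr_ge0 => V' _; rewrite mulr_ge0 ?expR_ge0.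
Qed.

Lemma least_squares_network_bound (Qs : 'M[R]_k) (zs : {ffun 'I_n -> 'I_k}) :
  least_squares_estimator k n0 est -> Qs^T = Qs -> block_maps n0 zs ->
  3 / 4 * Ex th (fun a => square_loss theta (est (config_mx a))) <=
  \sum_(i < n) \sum_(j < n | (j < i)%N) (Qs (zs i) (zs j) - theta i j) ^+ 2
  + 32 * r * (n%:R * ln k%:R + k%:R ^+ 2 * ln 12 + 1)
  + 16 * r * (n%:R * ln k%:R + 1) + 2 * (k%:R ^+ 2 * rho).
Proof.
move=> estP QsT zsP.
have := least_squares_network (bad := fun a => k%:R ^+ 2 * large_block a)
  (Qs := Qs) (zs := zs) (fun Q QT => QT) estP theta0 rho1 r0 rr.
move=> /(_ QsT zsP) h; apply: le_trans (h _) _.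
  by move=> a Q z QT zP; exact: large_block_bad.
rewrite lerD2l ExZ ler_wpM2l // ler_wpM2l //; exact: Ex_large_block.
Qed.

End BlockAverages.
End NetworkEstimators.

(** * Ranks of a sample *)

Section Ranks.
Context {R : realType}.

Lemma down_closed_card n (p : pred 'I_n) :
  (forall i j : 'I_n, (i <= j)%N -> p j -> p i) ->
  forall i : 'I_n, p i = (i < #|p|)%N.
Proof.
move=> pd i; apply/idP/idP => [pi|].
  have -> : i.+1 = #|[pred j : 'I_n | (j < i.+1)%N]|.
    rewrite -sum1_card -(big_ord_widen_cond _ xpredT (fun=> 1%N) (ltn_ord i)).
    by rewrite sum1_card card_ord.
  by apply/subset_leq_card/fintype.subsetP => j; rewrite !inE ltnS => ji; exact: pd ji pi.
apply: contraLR => npi; rewrite -leqNgt.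
have -> : nat_of_ord i = #|[pred j : 'I_n | (j < i)%N]|.
  rewrite -sum1_card -(big_ord_widen_cond _ xpredT (fun=> 1%N) (ltnW (ltn_ord i))).
  by rewrite sum1_card card_ord.
apply/subset_leq_card/fintype.subsetP => j; rewrite !inE ltnNge => pj.
by apply/negP => ij; move/negP: npi; apply; exact: pd ij pj.
Qed.

Lemma sum_arith (c : R) N : \sum_(r < N) (c - 2 * r%:R) = N%:R * (c + 1 - N%:R).
Proof.
elim: N => [|N IH]; first by rewrite big_ord0 mul0r.
by rewrite big_ord_recr /= IH -natr1; ring.
Qed.

Lemma sum_ord_lt n N (f : nat -> R) : (N <= n)%N ->
  \sum_(r < n) (r < N)%:R * f r = \sum_(r < N) f r.
Proof.
move=> Nn; rewrite (big_ord_widen _ f Nn) [RHS]big_mkcond /=.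
by apply: eq_bigr => r _; case: (r < N)%N; rewrite ?mul1r ?mul0r.
Qed.

Lemma sorting_perm n (xi : 'I_n -> R) : exists s : {perm 'I_n},
  forall i j : 'I_n, (i <= j)%N -> xi (s i) <= xi (s j).
Proof.
pose t := [tuple xi i | i < n].
have /tuple_permP[s sE] : perm_eq (sort <=%R t) t by rewrite perm_sort.
exists s => i j ij.
have nthE (m : 'I_n) : nth 0 (sort <=%R t) m = xi (s m).
  by rewrite sE (nth_map m) ?size_enum_ord // tnth_mktuple nth_ord_enum.
rewrite -!nthE; have st : sorted <=%R (sort <=%R t) by apply: sort_sorted; exact: le_total.
apply: (sorted_leq_nth le_trans lexx 0 st) => //;
  by rewrite inE size_sort size_tuple.
Qed.

(* Counting the pairs (r, l) with x_r > (l + 1) / n in the two possible orders: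
   the integer distances from the sorted sample to its ranks and from its
   counting function to the identity have the same sum of squares. *)
Lemma sorted_square_sum n (x : 'I_n -> R) :
  let N (l : 'I_n) := \sum_i (x i <= l.+1%:R / n%:R)%R%:R : R in
  (forall i j : 'I_n, (i <= j)%N -> x i <= x j) ->
  (forall i, 0 <= x i <= 1) ->
  \sum_i (n%:R * x i - i%:R) ^+ 2 <=
  2 * \sum_l (N l - l.+1%:R) ^+ 2 + 2 * n%:R.
Proof.
move=> N xm x01.
case: (posnP n) => [n0|n_gt0].
  by subst n; rewrite !big_ord0 !mulr0 addr0.
have n0 : 0 < n%:R :> R by rewrite ltr0n.
pose c (l : 'I_n) := #|[pred i | x i <= l.+1%:R / n%:R]|.
have NE l : N l = (c l)%:R.
  by rewrite /N /c -sum1_card natr_sum [RHS]big_mkcond; apply: eq_bigr => i _; rewrite inE; case: ifP.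
have cE (l i : 'I_n) : (x i <= l.+1%:R / n%:R) = (i < c l)%N.
  apply: (@down_closed_card _ [pred i | x i <= l.+1%:R / n%:R]) => a b ab /=.
  exact/le_trans/xm.
have cn (l : 'I_n) : (c l <= n)%N by rewrite -[leqRHS]card_ord max_card.
pose v (i : 'I_n) := #|[pred l : 'I_n | l.+1%:R / n%:R < x i]|.
have vE (i l : 'I_n) : (l.+1%:R / n%:R < x i) = (l < v i)%N.
  apply: (@down_closed_card _ [pred l : 'I_n | l.+1%:R / n%:R < x i]) => a b ab /=.
  apply: le_lt_trans; rewrite ler_pM2r ?invr_gt0 // ler_nat.
  by rewrite ltnS.
have vn i : (v i <= n)%N by rewrite -[leqRHS]card_ord max_card.
(* As v i <= n x_i <= v i + 1, rounding to the grid moves each point by at most 1; this is the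
   source of the term 2 n. *)
have dist i : (n%:R * x i - i%:R) ^+ 2 <= 2 * ((v i)%:R - i%:R) ^+ 2 + 2.
  have /andP[x0 x1] := x01 i.
  have h1 : (v i)%:R <= n%:R * x i.
    have [->|v0] := posnP (v i); first by rewrite mulr_ge0.
    have vl : ((v i).-1 < n)%N by rewrite prednK.
    have := vE i (Ordinal vl) => /=; rewrite prednK // leqnn.
    by rewrite ltr_pdivrMr // mulrC => /ltW.
  have h2 : n%:R * x i <= (v i)%:R + 1.
    have [vi|vi] := ltnP (v i) n; last first.
      have : n%:R <= (v i)%:R :> R by rewrite ler_nat.
      have : n%:R * x i <= n%:R by rewrite ler_piMr // ltW.
      by lra.
    have := vE i (Ordinal vi) => /=; rewrite ltnn => /negbT.
    by rewrite -leNgt ler_pdivlMr // natr1 mulrC.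
  have : 0 <= (n%:R * x i - (v i)%:R) * (1 - (n%:R * x i - (v i)%:R)).
    by rewrite mulr_ge0 //; lra.
  have := sqr_ge0 ((v i)%:R - i%:R - (n%:R * x i - (v i)%:R)); nra.
apply: le_trans (ler_sum _ (fun i _ => dist i)) _.
rewrite big_split /= -mulr_sumr sumr_const card_ord -[2 *+ n]mulr_natr lerD2r.
rewrite ler_pM2l // le_eqVlt; apply/orP; left; apply/eqP.
(* (v - i)^2 - i^2 telescopes over l < v, which turns the total into a sum over pairs (i, l), ready
   for the exchange of the two summations. *)
have vi2 (i : 'I_n) : ((v i)%:R - i%:R) ^+ 2 =
    \sum_(l < n) (l < v i)%:R * (2 * l%:R + 1 - 2 * i%:R) + i%:R ^+ 2 :> R.
  transitivity (\sum_(l < v i) (2 * l%:R + 1 - 2 * i%:R) + i%:R ^+ 2 : R); last first.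
    congr (_ + _); apply/esym.
    exact: (sum_ord_lt (fun l => 2 * l%:R + 1 - 2 * i%:R) (vn i)).
  rewrite -[LHS]sqrrN.
  have -> : \sum_(l < v i) (2 * l%:R + 1 - 2 * i%:R) =
     - \sum_(l < v i) ((2 * i%:R - 1) - 2 * l%:R) :> R.
    by rewrite -sumrN; apply: eq_bigr => l _; ring.
  by rewrite sum_arith; ring.
rewrite (eq_bigr _ (fun i _ => vi2 i)).
rewrite big_split /= exchange_big /=.
(* The relation l < v i fails exactly when i < c l, so the sum over i is a full sum minus an initial
   segment. *)
have cl2 (l : 'I_n) : \sum_(i < n) (l < v i)%:R * (2 * l%:R + 1 - 2 * i%:R) =
    (N l - l.+1%:R) ^+ 2 - (n%:R - l.+1%:R) ^+ 2.
  transitivity (\sum_(i < n) (2 * l%:R + 1 - 2 * i%:R) -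
      \sum_(i < n) (i < c l)%:R * (2 * l%:R + 1 - 2 * i%:R) : R).
    rewrite -sumrB; apply: eq_bigr => i _.
    by rewrite -vE ltNge cE; case: (i < c l)%N => /=; ring.
  transitivity (\sum_(i < n) (2 * l%:R + 1 - 2 * i%:R) -
      \sum_(i < c l) (2 * l%:R + 1 - 2 * i%:R) : R).
    congr (_ - _); exact: (sum_ord_lt (fun i => 2 * l%:R + 1 - 2 * i%:R) (cn l)).
  rewrite !sum_arith NE -natr1.
  ring.
rewrite (eq_bigr _ (fun i _ => cl2 i)).
rewrite sumrB -[RHS]addr0 -addrA; congr (_ + _).
(* The leftover squares i^2 and (n - l - 1)^2 cancel once the order is reversed. *)
rewrite [X in _ + X](reindex_inj rev_ord_inj) /=.
rewrite addrC; apply/eqP; rewrite subr_eq0; apply/eqP; apply: eq_bigr => i _.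
by rewrite natrB // ltn_ord.
Qed.

Lemma rank_approximation n (xi : 'I_n -> R) : (forall i, 0 <= xi i <= 1) ->
  exists s : {perm 'I_n},
  \sum_i (n%:R * xi i - (s i)%:R) ^+ 2 <=
  2 * \sum_(l < n) (\sum_i (xi i <= l.+1%:R / n%:R)%R%:R - l.+1%:R) ^+ 2
  + 2 * n%:R.
Proof.
move=> x01; have [s sm] := sorting_perm xi.
(* The sorting permutation sends ranks to vertices; its inverse sends a vertex to its rank, counted
   from 0. *)
exists (s^-1)%g.
have := @sorted_square_sum n (fun i => xi (s i)) sm (fun i => x01 (s i)).
rewrite (reindex_inj (@perm_inj _ (s^-1)%g)) /=.
under eq_bigr do rewrite permKV.
move=> h; apply: le_trans h _; rewrite lerD2r ler_pM2l //.
rewrite le_eqVlt; apply/orP; left; apply/eqP; apply: eq_bigr => l _.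
by rewrite [in RHS](reindex_inj (@perm_inj _ s)).
Qed.

Lemma rank_block_ltn n k (i : 'I_n) : (0 < k)%N -> (i * k %/ n < k)%N.
Proof.
move=> k0; have n0 : (0 < n)%N by case: i => i; case: n.
by rewrite ltn_divLR // mulnC ltn_pmul2l.
Qed.

Definition rank_block n k (k0 : (0 < k)%N) (s : {perm 'I_n}) : {ffun 'I_n -> 'I_k} :=
  [ffun i => Ordinal (rank_block_ltn (s i) k0)].

Lemma rank_block_maps n k n0 (k0 : (0 < k)%N) (s : {perm 'I_n}) :
  (n0 * k <= n)%N -> block_maps n0 (rank_block k0 s).
Proof.
move=> n0k b.
case: (posnP n0) => [->//|n00].
have n_gt0 : (0 < n)%N by apply: leq_trans n0k; rewrite muln_gt0 n00.
(* Block b collects the ranks in [b n / k, (b + 1) n / k[. [f0 0] is the ceiling of b n / k, and n0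
   consecutive ranks fit from there on because n0 k <= n. *)
pose f0 (t : nat) := (((b * n + k.-1) %/ k) + t)%N.
have q1 : (b * n <= (b * n + k.-1) %/ k * k <= b * n + k.-1)%N.
  have := divn_eq (b * n + k.-1) k; have := ltn_pmod (b * n + k.-1) k0; lia.
have f0P (t : 'I_n0) : (f0 t * k < b.+1 * n)%N /\ (b * n <= f0 t * k)%N.
  have : (t.+1 * k <= n0 * k)%N by rewrite leq_mul2r ltn_ord orbT.
  by move: q1 (ltn_ord t) => /andP[h1 h2] h3 h4; rewrite /f0 mulnDl mulSn; split; lia.
have f0n (t : 'I_n0) : (f0 t < n)%N.
  have [h _] := f0P t; rewrite -(ltn_pmul2r k0); apply: leq_trans h _.
  by rewrite mulnC leq_mul2l ltn_ord orbT.
pose f t : 'I_n := (s^-1)%g (Ordinal (f0n t)).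
have fi : injective f.
  by move=> t u /perm_inj /(congr1 val) /= /addnI /val_inj.
rewrite -[leqLHS]card_ord -(card_codom fi).
apply/subset_leq_card/fintype.subsetP => _ /codomP[t ->]; rewrite inE.
apply/eqP/val_inj; rewrite /f ffunE /= permKV /=.
have [h1 h2] := f0P t.
by apply/eqP; rewrite eqn_leq leq_divRL // h2 -ltnS ltn_divLR // h1.
Qed.

Lemma rank_block_dist n k (k0 : (0 < k)%N) (s : {perm 'I_n}) i :
  0 <= ((s i)%:R / n%:R - (rank_block k0 s i)%:R / k%:R : R) <= k%:R^-1.
Proof.
have n_gt0 : (0 < n)%N by case: i => i; case: n s.
have k0' : 0 < k%:R :> R by rewrite ltr0n.
have n0' : 0 < n%:R :> R by rewrite ltr0n.
rewrite ffunE /=; set q := (s i * k %/ n)%N.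
have h1 : (q * n <= s i * k)%N by rewrite leq_divM.
have h2 : (s i * k < q.+1 * n)%N by rewrite -ltn_divLR.
rewrite -(ler_nat R) !natrM in h1; rewrite -(ltr_nat R) !natrM -[q.+1%:R]natr1 in h2.
have kn0 : (k%:R != 0 :> R) && (n%:R != 0 :> R).
  by rewrite (gt_eqF k0') (gt_eqF n0').
have -> : (s i)%:R / n%:R - q%:R / k%:R =
    ((s i)%:R * k%:R - q%:R * n%:R) / (n%:R * k%:R) :> R by field.
rewrite divr_ge0 ?subr_ge0 ?mulr_ge0 //= ler_pdivrMr ?mulr_gt0 //.
by rewrite mulrCA mulVf ?(gt_eqF k0') // mulr1; lra.
Qed.

End Ranks.

(** * Smoothness *)

Section HolderModulus.
Context {R : realType}.
Implicit Types (W : R * R -> R) (D : nat -> nat -> R * R -> R).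

Lemma unit_derivative_approx (g : R -> R) x l : unit_derivative g x l ->
  forall e, 0 < e -> exists2 d, 0 < d & forall t, 0 <= t <= 1 -> `|t - x| < d ->
    `|g t - g x - l * (t - x)| <= e * `|t - x|.
Proof.
move=> /cvgrPdist_le H e e0; have := H e e0.
move=> [d /= d0 Hd]; exists d => // t t01 tx.
have [->|tnx] := eqVneq t x; first by rewrite !subrr mulr0 normr0 subr0 normr0 mulr0.
have := Hd t; rewrite /ball_ /= distrC => /(_ tx).
rewrite in_itv /= => /(_ tnx t01) h.
have tx0 : t - x != 0 by rewrite subr_eq0.
have -> : g t - g x - l * (t - x) = - ((l - (g t - g x) / (t - x)) * (t - x)).
  by field.
by rewrite normrN normrM ler_wpM2r.
Qed.

(** The derivative relative to [0, 1] is an ordinary one at interior points and gives one-sided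
    continuity at the ends, which is what the mean value theorem asks for. *)
Lemma unit_derivative_lipschitz (g dg : R -> R) B :
  (forall t, 0 <= t <= 1 -> unit_derivative g t (dg t)) ->
  (forall t, 0 <= t <= 1 -> `|dg t| <= B) ->
  forall x x', 0 <= x <= 1 -> 0 <= x' <= 1 -> `|g x' - g x| <= B * `|x' - x|.
Proof.
move=> gd gB.
suff H a b : 0 <= a -> a < b -> b <= 1 -> `|g b - g a| <= B * `|b - a|.
  move=> x x' /andP[x0 x1] /andP[x'0 x'1]; case: (ltgtP x x') => [xx'|xx'|->].
  - exact: H.
  - by rewrite distrC [`|x' - x|]distrC; exact: H.
  - by rewrite !subrr normr0 mulr0.
move=> a0 ab b1.
have itv t : t \in `]a, b[ -> 0 < t < 1.
  by rewrite in_itv /= => /andP[h1 h2]; apply/andP; split; lra.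
have der t : t \in `]a, b[ -> is_derive t 1 g (dg t).
  move=> tab; have /andP[t0 t1] := itv t tab.
  have c : (fun h => h^-1 *: ((g \o shift t) (h *: 1) - g t)) @ 0^' --> dg t.
    apply/cvgrPdist_le => e e0.
    have t01 : 0 <= t <= 1 by rewrite !ltW.
    have [d d0 Hd] := unit_derivative_approx (gd t t01) e0.
    have m0 : 0 < Num.min d (Num.min t (1 - t)) by rewrite !lt_min d0 t0 subr_gt0.
    near=> h.
    have h0 : h != 0 by near: h; exact: nbhs_dnbhs_neq.
    have : `|h| < Num.min d (Num.min t (1 - t)) by near: h; exact: dnbhs0_lt.
    rewrite !lt_min => /and3P[hd]; rewrite !ltr_norml => /andP[h1 _] /andP[_ h2].
    have := Hd (h + t); rewrite addrK => /(_ _ hd).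
    have -> : 0 <= h + t <= 1 by apply/andP; split; lra.
    move=> /(_ isT) hh; rewrite /= /GRing.scale /= mulr1.
    have -> : dg t - h^-1 * (g (h + t) - g t) =
        - (g (h + t) - g t - dg t * h) / h by field.
    by rewrite normrM normrN normfV ler_pdivrMr ?normr_gt0.
  by split; [apply: cvgP c | exact: cvg_lim c].
have cont : {within `[a, b], continuous g}.
  apply/subspace_continuousP => t; rewrite /= in_itv /= => /andP[t0 t1].
  have t01 : 0 <= t <= 1 by apply/andP; split; lra.
  apply/cvgrPdist_le => e e0.
  have [d d0 Hd] := unit_derivative_approx (gd t t01) ltr01.
  have q0 : 0 < `|dg t| + 1 by rewrite ltr_wpDl.
  exists (Num.min d (e / (`|dg t| + 1))); first by rewrite /= lt_min d0 divr_gt0.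
  move=> s /=; rewrite lt_min distrC => /andP[sd se]; rewrite in_itv /= => /andP[s0 s1].
  have := Hd s; rewrite mul1r => /(_ _ sd) h.
  have {}h : `|g s - g t - dg t * (s - t)| <= `|s - t|.
    by apply: h; apply/andP; split; lra.
  rewrite distrC; have -> : g s - g t = (g s - g t - dg t * (s - t)) + dg t * (s - t) by ring.
  apply: le_trans (ler_normD _ _) _; rewrite normrM.
  move: se; rewrite ltr_pdivlMr //; lra.
have [c cab ->] := MVT ab der cont.
have /andP[c0 c1] := itv c cab.
by rewrite normrM ler_wpM2r // gB // !ltW.
Unshelve. all: by end_near.
Qed.

(* By interpolation at l + 1 points, the linear coefficient of a polynomial of
   degree l is a linear form in its values there. *)
Lemma linear_coef_bound (l : nat) : exists2 C : R, 0 <= C &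
  forall (c : nat -> R) B, (0 < l)%N ->
    (forall t, 0 <= t <= 1 / 2 -> `|\sum_(i < l.+1) c i * t ^+ i| <= B) ->
    `|c 1%N| <= C * B.
Proof.
pose t (m : 'I_l.+1) : R := m%:R / (2 * l.+1%:R).
have l0 : 0 < l.+1%:R :> R by rewrite ltr0n.
have t_itv m : 0 <= t m <= 1 / 2.
  rewrite /t divr_ge0 ?mulr_ge0 //= ler_pdivrMr ?mulr_gt0 //.
  have : m%:R <= l.+1%:R :> R by rewrite ler_nat ltnW.
  lra.
have tinj : injective t.
  move=> m m' /(congr1 (fun x => x * (2 * l.+1%:R))) /=; rewrite /t.
  rewrite !mulfVK ?mulf_neq0 ?pnatr_eq0 // => /eqP.
  by rewrite eqr_nat => /eqP/val_inj.
pose V := Vandermonde l.+1 (\row_m t m).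
have Vu : V \in unitmx.
  rewrite unitmxE det_Vandermonde unitfE; apply/prodf_neq0 => i _.
  apply/prodf_neq0 => j ij; rewrite !mxE subr_eq0; apply/eqP => /tinj ji.
  by move: ij; rewrite ji ltnn.
pose w := invmx V *m (\col_(i < l.+1) (i == 1%N :> nat)%:R).
have wE (i : 'I_l.+1) : \sum_m t m ^+ i * w m 0 = (i == 1%N :> nat)%:R.
  have := mulmxA V (invmx V) (\col_(i < l.+1) (i == 1%N :> nat)%:R : 'cV[R]_l.+1).
  rewrite mulmxV // mul1mx -/w => /matrixP/(_ i 0); rewrite !mxE => <-.
  by apply: eq_bigr => m _; rewrite !mxE.
exists (\sum_m `|w m 0|); first by apply: sumr_ge0.
move=> c B l_gt0 cB.
have -> : c 1%N = \sum_m w m 0 * \sum_(i < l.+1) c i * t m ^+ i.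
  transitivity (\sum_(i < l.+1) c i * (i == 1%N :> nat)%:R).
    have l1 : (1 < l.+1)%N by [].
    rewrite (bigD1 (Ordinal l1)) //= mulr1 big1 ?addr0 // => i.
    by rewrite -val_eqE /= => /negbTE ->; rewrite mulr0.
  under eq_bigr do rewrite -wE mulr_sumr.
  rewrite exchange_big /=; apply: eq_bigr => m _; rewrite mulr_sumr.
  by apply: eq_bigr => i _; ring.
apply: le_trans (ler_norm_sum _ _ _) _; rewrite mulr_suml; apply: ler_sum => m _.
by rewrite normrM ler_wpM2l // cB.
Qed.

Lemma powR_le1 (x p : R) : 0 <= x <= 1 -> 0 <= p -> x `^ p <= 1.
Proof.
move=> /andP[x0 x1] p0; have -> : 1 = 1 `^ p :> R by rewrite powR1.
by rewrite ge0_ler_powR // nnegrE.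
Qed.

Lemma holder_class_swap alpha L W :
  holder_class alpha L W -> holder_class alpha L (fun z => W (z.2, z.1)).
Proof.
move=> [uW [D [D0 Dd] DT]].
have sw x y : unit_square (x, y) -> unit_square (y, x) :> Prop.
  by move=> [h1 h2]; split.
split; first by move=> [x y] /sw/uW.
exists (fun i j z => D j i (z.2, z.1)).
  split; first by move=> [x y] /sw/D0.
  move=> i j ij x y /sw xy; rewrite addnC in ij.
  by have [h1 h2] := Dd j i ij y x xy.
move=> x y x' y' /sw xy /sw xy'.
have := DT _ _ _ _ xy xy'; rewrite /= [in leRHS]addrC.
congr (`| _ - _ | <= _); rewrite /taylor_polynomial /=.
rewrite (exchange_big_dep xpredT) //=; apply: eq_bigr => i _.
apply: eq_big => [j|j _]; first by rewrite addnC.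
by rewrite mulnC -!mulrA; congr (_ * (_ * _)); rewrite mulrC.
Qed.

(** Along the first variable the Taylor polynomial differs from W by at most L, so it is bounded by
    1 + L on an interval of length 1/2. The interpolation constant C then bounds its linear
    coefficient, the partial derivative, by C (1 + L). *)
Lemma holder_class_first alpha L C W : 1 < alpha -> 0 < L -> 0 <= C ->
  (forall (c : nat -> R) B, (0 < holder_order alpha)%N ->
    (forall t, 0 <= t <= 1 / 2 ->
       `|\sum_(i < (holder_order alpha).+1) c i * t ^+ i| <= B) ->
    `|c 1%N| <= C * B) ->
  holder_class alpha L W ->
  forall x x' y, unit_square (x, y) -> unit_square (x', y) ->
    `|W (x', y) - W (x, y)| <= C * (1 + L) * `|x' - x|.
Proof.
move=> al1 L0 C0 CP [uW [D [D0 Dd] DT]].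
set l := holder_order alpha in CP D0 Dd DT.
have cg1 : (1 < Num.ceil alpha)%R by rewrite ceil_gt_int.
have lE : l%:R = (Num.ceil alpha)%:~R - 1 :> R.
  rewrite /l /holder_order; case: (Num.ceil alpha) cg1 => // m m1.
  by rewrite /= -pmulrn -[in RHS](@prednK m) ?(ltn_trans _ m1) // -[_.+1%:R]natr1 addrK.
have l_gt0 : (0 < l)%N.
  rewrite -(ltr_nat R) lE subr_gt0.
  by rewrite (_ : 1 = 1%:~R) // ltr_int.
have be0 : 0 < alpha - l%:R.
  by rewrite lE; have := ceilB1_lt alpha; rewrite intrD; lra.
move=> x x' y xy x'y.
have y01 : 0 <= y <= 1 by case: xy => _; rewrite /= in_itv.
have sq t : 0 <= t <= 1 -> unit_square (t, y).
  by move=> t01; split; rewrite /= in_itv.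
rewrite -(D0 _ xy) -(D0 _ x'y).
apply: (@unit_derivative_lipschitz (fun t => D 0%N 0%N (t, y)) (fun t => D 1%N 0%N (t, y))).
- by move=> t /sq ty; have [] := Dd 0%N 0%N l_gt0 t y ty.
- move=> t t01; have ty := sq t t01.
  (* From any t, one of the two directions leaves room 1/2 inside [0, 1]; the sign e is absorbed by
     the coefficients. *)
  have [e [e1 eP]] : exists e : R, `|e| = 1 /\ forall h, 0 <= h <= 1 / 2 -> 0 <= t + e * h <= 1.
    have [th|th] := leP t (1 / 2).
      exists 1; rewrite normr1; split => // h h01; apply/andP; split; lra.
    exists (- 1); rewrite normrN1; split => // h h01; apply/andP; split; lra.
  have := CP (fun i => D i 0%N (t, y) / (i`! * 0`!)%:R * e ^+ i) (1 + L) l_gt0.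
  rewrite /= divr1 expr1 normrM e1 mulr1; apply => h h01.
  have te := eP h h01; have tey := sq _ te.
  have teE : t + e * h - t = e * h by ring.
  have := DT _ _ _ _ ty tey; rewrite teE subrr normr0 powR0 ?gt_eqF // addr0.
  rewrite (_ : taylor_polynomial _ _ _ _ =
    \sum_(i < l.+1) D i 0%N (t, y) / (i`! * 0`!)%:R * e ^+ i * h ^+ i); last first.
    rewrite /taylor_polynomial; apply: eq_bigr => i _.
    rewrite (bigD1 ord0) ?addn0 //=; last by rewrite -ltnS.
    rewrite big1 ?addr0 => [|j /andP[_ j0]]; last first.
      by rewrite expr0n (_ : (j == 0 :> nat)%N = false) ?mulr0 //; apply/negbTE.
    by rewrite expr0 mulr1 exprMn mulrA.
  move=> hT; have := uW _ tey => /andP[w0 w1].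
  have h1 : `|e * h| `^ (alpha - l%:R) <= 1.
    rewrite powR_le1 ?(ltW be0) // normrM e1 mul1r ger0_norm; lra.
  move: hT; set P := \sum_(i < _) _ => hT.
  have : L * `|e * h| `^ (alpha - l%:R) <= L by rewrite ler_piMr // ltW.
  move: w0 w1 hT; set w := W _ => w0 w1 hT hL.
  rewrite (_ : P = w - (w - P)); last by ring.
  by apply: le_trans (ler_normB _ _) _; rewrite ger0_norm //; lra.
- by case: xy; rewrite /= in_itv.
- by case: x'y; rewrite /= in_itv.
Qed.

(** For alpha <= 1 the Taylor polynomial is the constant W(x, y) and M = L works. For alpha > 1 the
    increments in the second variable follow from those in the first by exchanging the variables. *)
Lemma holder_modulus (alpha L : R) : 0 < alpha -> 0 < L ->
  exists2 M : R, 0 < M & forall W, holder_class alpha L W ->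
    forall x y x' y', unit_square (x, y) -> unit_square (x', y') ->
    `|W (x', y') - W (x, y)| <=
      M * (`|x' - x| `^ Num.min alpha 1 + `|y' - y| `^ Num.min alpha 1).
Proof.
move=> a0 L0; have [a1|a1] := leP alpha 1.
  have c1 : Num.ceil alpha = 1.
    apply/eqP; rewrite eq_le ceil_le_int a1 /=.
    by rewrite -[leLHS]add0r lezD1 ceil_gt0.
  exists L => // W [_]; rewrite /holder_order c1 /= subr0.
  move=> [D [D0 _] H] x y x' y' xy xy'; have := H _ _ _ _ xy xy'.
  by rewrite /taylor_polynomial big_ord1 big_mkcond big_ord1 /= !expr0 !mulr1 divr1 D0.
have [C C0 CP] := linear_coef_bound (holder_order alpha).
exists (C * (1 + L) + 1); first by rewrite ltr_wpDl // mulr_ge0 //; lra.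
move=> W HW x y x' y' xy xy'; rewrite !powRr1 //.
have xy1 : unit_square (x', y) by case: xy xy' => ? ? [? ?]; split.
have h1 := holder_class_first a1 L0 C0 CP HW xy xy1.
have h2 : `|W (x', y') - W (x', y)| <= C * (1 + L) * `|y' - y|.
  have := @holder_class_first alpha L C (fun z => W (z.2, z.1)) a1 L0 C0 CP
    (holder_class_swap HW) y y' x'.
  by apply; [case: xy1|case: xy'] => ? ?; split.
have -> : W (x', y') - W (x, y) = (W (x', y') - W (x', y)) + (W (x', y) - W (x, y)) by ring.
apply: le_trans (ler_normD _ _) _.
have := normr_ge0 (x' - x); have := normr_ge0 (y' - y); lra.
Qed.

End HolderModulus.

(** * The graphon distance *)

(* The integral of a nonnegative function is a supremum over the simple
   functions below it, so measurability plays no role here. *)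
Lemma ge0_le_integral_any d (T : measurableType d) (R : realType)
    (mu : {measure set T -> \bar R}) (D : set T) (f g : T -> \bar R) :
  (forall x, D x -> 0 <= f x)%E -> (forall x, D x -> f x <= g x)%E ->
  (\int[mu]_(x in D) f x <= \int[mu]_(x in D) g x)%E.
Proof.
move=> f0 fg; rewrite !ge0_integralE //; last first.
  by move=> x Dx; apply: le_trans (fg x Dx); exact: f0.
apply: le_ereal_sup => _ [h /= hf <-]; exists h => // x /=.
apply: le_trans (hf x) _; rewrite /patch.
by case: ifPn => // /set_mem /fg.
Qed.

Section Cells.
Context {R : realType}.
Variables (n : nat).
Hypothesis n_gt0 : (0 < n)%N.
Implicit Types (s : {perm 'I_n}) (i j : 'I_n) (x : R).

Let n0 : 0 < n%:R :> R.
Proof. by rewrite ltr0n. Qed.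

(** Open on the left to agree with the ceiling in [empirical_graphon]; within [0, 1] only the point
    0 lies in no cell. *)
Definition cell (i : 'I_n) : set R := `](i%:R / n%:R), (i.+1%:R / n%:R)].

Lemma cellE i x : cell i x <-> Num.ceil (n%:R * x) == Posz i.+1.
Proof.
rewrite /cell /= in_itv /= ltr_pdivrMr // ler_pdivlMr // mulrC.
rewrite eq_le ceil_le_int -pmulrn.
have -> : (Posz i.+1 <= Num.ceil (n%:R * x)) = (i%:R < n%:R * x).
  by rewrite -addn1 PoszD lezD1 ceil_gt_int -pmulrn.
by rewrite andbC.
Qed.

Lemma cell_inj i j x : cell i x -> cell j x -> i = j.
Proof.
by move=> /cellE /eqP ci /cellE; rewrite ci eqz_nat eqSS => /eqP/val_inj.
Qed.

Lemma cell_cover x : 0 < x <= 1 -> exists i, cell i x.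
Proof.
move=> /andP[x0 x1].
have c0 : 0 < Num.ceil (n%:R * x) by rewrite ceil_gt0 mulr_gt0.
have cn : Num.ceil (n%:R * x) <= n.
  by rewrite ceil_le_int -pmulrn ler_piMr // ltW.
have cell' m : Num.ceil (n%:R * x) = Posz m -> exists i, cell i x.
  move=> cE; rewrite cE in c0 cn; case: m c0 cn cE => // m _ mn cE.
  by exists (Ordinal mn); apply/cellE; rewrite cE.
by case: (Num.ceil _) c0 cell' => // m _; apply.
Qed.

Lemma cell_sub i x : cell i x -> 0 < x <= 1.
Proof.
rewrite /cell /= in_itv /= => /andP[h1 h2]; apply/andP; split.
  by apply: le_lt_trans h1; rewrite divr_ge0.
by apply: (le_trans h2); rewrite ler_pdivrMr // mul1r ler_nat.
Qed.

Lemma measurable_cell i : measurable (cell i).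
Proof. exact: measurable_itv. Qed.

Lemma lebesgue_measure_cell i : lebesgue_measure (cell i) = (n%:R^-1)%:E :> \bar R.
Proof.
rewrite /cell lebesgue_measure_itv /= lte_fin ltr_pM2r ?invr_gt0 // ltr_nat ltnSn.
by rewrite -EFinB -mulrBl -[i.+1%:R]natr1 addrAC subrr add0r mul1r.
Qed.

(** Translates cell i onto cell s i and fixes every point outside the cells; the indicators make it
    visibly measurable. *)
Definition cell_shift (s : {perm 'I_n}) (x : R) : R :=
  x + \sum_(i < n) \1_(cell i) x * (((s i)%:R - i%:R) / n%:R).

Lemma cell_shiftE s i x : cell i x -> cell_shift s x = x + ((s i)%:R - i%:R) / n%:R.
Proof.
move=> ix; rewrite /cell_shift (bigD1 i) //= big1 => [|j ji].
  by rewrite indicE mem_set // mul1r addr0.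
rewrite indicE memNset ?mul0r // => jx.
by move/eqP: ji; apply; exact: cell_inj jx ix.
Qed.

Lemma cell_shift_cell s i x : cell i x -> cell (s i) (cell_shift s x).
Proof.
move=> ix; rewrite (cell_shiftE s ix); move: ix; rewrite /cell /= !in_itv /=.
rewrite -![_.+1%:R]natr1 => /andP[h1 h2]; apply/andP; split.
  have -> : (s i)%:R / n%:R = i%:R / n%:R + ((s i)%:R - i%:R) / n%:R :> R by ring.
  by rewrite ltrD2r.
have -> : ((s i)%:R + 1) / n%:R = (i%:R + 1) / n%:R + ((s i)%:R - i%:R) / n%:R :> R.
  by ring.
by rewrite lerD2r.
Qed.

Lemma cell_shift0 s : cell_shift s 0 = 0.
Proof.
rewrite /cell_shift add0r big1 // => i _; rewrite indicE memNset ?mul0r //.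
by move=> /cell_sub; rewrite ltxx.
Qed.

Lemma unit_itv_case x : 0 <= x <= 1 -> x = 0 \/ exists i, cell i x.
Proof.
move=> /andP[]; rewrite le_eqVlt => /predU1P[<-|x0 x1]; first by left.
by right; apply: cell_cover; rewrite x0.
Qed.

Lemma cell_shiftK s x : 0 <= x <= 1 -> cell_shift s^-1%g (cell_shift s x) = x.
Proof.
case/unit_itv_case => [->|[i ix]]; first by rewrite !cell_shift0.
rewrite (cell_shiftE _ (cell_shift_cell s ix)) (cell_shiftE s ix) permK.
by ring.
Qed.

Lemma cell_shift_itv s x : 0 <= x <= 1 -> 0 <= cell_shift s x <= 1.
Proof.
case/unit_itv_case => [->|[i ix]]; first by rewrite cell_shift0 lexx ler01.
by have /andP[/ltW -> ->] := cell_sub (cell_shift_cell s ix).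
Qed.

Lemma measurable_cell_shift s : measurable_fun setT (cell_shift s).
Proof.
apply: measurable_funD => //; apply: measurable_sum => i.
by apply: measurable_funM => //; apply: measurable_indic; exact: measurable_cell.
Qed.

Lemma lebesgue_measure_shift (c : R) (A : set R) : measurable A ->
  lebesgue_measure ((fun x => x + c) @^-1` A) = lebesgue_measure A.
Proof.
move=> mA.
have mf : measurable_fun [set: measurableTypeR R]
    ((fun x => x + c) : _ -> measurableTypeR R).
  exact: measurable_funD.
transitivity (pushforward lebesgue_measure
  ((fun x => x + c) : _ -> measurableTypeR R) A) => //.
apply/esym/lebesgue_measure_unique => //= _ [[a b]] _ <-.
rewrite /pushforward (_ : _ @^-1` _ = `]a - c, b - c]%classic); last first.
  by apply/seteqP; split => x /=; rewrite !in_itv /= ltrBlDr lerBrDr.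
by rewrite !lebesgue_measure_itv /= !lte_fin ltrD2r -!EFinB opprD addrACA subrr addr0.
Qed.

Lemma lebesgue_measure_cells (X : set R) : measurable X -> X `<=` `[0, 1] ->
  lebesgue_measure X = (\sum_(i < n) lebesgue_measure (X `&` cell i))%E.
Proof.
move=> mX X01.
have m0 : measurable ([set 0] : set R) by [].
have mXc i : measurable (X `&` cell i).
  by apply: measurableI => //; exact: measurable_cell.
have XE : X = (X `&` [set 0]) `|` \big[setU/set0]_(i < n) (X `&` cell i).
  apply/seteqP; split => [x Xx|x [[]//|]].
    have /unit_itv_case : 0 <= x <= 1 by have := X01 x Xx; rewrite /= in_itv.
    by case=> [x0|[i ix]]; [left|right; rewrite -bigcup_seq; exists i => //=; rewrite mem_index_enum].
  by rewrite -bigcup_seq => -[i _ []].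
rewrite [in LHS]XE measureU.
- rewrite [X in (X + _)%E](_ : _ = 0%E) ?add0e; last first.
    apply/eqP; rewrite eq_le measure_ge0 andbT -(lebesgue_measure_set1 (0 : R)).
    apply: le_measure; [exact/mem_set/measurableI|exact/mem_set|exact: subIsetr].
  rewrite measure_bigsetU_ord //.
  by move=> i j _ _ [x [[_ ix] [_ jx]]]; exact: cell_inj ix jx.
- exact: measurableI.
- by apply: bigsetU_measurable => i _; exact: mXc.
- apply/seteqP; split => // x [[_ ->]]; rewrite -bigcup_seq.
  by move=> [i _ [_ /cell_sub]]; rewrite ltxx.
Qed.

(** The shift by the inverse permutation undoes it. Measure is preserved cell by cell by translation
    invariance, the point 0 being negligible. *)
Lemma cell_shift_mpb s : measure_preserving_bijection (cell_shift s).
Proof.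
split.
- split.
  + by move=> x; rewrite /= !in_itv /=; exact: cell_shift_itv.
  + move=> x y /set_mem + /set_mem; rewrite /= !in_itv /= => x01 y01 E.
    by rewrite -(cell_shiftK s x01) E cell_shiftK.
  + move=> y; rewrite /= in_itv /= => y01.
    exists (cell_shift s^-1%g y); first by rewrite /= in_itv /= cell_shift_itv.
    by rewrite -{1}[s]invgK cell_shiftK.
- by apply: measurable_funTS; exact: measurable_cell_shift.
move=> B mB B01.
have mtB : measurable (`[0, 1] `&` cell_shift s @^-1` B).
  have := measurable_cell_shift s measurableT mB; rewrite setTI.
  by apply: measurableI; exact: measurable_itv.
rewrite (lebesgue_measure_cells mtB); last by move=> x [].
rewrite (lebesgue_measure_cells mB B01) [RHS](reindex_inj (@perm_inj _ s)) /=.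
apply: eq_bigr => i _.
rewrite -[RHS](lebesgue_measure_shift (((s i)%:R - i%:R) / n%:R)); last first.
  by apply: measurableI => //; exact: measurable_cell.
congr lebesgue_measure; apply/seteqP; split => x.
  move=> [[x01 xB] ix]; rewrite /= -(cell_shiftE s ix); split => //.
  exact: cell_shift_cell.
move=> [/= xB ix].
have {}ix : cell i x.
  move: ix; rewrite /cell /= !in_itv /= -![_.+1%:R]natr1.
  have -> : (s i)%:R / n%:R = i%:R / n%:R + ((s i)%:R - i%:R) / n%:R :> R by ring.
  have -> : ((s i)%:R + 1) / n%:R = (i%:R + 1) / n%:R + ((s i)%:R - i%:R) / n%:R :> R.
    by ring.
  by rewrite ltrD2r lerD2r.
split => //; split; last by rewrite /= (cell_shiftE s ix).
by rewrite in_itv /=; have /andP[/ltW -> ->] := cell_sub ix.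
Qed.

Lemma empirical_graphonE (Th : 'M[R]_n) i j x y : cell i x -> cell j y ->
  empirical_graphon Th (x, y) = Th i j.
Proof.
move=> /cellE /= /eqP ix /cellE /= /eqP jy; rewrite /empirical_graphon.
rewrite (bigD1 i) //= (bigD1 j) //= ix jy !eqxx /=.
rewrite big1 => [|j' /negbTE j'j]; last by rewrite eqz_nat eqSS eq_sym val_eqE j'j.
rewrite big1 ?addr0 // => i' /negbTE i'i; rewrite big1 // => j' _.
by rewrite eqz_nat eqSS eq_sym val_eqE i'i.
Qed.

(** The shift by s is one candidate of the infimum, and its integrand lies below a step function
    constant on products of cells, each of area n^-2. *)
Lemma delta2_le (Th : 'M[R]_n) (f0 : R * R -> R) (s : {perm 'I_n})
    (c : 'I_n -> 'I_n -> R) :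
  (forall i j, 0 <= c i j) ->
  (forall i j u v, cell (s i) u -> cell (s j) v -> (f0 (u, v) - Th i j) ^+ 2 <= c i j) ->
  (delta2 (empirical_graphon Th) f0 <= (\sum_i \sum_j c i j / n%:R ^+ 2)%:E)%E.
Proof.
move=> c0 cP.
apply: (@le_trans _ _ (\int[(lebesgue_measure \x lebesgue_measure)%E]_(
    z in open_unit_square) (`|f0 (cell_shift s z.1, cell_shift s z.2)
      - empirical_graphon Th z| ^+ 2)%:E)%E).
  by apply: ereal_inf_lbound; exists (cell_shift s) => //; exact: cell_shift_mpb.
have mc (p : 'I_n * 'I_n) : measurable (cell p.1 `*` cell p.2).
  by apply: measurableX; exact: measurable_cell.
apply: (@le_trans _ _ (\int[(lebesgue_measure \x lebesgue_measure)%E]_(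
    z in open_unit_square)
    (\sum_(p : 'I_n * 'I_n) (c p.1 p.2)%:E * (\1_(cell p.1 `*` cell p.2) z)%:E))%E).
  apply: ge0_le_integral_any => [z _|[x y] [/= x01 y01]].
    by rewrite lee_fin exprn_ge0.
  have [i ix] : exists i, cell i x.
    apply: cell_cover; move: x01; rewrite in_itv /= => /andP[-> /ltW ->] //.
  have [j jy] : exists j, cell j y.
    by apply: cell_cover; move: y01; rewrite in_itv /= => /andP[-> /ltW ->].
  rewrite (bigD1 (i, j)) //= -[leLHS]adde0 leeD //.
    rewrite indicE mem_set // mule1 lee_fin real_normK ?num_real //.
    by rewrite (empirical_graphonE _ ix jy); apply: cP; exact: cell_shift_cell.
  by apply: sume_ge0 => p _; rewrite mule_ge0 ?lee_fin.
have mo : measurable (@open_unit_square R).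
  by apply: measurableX; exact: measurable_itv.
rewrite ge0_integral_sum //; last 2 first.
- move=> p; apply: measurable_funeM; apply/measurable_EFinP.
  by apply: measurable_funTS; apply: measurable_indic; exact: mc.
- by move=> p z _; rewrite mule_ge0 ?lee_fin.
rewrite pair_bigA /= -sumEFin; apply: lee_sum => p _.
rewrite ge0_integralZl //; last 2 first.
- by apply/measurable_EFinP; apply: measurable_funTS; apply: measurable_indic; exact: mc.
- by rewrite lee_fin.
rewrite integral_indic; [|exact: mo|exact: mc].
rewrite EFinM lee_wpmul2l ?lee_fin //.
apply: (@le_trans _ _ ((lebesgue_measure \x lebesgue_measure)%E (cell p.1 `*` cell p.2))).
  apply: le_measure; [|apply/mem_set; exact: mc|exact: subIsetl].
  by apply/mem_set/measurableI => //; exact: mc.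
rewrite product_measure1E; [|exact: measurable_cell..].
by rewrite [X in (X * _)%E]lebesgue_measure_cell [X in (_ * X)%E]lebesgue_measure_cell -EFinM lee_fin -invfM -expr2.
Qed.

End Cells.

(** * Conditioning on the sample *)

Section Conditioning.
Context {R : realType} {d : measure_display} {Omega : measurableType d}.
Variable P : probability Omega R.
Variables (n : nat) (xi : 'I_n -> {RV P >-> R}).

Definition sample_sets : set (set Omega) :=
  \bigcup_(i in [set: 'I_n]) preimage_set_system setT (xi i) measurable.

(** Omega with the sigma-algebra of the sample: to depend measurably on the sample is to be
    measurable on this type. *)
Definition sample_space := g_sigma_algebraType sample_sets.

Lemma sample_measurable (E : set Omega) :
  generated_sigma_algebra xi E -> measurable E.
Proof.
apply: smallest_sub; first exact: sigma_algebra_measurable.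
move=> _ [i _ [B mB <-]]; rewrite setTI -[X in measurable X]setTI.
by apply: measurable_funPT.
Qed.

Lemma measurable_sample (i : 'I_n) :
  measurable_fun setT (xi i : sample_space -> R).
Proof.
move=> _ B mB; apply: sub_sigma_algebra; exists i => //.
by exists B.
Qed.

Lemma measurable_fun_sample (f : Omega -> R) :
  measurable_fun setT (f : sample_space -> R) -> measurable_fun setT f.
Proof. by move=> mf _ B mB; apply: sample_measurable; exact: mf. Qed.

(* Slicing f into level sets of height 1/N reduces integrals against the law
   of the sample to the defining property of conditional probabilities. *)
Lemma integral_sample_le (C : set Omega) (p : Omega -> R) (f : Omega -> R) (M : R) :
  measurable C ->
  measurable_fun setT (p : sample_space -> R) -> (forall w, 0 <= p w <= 1) ->
  measurable_fun setT (f : sample_space -> R) -> (forall w, 0 <= f w <= M) ->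
  (forall E, generated_sigma_algebra xi E ->
     P (E `&` C) = (\int[P]_(w in E) (p w)%:E)%E) ->
  (\int[P]_w (f w * \1_C w)%:E <= \int[P]_w (f w * p w)%:E)%E.
Proof.
move=> mC mp p01 mf f0M CE.
have mp' := measurable_fun_sample mp; have mf' := measurable_fun_sample mf.
(* The slack e is also the height of the slices: f is rounded up to (j + 1) e on [E j], at a final
   cost of at most e, and f <= M leaves finitely many slices. *)
apply/lee_addgt0Pr => e e0.
have [K MK] : exists K : nat, M / e < K%:R.
  by exists (Num.truncn (M / e)).+1; exact: truncnS_gt.
pose E (j : nat) : set Omega := f @^-1` `[(j%:R * e), (j.+1%:R * e)[.
have EG j : generated_sigma_algebra xi (E j).
  by have := mf measurableT `[(j%:R * e), (j.+1%:R * e)[%classic (measurable_itv _);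
    rewrite setTI.
have mE j := sample_measurable (EG j).
have EP w : exists2 j : 'I_K, E j w & forall j', E j' w -> j' = j.
  have /andP[f0 fM] := f0M w.
  have fe : 0 <= f w / e by rewrite divr_ge0 // ltW.
  have /andP[h1 h2] := truncn_itv fe.
  have jK : (Num.truncn (f w / e) < K)%N.
    rewrite -(ltr_nat R); apply: le_lt_trans h1 (le_lt_trans _ MK).
    by rewrite ler_pM2r ?invr_gt0.
  exists (Ordinal jK).
    by rewrite /E /= in_itv /= -ler_pdivlMr // h1 -ltr_pdivrMr.
  move=> j'; rewrite /E /= in_itv /= -ler_pdivlMr // -ltr_pdivrMr // => h.
  by apply/esym/eqP; rewrite truncn_eq.
have sumE w (c : nat -> R) (j : 'I_K) : E j w -> (forall j', E j' w -> j' = j :> nat) ->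
    \sum_(i < K) c i * \1_(E i) w = c j.
  move=> jw ju; rewrite (bigD1 j) //= indicE mem_set // mulr1 big1 ?addr0 //.
  move=> i ij; rewrite indicE memNset ?mulr0 // => iw.
  by move/eqP: ij; apply; apply/val_inj/ju.
apply: (@le_trans _ _ (\int[P]_w (\sum_(j < K) (j.+1%:R * e)%:E * (\1_(E j `&` C) w)%:E))%E).
  apply: ge0_le_integral_any => [w _|w _].
    by have /andP[f0 _] := f0M w; rewrite lee_fin mulr_ge0.
  have [j jw ju] := EP w.
  rewrite (eq_bigr (fun i : 'I_K => (i.+1%:R * e * \1_(E i) w * \1_C w)%:E)); last first.
    by move=> i _; rewrite -EFinM indicI /= mulrA.
  rewrite sumEFin lee_fin -mulr_suml (sumE w (fun i => i.+1%:R * e) j) //.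
    by rewrite ler_wpM2r //; move: jw; rewrite /E /= in_itv /= => /andP[_ /ltW].
rewrite ge0_integral_sum //; last 2 first.
- move=> j; apply: measurable_funeM; apply/measurable_EFinP.
  by apply: measurable_indic; exact: measurableI.
- by move=> j w _; rewrite mule_ge0 ?lee_fin ?mulr_ge0 // ltW.
have step (j : 'I_K) : (\int[P]_w ((j.+1%:R * e)%:E * (\1_(E j `&` C) w)%:E) =
    \int[P]_w ((j.+1%:R * e) * \1_(E j) w * p w)%:E)%E.
  have c0 : 0 <= j.+1%:R * e by rewrite mulr_ge0 // ltW.
  rewrite ge0_integralZl //; last first.
    by apply/measurable_EFinP; apply: measurable_indic; exact: measurableI.
  rewrite integral_indic //; last exact: measurableI.
  rewrite setIT -[X in (_ * X)%E]/(P (E j `&` C)) CE // integral_mkcond.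
  under [RHS]eq_integral do rewrite -mulrA EFinM.
  rewrite ge0_integralZl //; last 2 first.
  - by apply/measurable_EFinP; apply: measurable_funM => //; exact: measurable_indic.
  - by move=> w _; have /andP[? _] := p01 w; rewrite lee_fin mulr_ge0.
  congr (_ * _)%E; apply: eq_integral => w _; rewrite /patch indicE.
  by case: ifPn => wE; rewrite ?mul1r ?mul0r.
rewrite (eq_bigr _ (fun j _ => step j)) -ge0_integral_sum //; last 2 first.
- move=> j; apply/measurable_EFinP; apply: measurable_funM => //.
  by apply: measurable_funM => //; exact: measurable_indic.
- move=> j w _; have /andP[? _] := p01 w.
  by rewrite lee_fin !mulr_ge0 // ltW.
apply: (@le_trans _ _ (\int[P]_w ((f w * p w)%:E + e%:E))%E).
  apply: ge0_le_integral_any => [w _|w _].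
    apply: sume_ge0 => j _; have /andP[? _] := p01 w.
    by rewrite lee_fin !mulr_ge0 // ltW.
  have [j jw ju] := EP w; have /andP[p0 p1] := p01 w.
  rewrite sumEFin -EFinD lee_fin -mulr_suml (sumE w (fun i => i.+1%:R * e) j) //.
  move: jw; rewrite /E /= in_itv /= => /andP[jf _].
  rewrite -natr1 mulrDl mul1r mulrDl lerD //; first by rewrite ler_wpM2r.
  by rewrite ler_piMr // ltW.
rewrite ge0_integralD //.
- by rewrite integral_cst // -[X in (_ * X)%E]/(P setT) probability_setT mule1.
- by move=> w _; have /andP[? _] := p01 w; have /andP[? _] := f0M w; rewrite lee_fin mulr_ge0.
- by apply/measurable_EFinP; exact: measurable_funM.
- by move=> w _; rewrite lee_fin ltW.
Qed.

End Conditioning.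

(** * Expectations in the sparse graphon model *)

Section Model.
Context {R : realType} {d : measure_display} {Omega : measurableType d}.
Variable P : probability Omega R.
Variables (n : nat) (rho : R) (W0 : R * R -> R).
Variables (xi : 'I_n -> {RV P >-> R}) (A : 'I_n -> 'I_n -> {RV P >-> bool}).
Hypotheses (rho0 : 0 < rho) (rho1 : rho <= 1).
Hypothesis W0_graphon : graphon W0.
Hypothesis model : sparse_graphon_model rho W0 xi A.

Implicit Types i j : 'I_n.

Let I := lower_pair n.
Let th (w : Omega) : 'I_n -> 'I_n -> R := Theta0 rho W0 xi w.
Let thI w (p : I) : R := th w (val p).1 (val p).2.

Lemma sample_itv i w : 0 <= xi i w <= 1.
Proof. by case: model. Qed.

Lemma sample_square i j w : unit_square (xi i w, xi j w).
Proof. by split; rewrite /= in_itv /=; exact: sample_itv. Qed.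

Lemma Theta0E w i j : (j < i)%N -> th w i j = rho * W0 (xi i w, xi j w).
Proof. by move=> ji; rewrite /th /Theta0 mxE ji. Qed.

Lemma Theta0_itv w i j : (j < i)%N -> 0 <= th w i j <= rho.
Proof.
move=> ji; rewrite Theta0E //; case: W0_graphon => + _ _.
move=> /(_ _ (sample_square i j w)) /andP[h0 h1].
by rewrite mulr_ge0 ?(ltW rho0) //= ler_piMr // ltW.
Qed.

Lemma measurable_unit_square : measurable (@unit_square R).
Proof. by apply: measurableX; exact: measurable_itv. Qed.

Lemma measurable_Theta0 i j : (j < i)%N ->
  measurable_fun setT ((fun w => th w i j) : sample_space xi -> R).
Proof.
move=> ji; rewrite (_ : (fun _ => _) =
    (fun w => rho * W0 (xi i w, xi j w))); last first.
  by apply/funext => w; rewrite Theta0E.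
apply: measurable_funM => //.
case: W0_graphon => _ mW _.
apply: (measurable_comp measurable_unit_square _ mW).
  by move=> _ [w _ <-]; exact: sample_square.
by apply/measurable_fun_pairP; split; exact: measurable_sample.
Qed.

Definition observed (w : Omega) : {ffun I -> bool} :=
  [ffun p => A (val p).1 (val p).2 w].

Lemma adjacency_observed w : adjacency A w = config_mx (observed w).
Proof.
apply/matrixP => i j; rewrite !mxE.
by case: ifPn => ji; [|case: ifPn => // ij];
  rewrite /lower_config insubT /= ffunE.
Qed.

Definition config_event (c : {ffun I -> bool}) : set Omega :=
  [set w | forall i j : 'I_n, (j < i)%N -> A i j w = lower_config c i j].

Lemma config_eventE c w : config_event c w <-> observed w = c.
Proof.
split => [h|<- i j ji]; last by rewrite /lower_config insubT /= ffunE.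
apply/ffunP => p; rewrite ffunE -lower_configE; apply: h; exact: (valP p).
Qed.

Lemma measurable_config_event c : measurable (config_event c).
Proof.
rewrite (_ : config_event c =
    \bigcap_(p in [set: I]) (A (val p).1 (val p).2 @^-1` [set c p])).
  apply: fin_bigcap_measurable => [|p _]; first by apply: (sub_finite_set _ (finite_finpred (pred_of_simpl (@predT I)))).
  by rewrite -[X in measurable X]setTI; apply: measurable_funPT.
apply/seteqP; split => [w /config_eventE <- p _|w h].
  by rewrite /= ffunE.
apply/config_eventE/ffunP => p; rewrite ffunE; exact: (h p).
Qed.

(** The left side is split over the finitely many graphs, and [integral_sample_le] conditions each
    of these events. F also depends on the sample, as the loss does through [Theta0]. *)
Lemma model_integral_le (F : {ffun I -> bool} -> Omega -> R) (M : R) :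
  (forall c, measurable_fun setT (F c : sample_space xi -> R)) ->
  (forall c w, 0 <= F c w <= M) ->
  (\int[P]_w (F (observed w) w)%:E <= \int[P]_w (Ex (thI w) (fun c => F c w))%:E)%E.
Proof.
move=> mF FM.
pose p (c : {ffun I -> bool}) w : R := \prod_i bernoulli_pmf (thI w i) (c i).
have p01 c w : 0 <= p c w <= 1.
  apply/andP; split.
    apply: prodr_ge0 => i _; apply: bernoulli_pmf_ge0.
    have /andP[-> h] := Theta0_itv w (valP i); exact: le_trans h rho1.
  apply: Num.Theory.prodr_ile1 => i _.
  have /andP[h0 h1] := Theta0_itv w (valP i); rewrite -/(thI w i) in h0 h1.
  by rewrite /bernoulli_pmf; case: (c i); apply/andP; split; move: rho1; lra.
have mp c : measurable_fun setT (p c : sample_space xi -> R).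
  apply: measurable_prod => i _.
  have mi := measurable_Theta0 (valP i).
  rewrite /bernoulli_pmf; case: (c i) => //.
  by apply: measurable_funB.
have mFc c := measurable_fun_sample (mF c).
have mpc c := measurable_fun_sample (mp c).
apply: (@le_trans _ _ (\int[P]_w (\sum_c (F c w * \1_(config_event c) w)%:E))%E).
  apply: ge0_le_integral_any => [w _|w _].
    by have /andP[? _] := FM (observed w) w; rewrite lee_fin.
  rewrite sumEFin lee_fin (bigD1 (observed w)) //=.
  rewrite indicE mem_set ?mulr1; last exact/config_eventE.
  rewrite lerDl sumr_ge0 // => c _; have /andP[? _] := FM c w.
  by rewrite mulr_ge0.
rewrite ge0_integral_sum //; last 2 first.
- move=> c; apply/measurable_EFinP; apply: measurable_funM => //.
  exact/measurable_indic/measurable_config_event.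
- by move=> c w _; have /andP[? _] := FM c w; rewrite lee_fin mulr_ge0.
apply: (@le_trans _ _ (\sum_c \int[P]_w (F c w * p c w)%:E)%E).
  apply: lee_sum => c _; apply: (@integral_sample_le _ _ _ P n xi _ (p c) (F c) M) => //.
    exact: measurable_config_event.
  move=> E EG; case: model => _ _ _ /(_ E EG (lower_config c)) ->.
  apply: eq_integral => w _; congr (_%:E).
  rewrite (big_lower_pair _ (fun i j =>
     bernoulli_pmf (Theta0 rho W0 xi w i j) (lower_config c i j))).
  by apply: eq_bigr => i _; rewrite lower_configE.
rewrite -ge0_integral_sum //; last 2 first.
- by move=> c; apply/measurable_EFinP; exact: measurable_funM.
- move=> c w _; have /andP[? _] := FM c w; have /andP[? _] := p01 c w.
  by rewrite lee_fin mulr_ge0.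
apply: ge0_le_integral_any => [w _|w _].
  apply: sume_ge0 => c _; have /andP[? _] := FM c w; have /andP[? _] := p01 c w.
  by rewrite lee_fin mulr_ge0.
by rewrite sumEFin lee_fin /Ex; apply: ler_sum => c _; rewrite mulrC.
Qed.

Lemma uniform_prob_lower (u : R) : 0 <= u <= 1 ->
  uniform_prob (@ltr01 R) `]-oo, u]%classic = u%:E.
Proof.
move=> /andP[u0 u1]; rewrite /uniform_prob integral_uniform_pdf.
rewrite (_ : `]-oo, u]%classic `&` `[0, 1]%classic = `[0, u]%classic); last first.
  apply/seteqP; split => x /=; rewrite !in_itv /=.
    by move=> [xu /andP[-> _]].
  by move=> /andP[x0 xu]; rewrite xu x0 (le_trans xu u1).
rewrite (eq_integral (fun=> 1%E)); last first.
  move=> x /set_mem; rewrite /= in_itv /= => /andP[x0 xu].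
  by rewrite /uniform_pdf x0 (le_trans xu u1) /= subr0 invr1.
by rewrite integral_cst //= lebesgue_measure_itv /= lte_fin mul1e;
  case: ltgtP u0 => // [_|<-]; rewrite ?oppr0 ?adde0 // oppe0 adde0.
Qed.

Definition below (u : R) i : set Omega := xi i @^-1` `]-oo, u].

Lemma measurable_below u i : measurable (below u i).
Proof. by rewrite -[X in measurable X]setTI; apply: measurable_funPT. Qed.

Lemma below_prob u i : 0 <= u <= 1 -> P (below u i) = u%:E.
Proof.
move=> u01; case: model => _ /(_ i _ (measurable_itv `]-oo, u])) h _ _.
by rewrite -uniform_prob_lower // -h.
Qed.

Lemma below2_prob u i j : 0 <= u <= 1 -> i != j ->
  P (below u i `&` below u j) = (u ^+ 2)%:E.
Proof.
move=> u01 ij; case: model => _ _ /(_ [set i; j]%SET (fun=> `]-oo, u]%classic)) h _.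
have := h (fun _ _ => measurable_itv _).
rewrite big_setU1 ?inE //= big_set1 -!/(below u _) !below_prob // -EFinM -expr2 => <-.
congr (P _); apply/seteqP; split => w /=.
  by move=> [wi wj] m; rewrite !inE => /orP[/eqP ->|/eqP ->].
by move=> hw; split; apply: hw; rewrite !inE eqxx ?orbT.
Qed.

(** The binomial variance n u (1 - u) is at most n. The second moment is expanded over couples of
    vertices: u on the diagonal and, by independence, u^2 elsewhere. *)
Lemma counting_variance u : 0 <= u <= 1 ->
  (\int[P]_w ((\sum_i \1_(below u i) w - n%:R * u) ^+ 2)%:E <= n%:R%:E)%E.
Proof.
move=> u01; have /andP[u0 u1] := u01.
pose N w : R := \sum_i \1_(below u i) w.
have mN : measurable_fun setT N.
  by apply: measurable_sum => i; exact/measurable_indic/measurable_below.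
have N0 w : 0 <= N w by apply: sumr_ge0.
have i1 i : (\int[P]_w (\1_(below u i) w)%:E = u%:E)%E.
  rewrite integral_indic //; last exact: measurable_below.
  by rewrite setIT -[LHS]/(P (below u i)) below_prob.
have iN : (\int[P]_w (N w)%:E = (n%:R * u)%:E)%E.
  under eq_integral do rewrite /N -sumEFin.
  rewrite ge0_integral_sum //; last first.
    by move=> i; apply/measurable_EFinP/measurable_indic/measurable_below.
  rewrite (eq_bigr _ (fun i _ => i1 i)) sumEFin sumr_const card_ord.
  by rewrite mulr_natl.
have iN2 : (\int[P]_w (N w ^+ 2)%:E = (n%:R * u + (n%:R ^+ 2 - n%:R) * u ^+ 2)%:E)%E.
  have N2 w : (N w ^+ 2)%:E =
      (\sum_(q : 'I_n * 'I_n) (\1_(below u q.1 `&` below u q.2) w)%:E)%E.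
    rewrite sumEFin /N expr2 mulr_suml; congr (_%:E).
    under eq_bigr do rewrite mulr_sumr.
    by rewrite pair_bigA /=; apply: eq_bigr => q _; rewrite indicI.
  under eq_integral do rewrite N2.
  rewrite ge0_integral_sum //; last first.
    by move=> q; apply/measurable_EFinP/measurable_indic/measurableI;
      exact: measurable_below.
  transitivity (\sum_(q : 'I_n * 'I_n) (if q.1 == q.2 then u else u ^+ 2)%:E)%E.
    apply: eq_bigr => q _; rewrite integral_indic //; last first.
      by apply: measurableI; exact: measurable_below.
    rewrite setIT -[LHS]/(P (below u q.1 `&` below u q.2)).
    by case: eqP => [->|/eqP q12]; [rewrite setIid below_prob|rewrite below2_prob].
  rewrite sumEFin -(pair_bigA _ (fun i j => if i == j then u else u ^+ 2)) /=.
  rewrite (eq_bigr (fun=> u + (n%:R - 1) * u ^+ 2)); last first.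
    move=> i _; rewrite (bigD1 i) //= eqxx; congr (_ + _).
    rewrite (eq_bigr (fun=> u ^+ 2)) => [|j /negbTE ji]; last by rewrite eq_sym ji.
    rewrite sumr_const -[LHS]mulr_natl; congr (_ * _).
    by rewrite cardC1 card_ord -subn1 natrB //; case: i => i; case: n.
  by rewrite sumr_const card_ord -[in LHS]mulr_natl; congr (_%:E); ring.
(* The cross term stands on the left with a plus sign, so that all integrands are nonnegative and
   additivity applies in the extended reals; finiteness is read off afterwards. *)
have eq1 : (\int[P]_w ((N w - n%:R * u) ^+ 2)%:E + (2 * (n%:R * u) * (n%:R * u))%:E =
    \int[P]_w (N w ^+ 2)%:E + ((n%:R * u) ^+ 2)%:E)%E.
  have -> : ((2 * (n%:R * u) * (n%:R * u))%:E =
       \int[P]_w (2 * (n%:R * u) * N w)%:E)%E.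
    under eq_integral do rewrite EFinM.
    rewrite ge0_integralZl //; [by rewrite iN EFinM| exact/measurable_EFinP| |].
      by move=> w _; rewrite lee_fin.
    by rewrite lee_fin !mulr_ge0.
  have -> : (((n%:R * u) ^+ 2)%:E = \int[P]_w ((n%:R * u) ^+ 2)%:E)%E.
    by rewrite integral_cst // -[X in (_ * X)%E]/(P setT) probability_setT mule1.
  rewrite -!ge0_integralD //.
  - by apply: eq_integral => w _; rewrite -!EFinD; congr (_%:E); ring.
  - by move=> w _; rewrite lee_fin sqr_ge0.
  - by apply/measurable_EFinP/measurable_funX.
  - by move=> w _; rewrite lee_fin sqr_ge0.
  - by move=> w _; rewrite lee_fin sqr_ge0.
  - by apply/measurable_EFinP/measurable_funX/measurable_funB.
  - by move=> w _; rewrite lee_fin !mulr_ge0.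
  - by apply/measurable_EFinP/measurable_funM.
move: eq1; rewrite iN2; case: (integral _ _ _) => [x| |] //=.
rewrite -!EFinD => -[xE]; rewrite lee_fin.
have : n%:R * (u * (1 - u)) <= n%:R * 1 :> R by rewrite ler_wpM2l //; nra.
by lra.
Qed.

End Model.

(** * Risk of a block estimator *)

Section PowerBounds.
Context {R : realType}.
Variable a : R.
Hypotheses (a0 : 0 < a) (a1 : a <= 1).

Lemma powR_le1D (y : R) : 0 <= y -> y `^ a <= 1 + y.
Proof.
move=> y0; have [y1|y1] := leP y 1.
  by apply: le_trans (powR_le1 _ (ltW a0)) _; rewrite ?y0 ?y1 //; lra.
by apply: (@le_trans _ _ y); [apply: ler1_powR => //; exact: ltW|lra].
Qed.

Lemma powR_sqr (x : R) : 0 <= x -> (x `^ a) ^+ 2 = (x ^+ 2) `^ a.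
Proof. by move=> x0; rewrite !expr2 powRM. Qed.

(** This is y^a <= 1 + y at y = n x^2. It loses only a constant when x has the typical size n^(-1/2)
    of a rank deviation. *)
Lemma powR_sqr_le n (x : R) : (0 < n)%N -> 0 <= x ->
  (x `^ a) ^+ 2 <= (n%:R `^ a)^-1 * (1 + n%:R * x ^+ 2).
Proof.
move=> n_gt0 x0; have n0 : 0 < n%:R :> R by rewrite ltr0n.
have p0 : 0 < n%:R `^ a by exact: powR_gt0.
rewrite mulrC ler_pdivlMr // powR_sqr // mulrC -powRM ?sqr_ge0 ?(ltW n0) //.
by apply: powR_le1D; rewrite mulr_ge0 ?sqr_ge0 // ltW.
Qed.

Lemma powR_sqrD (x y : R) : 0 <= x -> 0 <= y ->
  ((x + y) `^ a) ^+ 2 <= 4 * ((x `^ a) ^+ 2 + (y `^ a) ^+ 2).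
Proof.
wlog xy : x y / x <= y.
  move=> H x0 y0; have [xy|/ltW yx] := leP x y; first exact: H.
  by rewrite addrC [(x `^ a) ^+ 2 + _]addrC; exact: H.
move=> x0 y0; rewrite !powR_sqr ?addr_ge0 //.
apply: (@le_trans _ _ ((4 * y ^+ 2) `^ a)).
  apply: ge0_ler_powR; rewrite ?nnegrE ?(ltW a0) ?sqr_ge0 ?mulr_ge0 ?sqr_ge0 //.
  by nra.
rewrite powRM ?sqr_ge0 //.
have h4 : 4 `^ a <= 4 :> R by apply: ler1_powR => //; lra.
have := powR_ge0 (x ^+ 2) a; have := powR_ge0 (y ^+ 2) a; nra.
Qed.

End PowerBounds.

Section RiskBound.
Context {R : realType} {d : measure_display} {Omega : measurableType d}.
Variable P : probability Omega R.
Variables (n : nat) (rho : R) (W0 : R * R -> R).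
Variables (xi : 'I_n -> {RV P >-> R}) (A : 'I_n -> 'I_n -> {RV P >-> bool}).
Hypotheses (rho0 : 0 < rho) (rho1 : rho <= 1).
Hypothesis W0_graphon : graphon W0.
Hypothesis model : sparse_graphon_model rho W0 xi A.
Hypothesis n_gt0 : (0 < n)%N.
Variables (a M : R).
Hypotheses (a0 : 0 < a) (a1 : a <= 1) (M0 : 0 <= M).
Hypothesis W0_modulus : forall x y x' y',
  unit_square (x, y) -> unit_square (x', y') ->
  `|W0 (x', y') - W0 (x, y)| <= M * (`|x' - x| `^ a + `|y' - y| `^ a).
Variable est : 'M[bool]_n -> 'M[R]_n.
Hypothesis est_sym : forall b, exists g, est b = sym_mx 0 g.

Implicit Types (i j : 'I_n) (s : {perm 'I_n}).

Let n0 : 0 < n%:R :> R.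
Proof. by rewrite ltr0n. Qed.

Let I := lower_pair n.
Let th (w : Omega) : 'I_n -> 'I_n -> R := Theta0 rho W0 xi w.
Let thI w (p : I) : R := th w (val p).1 (val p).2.
Let B : R := (n%:R `^ a)^-1.

Let B0 : 0 < B.
Proof. by rewrite invr_gt0 powR_gt0. Qed.

Let invn_le_B : n%:R^-1 <= B.
Proof.
rewrite lef_pV2 ?posrE ?powR_gt0 //; apply: ler1_powR => //.
by rewrite ler1n.
Qed.

(** n^2 times the squared deviations of the empirical distribution function from the identity,
    summed over the grid points (l + 1) / n. No sorting permutation occurs in it. *)
Definition discrepancy (w : Omega) : R :=
  \sum_(l < n) (\sum_i (xi i w <= l.+1%:R / n%:R)%R%:R - l.+1%:R) ^+ 2.

Definition rank_error s w i : R := (n%:R * xi i w - (s i)%:R) ^+ 2.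

Lemma rank_error_ge0 s w i : 0 <= rank_error s w i.
Proof. exact: sqr_ge0. Qed.

Lemma W0_diff_sqr x y x' y' : unit_square (x, y) -> unit_square (x', y') ->
  (rho * W0 (x', y') - rho * W0 (x, y)) ^+ 2 <=
  2 * (rho * M) ^+ 2 * ((`|x' - x| `^ a) ^+ 2 + (`|y' - y| `^ a) ^+ 2).
Proof.
move=> xy xy'; have := W0_modulus xy xy'.
rewrite -mulrBr exprMn -[X in _ * X <= _]real_normK ?num_real //.
set t := `|_ - _|; set u := _ `^ a; set v := _ `^ a => h.
have t0 : 0 <= t by exact: normr_ge0.
have h2 : t ^+ 2 <= (M * (u + v)) ^+ 2 by rewrite lerXn2r ?nnegrE // (le_trans t0).
apply: (@le_trans _ _ (rho ^+ 2 * (M * (u + v)) ^+ 2)).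
  by rewrite ler_pM2l ?exprn_gt0.
rewrite -subr_ge0.
have -> : 2 * (rho * M) ^+ 2 * (u ^+ 2 + v ^+ 2) - rho ^+ 2 * (M * (u + v)) ^+ 2 =
  (rho * M * (u - v)) ^+ 2 by ring.
exact: sqr_ge0.
Qed.

(** n u and n xi_i are both compared with the rank s i, the first within 1. This gives 2 + 2
    [rank_error], and [powR_sqr_le] adds the last unit of the 3. *)
Lemma cell_point_sqr s w i (u : R) : cell (s i) u ->
  (`|u - xi i w| `^ a) ^+ 2 <= B * (3 + 2 * rank_error s w i / n%:R).
Proof.
move=> iu; apply: le_trans (powR_sqr_le a0 a1 n_gt0 (normr_ge0 _)) _.
rewrite -/B ler_pM2l //.
rewrite real_normK ?num_real //.
move: iu; rewrite /cell /= in_itv /= ltr_pdivrMr // ler_pdivlMr // -natr1.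
move=> /andP[h1 h2].
rewrite /rank_error; set t := n%:R * xi i w - (s i)%:R.
have n1 : 1 <= n%:R :> R by rewrite ler1n.
have -> : n%:R * (u - xi i w) ^+ 2 = (u * n%:R - n%:R * xi i w) ^+ 2 / n%:R.
  by field; rewrite gt_eqF.
have h3 : (u * n%:R - n%:R * xi i w) ^+ 2 <= 2 + 2 * t ^+ 2.
  set e := u * n%:R - (s i)%:R.
  have -> : u * n%:R - n%:R * xi i w = e - t by rewrite /e /t; ring.
  have : e ^+ 2 <= 1 by rewrite expr_le1 // /e; lra.
  by have := sqr_ge0 (e + t); lra.
have : (u * n%:R - n%:R * xi i w) ^+ 2 / n%:R <= (2 + 2 * t ^+ 2) / n%:R.
  by rewrite ler_pM2r ?invr_gt0.
have : 2 / n%:R <= 2 :> R by rewrite ler_pdivrMr //; lra.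
rewrite mulrDl; lra.
Qed.

Lemma sym_sum (X : 'I_n -> 'I_n -> R) : (forall i j, X i j = X j i) ->
  (forall i, X i i = 0) ->
  \sum_i \sum_j X i j = 2 * \sum_(i < n) \sum_(j < n | (j < i)%N) X i j.
Proof.
move=> XC X0; rewrite mulr_natl mulr2n.
rewrite [X in _ = _ + X](exchange_big_dep xpredT) //= -big_split /=.
apply: eq_bigr => i _; rewrite (bigID (fun j : 'I_n => (j < i)%N)) /=; congr (_ + _).
rewrite (bigD1 i) ?ltnn //= X0 add0r; apply: eq_big => [j|j _]; last exact: XC.
by rewrite -val_eqE; case: ltngtP.
Qed.

Lemma delta2_pointwise s w :
  \sum_i rank_error s w i <= 2 * discrepancy w + 2 * n%:R ->
  (delta2 (empirical_graphon (est (adjacency A w))) (fun z => (rho * W0 z)%R) <=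
   (4 / n%:R ^+ 2 * square_loss (th w) (est (adjacency A w)) +
    rho ^+ 2 * B * (8 * M ^+ 2 * (7 + 4 * discrepancy w / n%:R ^+ 2) + 2))%:E)%E.
Proof.
move=> hs; set Th := est (adjacency A w); set T0 := Theta0 rho W0 xi w.
have [g gE] := est_sym (adjacency A w).
pose e i := 3 + 2 * rank_error s w i / n%:R.
have e0 i : 0 <= e i by rewrite addr_ge0 // divr_ge0 ?(ltW n0) // mulr_ge0 // rank_error_ge0.
(* Three sources of error: estimation, the variation of rho W0 between sample points and cells, and
   the diagonal, where both matrices vanish but f_0 need not. The diagonal cells have total area 1 /
   n <= n^(-a). *)
pose c i j := 2 * (Th i j - T0 i j) ^+ 2 +
  4 * (rho * M) ^+ 2 * B * (e i + e j) + (i == j)%:R * (2 * rho ^+ 2).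
have K0 : 0 <= 4 * (rho * M) ^+ 2 * B by rewrite !mulr_ge0 ?sqr_ge0 // ltW.
have c0 i j : 0 <= c i j.
  apply: addr_ge0; first apply: addr_ge0.
  - by rewrite mulr_ge0 // sqr_ge0.
  - by rewrite mulr_ge0 // addr_ge0.
  - by rewrite mulr_ge0 // mulr_ge0 // sqr_ge0.
have T0C i j : T0 i j = T0 j i by rewrite /T0 /Theta0 !mxE; case: ltngtP.
have ThC i j : Th i j = Th j i by rewrite /Th gE !mxE; case: ltngtP.
have T0d i : T0 i i = 0 by rewrite /T0 /Theta0 !mxE ltnn.
have Thd i : Th i i = 0 by rewrite /Th gE !mxE ltnn.
have Wsq i j (u v : R) : cell (s i) u -> cell (s j) v -> unit_square (u, v).
  move=> /(cell_sub n_gt0)/andP[/ltW u0 u1] /(cell_sub n_gt0)/andP[/ltW v0 v1].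
  by split; rewrite /= in_itv /=; apply/andP; split.
have cP i j (u v : R) : cell (s i) u -> cell (s j) v ->
    (rho * W0 (u, v) - Th i j) ^+ 2 <= c i j.
  move=> iu jv; have uv := Wsq _ _ _ _ iu jv.
  have [ij|ij] := eqVneq i j.
    rewrite /c -ij eqxx Thd T0d mul1r subrr expr0n /= mulr0 add0r subr0.
    case: W0_graphon => /(_ _ uv) /andP[w0 w1] _ _.
    have q0 : 0 <= 4 * (rho * M) ^+ 2 * B * (e i + e i) by rewrite mulr_ge0 // addr_ge0.
    have q1 : (rho * W0 (u, v)) ^+ 2 <= rho ^+ 2.
      by rewrite exprMn ler_piMr ?sqr_ge0 // expr_le1.
    have := sqr_ge0 rho; lra.
  have W0d : (rho * W0 (u, v) - T0 i j) ^+ 2 <=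
      2 * (rho * M) ^+ 2 * (B * e i + B * e j).
    have -> : T0 i j = rho * W0 (xi i w, xi j w).
      rewrite /T0 /Theta0 mxE; case: ltngtP => // [ij'|/val_inj ij'].
        by case: W0_graphon => _ _ ->; last exact: (sample_square model).
      by rewrite ij' eqxx in ij.
    apply: le_trans (W0_diff_sqr (sample_square model i j w) uv) _.
    apply: ler_wpM2l; first by rewrite mulr_ge0 // sqr_ge0.
    by apply: lerD; exact: cell_point_sqr.
  rewrite /c (negbTE ij) mul0r addr0.
  have := sqr_ge0 ((rho * W0 (u, v) - T0 i j) + (Th i j - T0 i j)).
  move: W0d; rewrite -mulrDr; lra.
apply: le_trans (delta2_le n_gt0 c0 cP) _.
rewrite lee_fin.
have -> : \sum_i \sum_j c i j / n%:R ^+ 2 = (\sum_i \sum_j c i j) / n%:R ^+ 2.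
  by rewrite mulr_suml; apply: eq_bigr => i _; rewrite mulr_suml.
have -> : \sum_i \sum_j c i j = 4 * square_loss (th w) Th +
    8 * (rho * M) ^+ 2 * B * (n%:R * \sum_i e i) + 2 * rho ^+ 2 * n%:R.
  transitivity (2 * (\sum_i \sum_j (Th i j - T0 i j) ^+ 2) +
    4 * (rho * M) ^+ 2 * B * (\sum_i \sum_j (e i + e j)) +
    \sum_(i < n) \sum_(j < n) (i == j)%:R * (2 * rho ^+ 2)).
    rewrite !mulr_sumr -!big_split /=; apply: eq_bigr => i _.
    by rewrite !mulr_sumr -!big_split.
  congr (_ + _ + _).
  - rewrite (sym_sum (X := fun i j => (Th i j - T0 i j) ^+ 2)).
    + by rewrite mulrA -natrM.
    + by move=> i j; rewrite ThC T0C.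
    + by move=> i; rewrite Thd T0d subrr expr0n.
  - have -> : \sum_i \sum_j (e i + e j) = 2 * (n%:R * \sum_i e i).
      transitivity (\sum_(i < n) (n%:R * e i + \sum_j e j)).
        by apply: eq_bigr => i _; rewrite big_split /= sumr_const card_ord mulr_natl.
      rewrite big_split /= sumr_const card_ord -mulr_sumr -[_ *+ n]mulr_natl.
      by ring.
    by ring.
  - rewrite (eq_bigr (fun=> 2 * rho ^+ 2)); last first.
      move=> i _; rewrite -mulr_suml (bigD1 i) //= eqxx big1 ?addr0 ?mul1r // => j.
      by rewrite eq_sym => /negbTE ->.
    by rewrite sumr_const card_ord -[LHS]mulr_natr.
have n1 : 1 <= n%:R :> R by rewrite ler1n.
have se : \sum_i e i <= 7 * n%:R + 4 * discrepancy w / n%:R.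
  rewrite /e big_split /= sumr_const card_ord -mulr_suml -mulr_sumr -[3 *+ n]mulr_natr.
  have : 2 * (\sum_i rank_error s w i) / n%:R <=
      2 * (2 * discrepancy w + 2 * n%:R) / n%:R.
    by rewrite ler_pM2r ?invr_gt0 // ler_pM2l.
  have -> : 2 * (2 * discrepancy w + 2 * n%:R) / n%:R = 4 * discrepancy w / n%:R + 4.
    by field; rewrite gt_eqF.
  lra.
have nn0 : n%:R != 0 :> R by rewrite gt_eqF.
have -> : (4 * square_loss (th w) Th + 8 * (rho * M) ^+ 2 * B * (n%:R * \sum_i e i)
   + 2 * rho ^+ 2 * n%:R) / n%:R ^+ 2 =
   4 / n%:R ^+ 2 * square_loss (th w) Th +
   (8 * (rho * M) ^+ 2 * B * (\sum_i e i / n%:R) + 2 * rho ^+ 2 * n%:R^-1).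
  by rewrite -mulr_suml; field.
rewrite lerD2l.
have h1 : 2 * rho ^+ 2 * n%:R^-1 <= 2 * rho ^+ 2 * B.
  by rewrite ler_wpM2l // mulr_ge0 // sqr_ge0.
have h2 : 8 * (rho * M) ^+ 2 * B * (\sum_i e i / n%:R) <=
   8 * (rho * M) ^+ 2 * B * (7 + 4 * discrepancy w / n%:R ^+ 2).
  rewrite ler_wpM2l //; first by rewrite !mulr_ge0 ?sqr_ge0 // ltW.
  rewrite -mulr_suml ler_pdivrMr //; apply: le_trans se _.
  by rewrite le_eqVlt; apply/orP; left; apply/eqP; field.
rewrite exprMn in h2 *; lra.
Qed.

(** Competitor: rho W0 at the lower corners of the k by k grid. It inherits symmetry and the bound
    rho from W0, and only its labelling depends on the sample. *)
Definition grid_matrix k : 'M[R]_k :=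
  \matrix_(x, y) (rho * W0 (x%:R / k%:R, y%:R / k%:R)).

Lemma bias_pointwise k (k0 : (0 < k)%N) s w :
  \sum_i rank_error s w i <= 2 * discrepancy w + 2 * n%:R ->
  \sum_(i < n) \sum_(j < n | (j < i)%N)
    (grid_matrix k (rank_block k0 s i) (rank_block k0 s j) - th w i j) ^+ 2 <=
  16 * (rho * M) ^+ 2 * n%:R ^+ 2 *
    (((k%:R^-1) `^ a) ^+ 2 + B * (3 + 2 * discrepancy w / n%:R ^+ 2)).
Proof.
move=> hs; set zs := rank_block k0 s; set ka := (_ `^ a) ^+ 2.
have nn0 : n%:R != 0 :> R by rewrite gt_eqF.
have n1 : 1 <= n%:R :> R by rewrite ler1n.
have kk0 : 0 < k%:R :> R by rewrite ltr0n.
pose h i : R := (`|(zs i)%:R / k%:R - xi i w| `^ a) ^+ 2.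
(* From the corner to the rank s i / n the distance is at most 1 / k; from there to xi_i it is the
   rank error. *)
have hh i : h i <= 4 * (ka + B * (1 + rank_error s w i / n%:R)).
  have /andP[d0 d1] := rank_block_dist (R := R) k0 s i.
  have t1 : `|(zs i)%:R / k%:R - xi i w| <=
      k%:R^-1 + `|n%:R * xi i w - (s i)%:R| / n%:R.
    rewrite distrC (_ : xi i w - (zs i)%:R / k%:R =
       ((s i)%:R / n%:R - (zs i)%:R / k%:R) + (n%:R * xi i w - (s i)%:R) / n%:R).
      apply: le_trans (ler_normD _ _) _; rewrite lerD //; first by rewrite ger0_norm.
      by rewrite normrM normfV (gtr0_norm n0).
    by field; rewrite nn0 gt_eqF.
  have r0 : 0 <= `|n%:R * xi i w - (s i)%:R| / n%:R by rewrite divr_ge0 // ltW.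
  apply: (@le_trans _ _ (((k%:R^-1 + `|n%:R * xi i w - (s i)%:R| / n%:R) `^ a) ^+ 2)).
    rewrite lerXn2r ?nnegrE ?powR_ge0 //.
    apply: ge0_ler_powR => //; first exact: ltW.
    by rewrite nnegrE addr_ge0 // invr_ge0 ltW.
  apply: le_trans (powR_sqrD a0 a1 _ r0) _; first by rewrite invr_ge0 ltW.
  rewrite ler_pM2l // lerD2l; apply: le_trans (powR_sqr_le a0 a1 n_gt0 r0) _.
  rewrite -/B (_ : n%:R * _ = rank_error s w i / n%:R) //.
  by rewrite exprMn real_normK ?num_real // /rank_error; field.
have ksq i j : unit_square ((zs i)%:R / k%:R : R, (zs j)%:R / k%:R).
  have q (x : 'I_k) : 0 <= (x%:R / k%:R : R) <= 1.
    rewrite divr_ge0 ?(ltW kk0) //= ler_pdivrMr // mul1r ler_nat ltnW //.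
  by split; rewrite /= in_itv /=; exact: q.
have h0 i : 0 <= h i by exact: sqr_ge0.
have C0 : 0 <= 2 * (rho * M) ^+ 2 by rewrite mulr_ge0 // sqr_ge0.
apply: (@le_trans _ _ (\sum_(i < n) \sum_(j < n) 2 * (rho * M) ^+ 2 * (h i + h j))).
  apply: ler_sum => i _; rewrite big_mkcond /=; apply: ler_sum => j _.
  case: ifPn => ji; last by rewrite mulr_ge0 // addr_ge0.
  rewrite /grid_matrix mxE /th Theta0E //.
  by apply: W0_diff_sqr => //; exact: (sample_square model).
under eq_bigr do rewrite -mulr_sumr big_split /= sumr_const card_ord.
rewrite -mulr_sumr big_split /= sumr_const card_ord.
have -> : \sum_(i < n) h i *+ n + (\sum_(i < n) h i) *+ n = 2 * n%:R * \sum_i h i.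
  by rewrite sumrMnl -[_ *+ n]mulr_natl; ring.
have sh : \sum_i h i <= 4 * (n%:R * ka + B * (n%:R + (2 * discrepancy w + 2 * n%:R) / n%:R)).
  apply: le_trans (ler_sum _ (fun i _ => hh i)) _.
  rewrite -mulr_sumr big_split /= sumr_const card_ord -[ka *+ n]mulr_natl.
  rewrite -mulr_sumr big_split /= sumr_const card_ord -mulr_suml.
  by rewrite ler_pM2l // lerD2l ler_pM2l // lerD2l ler_pM2r ?invr_gt0.
apply: (@le_trans _ _ (2 * (rho * M) ^+ 2 * (2 * n%:R * (4 * (n%:R * ka +
    B * (n%:R + (2 * discrepancy w + 2 * n%:R) / n%:R)))))).
  by rewrite ler_wpM2l // ler_wpM2l // mulr_ge0 // ltW.
have -> : 2 * (rho * M) ^+ 2 * (2 * n%:R * (4 * (n%:R * ka +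
    B * (n%:R + (2 * discrepancy w + 2 * n%:R) / n%:R)))) =
  16 * (rho * M) ^+ 2 * n%:R ^+ 2 *
    (ka + B * (1 + 2 / n%:R + 2 * discrepancy w / n%:R ^+ 2)) by field.
apply: ler_wpM2l.
  by apply: mulr_ge0; [apply: mulr_ge0 => //; exact: sqr_ge0 | exact: sqr_ge0].
rewrite lerD2l ler_pM2l // lerD2r.
have : 2 / n%:R <= 2 :> R by rewrite ler_pdivrMr //; lra.
lra.
Qed.


Lemma discrepancyE w : discrepancy w =
  \sum_(l < n) (\sum_i \1_(below xi (l.+1%:R / n%:R) i) w
                - n%:R * (l.+1%:R / n%:R)) ^+ 2.
Proof.
apply: eq_bigr => l _; rewrite mulrCA divff ?gt_eqF // mulr1.
congr ((_ - _) ^+ 2); apply: eq_bigr => i _; rewrite indicE; congr ((nat_of_bool _)%:R).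
by apply/idP/idP => [h|/set_mem]; [apply/mem_set|]; rewrite /below /= in_itv.
Qed.

Lemma discrepancy_ge0 w : 0 <= discrepancy w.
Proof. by apply: sumr_ge0 => l _; exact: sqr_ge0. Qed.

Lemma measurable_discrepancy :
  measurable_fun setT (discrepancy : sample_space xi -> R).
Proof.
rewrite (_ : discrepancy = fun w => \sum_(l < n)
  (\sum_i \1_(below xi (l.+1%:R / n%:R) i) w - n%:R * (l.+1%:R / n%:R)) ^+ 2);
  last by apply/funext => w; rewrite discrepancyE.
apply: measurable_sum => l; apply: measurable_funX; apply: measurable_funB => //.
apply: measurable_sum => i; apply: measurable_indic.
have := measurable_sample (xi := xi) i measurableT
  (measurable_itv `]-oo, (l.+1%:R / n%:R : R)]).
by rewrite setTI.
Qed.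

Lemma expected_discrepancy :
  (\int[P]_w (discrepancy w)%:E <= (n%:R ^+ 2)%:E)%E.
Proof.
under eq_integral do rewrite discrepancyE -sumEFin.
rewrite ge0_integral_sum //; last 2 first.
- move=> l; apply/measurable_EFinP/measurable_funX/measurable_funB => //.
  by apply: measurable_sum => i; apply/measurable_indic; exact: measurable_below.
- by move=> l w _; rewrite lee_fin sqr_ge0.
apply: (@le_trans _ _ (\sum_(l < n) n%:R%:E)%E).
  apply: lee_sum => l _; apply: (counting_variance model).
  by rewrite divr_ge0 ?(ltW n0) //= ler_pdivrMr // mul1r ler_nat.
by rewrite sumEFin sumr_const card_ord -[n%:R *+ n]mulr_natl expr2.
Qed.

Lemma square_loss_lower (t : 'I_n -> 'I_n -> R) T : square_loss t T =
  \sum_(p : I) (T (val p).1 (val p).2 - t (val p).1 (val p).2) ^+ 2.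
Proof. by rewrite /square_loss big_lower_pair. Qed.

(** Crude bound whose purpose is the boundedness that [model_integral_le] asks for. *)
Lemma discrepancy_le w : discrepancy w <= n%:R ^+ 3.
Proof.
apply: (@le_trans _ _ (\sum_(l < n) n%:R ^+ 2)); last first.
  by rewrite sumr_const card_ord -[leLHS]mulr_natl -exprS.
apply: ler_sum => l _; rewrite -[leLHS]real_normK ?num_real // lerXn2r ?nnegrE //.
set N := \sum_i _.
have N0 : 0 <= N by exact: sumr_ge0.
have Nn : N <= n%:R.
  apply: (@le_trans _ _ (\sum_(i < n) 1)); last by rewrite sumr_const card_ord.
  by apply: ler_sum => i _; rewrite lern1 leq_b1.
have l0 : 0 <= l.+1%:R :> R by [].
have ln : l.+1%:R <= n%:R :> R by rewrite ler_nat.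
by rewrite ler_norml; apply/andP; split; lra.
Qed.

(** The assumed oracle inequality abstracts the estimator: V is its variance term and n1 the block
    size the competitor must respect. After choosing a sorting permutation for each outcome, the
    conditional bound is affine in [discrepancy], whose mean is at most n^2. *)
Theorem risk_bound k (k0 : (0 < k)%N) (n1 : nat) (V : R) : (n1 * k <= n)%N -> 0 <= V ->
  (forall (t : 'I_n -> 'I_n -> R) (Qs : 'M[R]_k) (zs : {ffun 'I_n -> 'I_k}),
     (forall i j, (j < i)%N -> 0 <= t i j <= rho) ->
     Qs^T = Qs -> (forall b c, `|Qs b c| <= rho) -> block_maps n1 zs ->
     3 / 4 * Ex (fun p : I => t (val p).1 (val p).2)
               (fun c => square_loss t (est (config_mx c))) <=
     \sum_(i < n) \sum_(j < n | (j < i)%N) (Qs (zs i) (zs j) - t i j) ^+ 2 + V) ->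
  (\int[P]_w delta2 (empirical_graphon (est (adjacency A w)))
                    (fun z => (rho * W0 z)%R) <=
   (rho ^+ 2 * (86 * M ^+ 2 * ((k%:R^-1) `^ a) ^+ 2 + (516 * M ^+ 2 + 2) * B)
    + 6 * V / n%:R ^+ 2)%:E)%E.
Proof.
move=> n1k V0 oracle.
set ka := (_ `^ a) ^+ 2.
pose G w := rho ^+ 2 * B * (8 * M ^+ 2 * (7 + 4 * discrepancy w / n%:R ^+ 2) + 2).
pose F (c : {ffun I -> bool}) w :=
  4 / n%:R ^+ 2 * square_loss (th w) (est (config_mx c)) + G w.
have nn0 : n%:R != 0 :> R by rewrite gt_eqF.
have n2 : 0 < n%:R ^+ 2 :> R by rewrite exprn_gt0.
have rB0 : 0 <= rho ^+ 2 * B by rewrite mulr_ge0 ?sqr_ge0 // ltW.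
have G0 w : 0 <= G w.
  rewrite mulr_ge0 // addr_ge0 // mulr_ge0 //; first by rewrite mulr_ge0 // sqr_ge0.
  by rewrite addr_ge0 // divr_ge0 ?(ltW n2) // mulr_ge0 // discrepancy_ge0.
have q0 : 0 <= 4 / n%:R ^+ 2 :> R by rewrite divr_ge0 // ltW.
have L0 t T : 0 <= square_loss (n := n) (R := R) t T.
  by rewrite square_loss_lower sumr_ge0 // => p _; exact: sqr_ge0.
have F0 c w : 0 <= F c w by rewrite addr_ge0 // mulr_ge0.
pose Kc (c : {ffun I -> bool}) : R :=
  4 / n%:R ^+ 2 * \sum_(p : I) (2 * est (config_mx c) (val p).1 (val p).2 ^+ 2 + 2).
have Kc0 c : 0 <= Kc c.
  rewrite mulr_ge0 // sumr_ge0 // => p _.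
  by rewrite addr_ge0 // mulr_ge0 // sqr_ge0.
pose KG : R := rho ^+ 2 * B * (8 * M ^+ 2 * (7 + 4 * n%:R ^+ 3 / n%:R ^+ 2) + 2).
have FK c w : F c w <= \sum_c Kc c + KG.
  apply: lerD.
    apply: (@le_trans _ _ (Kc c)); last by rewrite (bigD1 c) //= lerDl sumr_ge0.
    rewrite ler_wpM2l // square_loss_lower; apply: ler_sum => p _.
    have /andP[t0 t1] := Theta0_itv rho0 W0_graphon model w (valP p).
    have tr : thI w p ^+ 2 <= 1 by rewrite expr_le1 // (le_trans t1).
    have := sqr_ge0 (est (config_mx c) (val p).1 (val p).2 + thI w p).
    rewrite -/(thI w p); move: tr; set x := est _ _ _; set y := thI _ _; lra.
  rewrite ler_wpM2l // lerD2r ler_wpM2l //; first by rewrite mulr_ge0 // sqr_ge0.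
  by rewrite lerD2l ler_pM2r ?invr_gt0 // ler_pM2l // discrepancy_le.
have mG : measurable_fun setT (G : sample_space xi -> R).
  apply: measurable_funM => //; apply: measurable_funD => //.
  apply: measurable_funM => //; apply: measurable_funD => //.
  apply: measurable_funM => //; apply: measurable_funM => //.
  exact: measurable_discrepancy.
have mF c : measurable_fun setT (F c : sample_space xi -> R).
  apply: measurable_funD => //; apply: measurable_funM => //.
  rewrite (_ : (fun _ => _) = (fun w => \sum_(p : I)
     (est (config_mx c) (val p).1 (val p).2 - thI w p) ^+ 2)); last first.
    by apply/funext => w; rewrite square_loss_lower.
  apply: measurable_sum => p; apply: measurable_funX; apply: measurable_funB => //.
  exact: (measurable_Theta0 W0_graphon model (valP p)).
(* 256 / 3 is the product of 4 from the loss, 4 / 3 from the oracle inequality and 16 from the bias.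
   The final constants 86, 516 and 6 round up 256 / 3, 1544 / 3 and 16 / 3. *)
pose c1 := 256 / 3 * (rho * M) ^+ 2 * (ka + 3 * B) + 16 / 3 * V / n%:R ^+ 2
  + rho ^+ 2 * B * (56 * M ^+ 2 + 2).
pose c2 := rho ^+ 2 * B * M ^+ 2 * (512 / 3 + 32) / n%:R ^+ 2.
have EF w : Ex (thI w) (fun c => F c w) <= c1 + c2 * discrepancy w.
  have [s hs] := rank_approximation (fun i => sample_itv model i w).
  have Qsym : (grid_matrix k)^T = grid_matrix k.
    apply/matrixP => x y; rewrite !mxE; congr (_ * _).
    case: W0_graphon => _ _ ->//.
    by split; rewrite /= in_itv /= divr_ge0 //= ler_pdivrMr ?ltr0n // mul1r ler_nat ltnW.
  have Qr b c : `|grid_matrix k b c| <= rho.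
    have sq : unit_square (b%:R / k%:R : R, c%:R / k%:R).
      by split; rewrite /= in_itv /= divr_ge0 //= ler_pdivrMr ?ltr0n // mul1r ler_nat ltnW.
    case: W0_graphon => /(_ _ sq) /andP[w0 w1] _ _.
    by rewrite mxE ger0_norm ?mulr_ge0 ?(ltW rho0) // ler_piMr // ltW.
  have := oracle (th w) (grid_matrix k) (rank_block k0 s)
    (fun i j => Theta0_itv rho0 W0_graphon model w (i := i) (j := j)) Qsym Qr
    (rank_block_maps k0 s n1k).
  have := bias_pointwise k0 hs; rewrite -/ka.
  set T := \sum_i _; set L := Ex _ _ => hT hL.
  rewrite /F ExD ExZ Ex_cst -/L.
  have {hT}hL : L <= 4 / 3 * (16 * (rho * M) ^+ 2 * n%:R ^+ 2 *
      (ka + B * (3 + 2 * discrepancy w / n%:R ^+ 2)) + V) by lra.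
  have -> : c1 + c2 * discrepancy w = 4 / n%:R ^+ 2 * (4 / 3 * (16 * (rho * M) ^+ 2 * n%:R ^+ 2 *
      (ka + B * (3 + 2 * discrepancy w / n%:R ^+ 2)) + V)) + G w.
    by rewrite /c1 /c2 /G; field.
  by rewrite lerD2r ler_wpM2l.
have c20 : 0 <= c2.
  apply: divr_ge0; last exact: ltW.
  apply: mulr_ge0; last lra.
  by apply: mulr_ge0 => //; exact: sqr_ge0.
have EF0 w : 0 <= Ex (thI w) (fun c => F c w).
  rewrite -(Ex_cst (thI w) 0); apply: Ex_le => [p|c]; last exact: F0.
  by have /andP[-> h] := Theta0_itv rho0 W0_graphon model w (valP p);
    exact: le_trans h rho1.
apply: (@le_trans _ _ (\int[P]_w (F (observed A w) w)%:E)%E).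
  apply: ge0_le_integral_any => [w _|w _].
    apply: le_ereal_inf_tmp => _ [tau _ <-].
    by apply: integral_ge0 => z _; rewrite lee_fin exprn_ge0.
  have [s hs] := rank_approximation (fun i => sample_itv model i w).
  by apply: le_trans (delta2_pointwise hs) _; rewrite adjacency_observed.
apply: le_trans (model_integral_le rho0 rho1 W0_graphon model mF
  (M := \sum_c Kc c + KG) _) _.
  by move=> c w; rewrite F0 FK.
have mD := measurable_fun_sample measurable_discrepancy.
have ka0 : 0 <= ka by exact: sqr_ge0.
have r20 : 0 <= rho ^+ 2 * M ^+ 2 by apply: mulr_ge0; exact: sqr_ge0.
have c10 : 0 <= c1.
  apply: addr_ge0; first apply: addr_ge0.
  - apply: mulr_ge0; first by apply: mulr_ge0; [lra | exact: sqr_ge0].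
    by apply: addr_ge0 => //; rewrite mulr_ge0 // ltW.
  - by rewrite divr_ge0 ?(ltW n2) // mulr_ge0.
  - by rewrite mulr_ge0 // addr_ge0 // mulr_ge0 // sqr_ge0.
apply: (@le_trans _ _ (\int[P]_w (c1%:E + c2%:E * (discrepancy w)%:E))%E).
  apply: ge0_le_integral_any => w _; first by rewrite lee_fin; exact: EF0.
  by rewrite -EFinM -EFinD lee_fin; exact: EF.
rewrite ge0_integralD //; last 2 first.
- by move=> w _; rewrite -EFinM lee_fin mulr_ge0 // discrepancy_ge0.
- by apply: measurable_funeM; apply/measurable_EFinP.
rewrite integral_cst // -[X in (_ * X + _)%E]/(P setT) probability_setT mule1.
rewrite ge0_integralZl //; last 2 first.
- exact/measurable_EFinP.
- by move=> w _; rewrite lee_fin discrepancy_ge0.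
apply: (@le_trans _ _ (c1%:E + c2%:E * (n%:R ^+ 2)%:E)%E).
  by rewrite leeD2l // lee_wpmul2l ?lee_fin // expected_discrepancy.
rewrite -EFinM -EFinD lee_fin.
have -> : c1 + c2 * n%:R ^+ 2 = 256 / 3 * (rho ^+ 2 * M ^+ 2 * ka) +
    16 / 3 * (V / n%:R ^+ 2) + (1544 / 3) * (rho ^+ 2 * M ^+ 2 * B) + 2 * (rho ^+ 2 * B).
  by rewrite /c1 /c2; field.
have -> : rho ^+ 2 * (86 * M ^+ 2 * ka + (516 * M ^+ 2 + 2) * B) + 6 * V / n%:R ^+ 2 =
    86 * (rho ^+ 2 * M ^+ 2 * ka) + 6 * (V / n%:R ^+ 2) +
    516 * (rho ^+ 2 * M ^+ 2 * B) + 2 * (rho ^+ 2 * B) by field.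
have : 0 <= rho ^+ 2 * M ^+ 2 * ka by rewrite mulr_ge0.
have : 0 <= V / n%:R ^+ 2 by rewrite divr_ge0 // ltW.
have : 0 <= rho ^+ 2 * M ^+ 2 * B by rewrite mulr_ge0 // ltW.
lra.
Qed.

End RiskBound.

(** * Choice of the number of blocks *)

Section Rates.
Context {R : realType}.

Lemma powR_expR (x p : R) : 0 < x -> x `^ p = expR (p * ln x).
Proof. by move=> x0; rewrite /powR gt_eqF. Qed.

Variables (alpha rho : R) (n : nat).
Hypotheses (alpha0 : 0 < alpha) (n_gt0 : (0 < n)%N).
Hypotheses (rho_gt : 4 / n%:R < rho) (rho1 : rho <= 1).

Let a := Num.min alpha 1.
Let k := block_number alpha rho n.
Let u : R := ln n%:R.
Let v : R := ln rho.
Let s : R := expR ((v / 2 + u) / (1 + a)).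
Let t : R := expR ((v + u) / (2 * a)).

Let n0 : 0 < n%:R :> R. Proof. by rewrite ltr0n. Qed.
Let rho0 : 0 < rho. Proof. by apply: le_lt_trans rho_gt; rewrite divr_ge0. Qed.
Let a0 : 0 < a. Proof. by rewrite lt_min alpha0 ltr01. Qed.
Let a1 : a <= 1. Proof. by rewrite ge_min lexx orbT. Qed.

Let rhon : 4 < rho * n%:R. Proof. by rewrite -ltr_pdivrMr. Qed.

Lemma sample_size_ge5 : (5 <= n)%N.
Proof.
rewrite -(ltr_nat R); apply: lt_le_trans rhon _.
by rewrite ler_piMl // ltW.
Qed.

Let lnx : ln (rho * n%:R) = v + u.
Proof. by rewrite lnM ?posrE. Qed.

Let uv1 : 1 <= v + u.
Proof. by rewrite -lnx ln4_ge1 // ltW. Qed.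

Let v0 : v <= 0.
Proof. exact: ln_le0. Qed.

Let a10 : 0 < 1 + a. Proof. by move: a0; lra. Qed.

Let s1 : 1 <= s.
Proof.
rewrite -[leLHS]expR0 ler_expR divr_ge0 ?(ltW a10) //.
by move: uv1 v0; lra.
Qed.

Let t1 : 1 <= t.
Proof.
rewrite -[leLHS]expR0 ler_expR divr_ge0 ?mulr_ge0 ?(ltW a0) //.
by move: uv1; lra.
Qed.

(** The condition n^(a - 1) <= rho is equivalent to s <= t, so k follows the smaller of two values:
    s, where the squared bias rho^2 k^(- 2 a) balances the variance rho k^2 / n^2, and t, where the
    squared bias has dropped to rho / n. *)
Lemma block_number_itv : Num.min s t <= k%:R <= Num.min s t + 1.
Proof.
have sE : (Num.sqrt rho * n%:R) `^ (1 + a)^-1 = s.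
  rewrite powR_expR; last by rewrite mulr_gt0 // sqrtr_gt0.
  rewrite lnM ?posrE ?sqrtr_gt0 // -powR12_sqrt ?(ltW rho0) // ln_powR.
  by congr expR; rewrite mulrC [2^-1 * _]mulrC.
have tE : (rho * n%:R) `^ (2 * a)^-1 = t.
  by rewrite powR_expR ?mulr_gt0 // lnx mulrC.
have minE : (if n%:R `^ (a - 1) <= rho then s else t) = Num.min s t.
  have -> : (n%:R `^ (a - 1) <= rho) = (s <= t).
    rewrite powR_expR // -[X in _ <= X](lnK (x := rho)) ?posrE // !ler_expR -/v -/u.
    rewrite ler_pdivrMr // mulrAC ler_pdivlMr ?mulr_gt0 //.
    by apply/idP/idP => h; lra.
  by case: leP.
have m1 : 1 <= Num.min s t by rewrite le_min s1 t1.
have kE : k%:R = (Num.ceil (Num.min s t))%:~R :> R.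
  rewrite /k /block_number -/a sE tE minE.
  have c0 : 0 <= Num.ceil (Num.min s t) by rewrite ceil_ge0; lra.
  by rewrite -[in RHS](gez0_abs c0) -pmulrn.
rewrite kE ceil_ge /=; have := ceilB1_lt (Num.min s t); rewrite intrD; lra.
Qed.

Lemma block_number_gt0 : (0 < k)%N.
Proof.
have /andP[h _] := block_number_itv.
rewrite -(ltr_nat R); apply: lt_le_trans h.
by rewrite lt_min !expR_gt0.
Qed.

Lemma block_number_le_s : k%:R <= 2 * s.
Proof.
have /andP[_ h] := block_number_itv; have : Num.min s t <= s by rewrite ge_min lexx.
by move: s1; lra.
Qed.

Lemma block_number_le_t : k%:R <= 2 * t.
Proof.
have /andP[_ h] := block_number_itv.
by have : Num.min s t <= t by [rewrite ge_min lexx orbT]; move: t1; lra.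
Qed.

Definition dense_rate (r : R) : R :=
  r `^ ((2 + a) / (1 + a)) * n%:R `^ (- (2 * a / (1 + a))).

Lemma dense_rateE r : 0 < r ->
  dense_rate r = expR ((2 + a) / (1 + a) * ln r - 2 * a / (1 + a) * u).
Proof. by move=> r0; rewrite /dense_rate !powR_expR // -expRD mulNr. Qed.

Lemma dense_rate_le r : rho <= r -> dense_rate rho <= dense_rate r.
Proof.
move=> rr; have r0 : 0 < r by exact: lt_le_trans rr.
rewrite !dense_rateE // ler_expR lerD2r ler_pM2l ?divr_gt0 ?ler_ln ?posrE //.
by move: a0; lra.
Qed.

Lemma approximation_rate :
  rho ^+ 2 * ((k%:R^-1) `^ a) ^+ 2 <= dense_rate rho + rho * ln (rho * n%:R) / n%:R.
Proof.
have k0 : 0 < k%:R :> R by rewrite ltr0n block_number_gt0.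
have h (m : R) : 0 < m -> m <= k%:R ->
    rho ^+ 2 * ((k%:R^-1) `^ a) ^+ 2 <= expR (2 * v - 2 * a * ln m).
  move=> m0 mk.
  have : (k%:R^-1) `^ a <= m^-1 `^ a.
    apply: ge0_ler_powR; rewrite ?nnegrE ?invr_ge0 ?(ltW a0) ?(ltW m0) ?(ltW k0) //.
    by rewrite lef_pV2 ?posrE.
  move=> hk.
  have -> : expR (2 * v - 2 * a * ln m) = rho ^+ 2 * (m^-1 `^ a) ^+ 2.
    rewrite powR_expR ?invr_gt0 // lnV ?posrE // -[in RHS](lnK (x := rho)) ?posrE // -/v.
    by rewrite -!expRM_natl -expRD; congr expR; ring.
  by rewrite ler_pM2l ?exprn_gt0 // lerXn2r ?nnegrE ?powR_ge0.
have /andP[kst _] := block_number_itv.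
have d0 : 0 <= dense_rate rho by rewrite mulr_ge0 ?powR_ge0.
have e0 : 0 <= rho * ln (rho * n%:R) / n%:R.
  by rewrite divr_ge0 ?(ltW n0) // mulr_ge0 ?(ltW rho0) // lnx; move: uv1; lra.
have := leP s t; case=> st; rewrite ?(min_idPl (ltW st)) in kst.
  have ks : s <= k%:R by move: kst; rewrite (min_idPl st).
  apply: (le_trans (h s (expR_gt0 _) ks)).
  rewrite (_ : expR _ = dense_rate rho) ?lerDl // dense_rateE // expRK -/v.
  by congr expR; field; rewrite gt_eqF.
have kt : t <= k%:R by move: kst; rewrite (min_idPr (ltW st)).
apply: (le_trans (h t (expR_gt0 _) kt)).
rewrite (_ : expR _ = rho / n%:R); last first.
  rewrite -[in RHS](lnK (x := rho)) ?posrE // -[in RHS](lnK (x := n%:R)) ?posrE //.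
  by rewrite -expRN -expRD expRK -/v -/u; congr expR; field; rewrite gt_eqF.
rewrite -[leLHS]add0r lerD // ler_pM2r ?invr_gt0 // ler_peMr ?(ltW rho0) //.
by rewrite lnx.
Qed.

(** The bound by t serves here since ln t is a multiple of ln (rho n); the latter is at least 1 and
    absorbs ln 2. *)
Lemma ln_block_number : ln k%:R <= (1 + (2 * a)^-1) * ln (rho * n%:R).
Proof.
have k0 : 0 < k%:R :> R by rewrite ltr0n block_number_gt0.
apply: (@le_trans _ _ (ln (2 * t))).
  by rewrite ler_ln ?posrE ?mulr_gt0 ?expR_gt0 // block_number_le_t.
rewrite lnM ?posrE ?expR_gt0 // expRK lnx [leRHS]mulrDl mul1r lerD //; last by rewrite mulrC.
apply: le_trans uv1; have := @le_ln1Dx R 1; rewrite (_ : 1 + 1 = 2) //.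
by apply; lra.
Qed.

Lemma block_number_rate r : rho <= r -> r * k%:R ^+ 2 / n%:R ^+ 2 <= 4 * dense_rate r.
Proof.
move=> rr; have r0 : 0 < r by exact: lt_le_trans rr.
have h : k%:R ^+ 2 <= 4 * s ^+ 2.
  have -> : 4 * s ^+ 2 = (2 * s) ^+ 2 by ring.
  by rewrite lerXn2r ?nnegrE ?mulr_ge0 ?expR_ge0 // block_number_le_s.
apply: (@le_trans _ _ (r * (4 * s ^+ 2) / n%:R ^+ 2)).
  by rewrite ler_pM2r ?invr_gt0 ?exprn_gt0 // ler_pM2l.
have -> : r * (4 * s ^+ 2) / n%:R ^+ 2 = 4 * (r * s ^+ 2 / n%:R ^+ 2) by ring.
rewrite ler_pM2l // dense_rateE //.
rewrite -{1}(lnK (x := r)) ?posrE // -{1}(lnK (x := n%:R)) ?posrE // -/u.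
rewrite -!expRM_natl -expRN -!expRD ler_expR.
have : v <= ln r by rewrite ler_ln ?posrE.
have -> : ln r + 2 * ((v / 2 + u) / (1 + a)) - 2 * u =
   ln r + (v - 2 * a * u) / (1 + a) by field; rewrite gt_eqF.
have -> : (2 + a) / (1 + a) * ln r - 2 * a / (1 + a) * u =
   ln r + (ln r - 2 * a * u) / (1 + a) by field; rewrite gt_eqF.
by move=> h'; rewrite lerD2l ler_pM2r ?invr_gt0 // lerD2r.
Qed.

Lemma rate_bound (M K r V : R) : 0 <= K -> rho <= r ->
  V <= K * (r * (n%:R * ln k%:R + 12 * k%:R ^+ 2 + 1)) ->
  rho ^+ 2 * (86 * M ^+ 2 * ((k%:R^-1) `^ a) ^+ 2 +
              (516 * M ^+ 2 + 2) * (n%:R `^ a)^-1) + 6 * V / n%:R ^+ 2 <=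
  (602 * M ^+ 2 + 2 + 6 * K * (50 + (2 * a)^-1)) *
  (dense_rate r + r * ln (rho * n%:R) / n%:R + rho ^+ 2 / n%:R `^ a).
Proof.
move=> K0 rr VK; have r0 : 0 < r by exact: lt_le_trans rr.
have hA := approximation_rate; have hB := block_number_rate rr.
have hL := ln_block_number; have hD := dense_rate_le rr.
set D := dense_rate r in hB hD *; set Q := r * _ / _.
set E := rho ^+ 2 / n%:R `^ a.
have D0 : 0 <= D by rewrite mulr_ge0 ?powR_ge0.
have E0 : 0 <= E by rewrite divr_ge0 ?sqr_ge0 ?powR_ge0.
have l1 : 1 <= ln (rho * n%:R) by rewrite lnx.
have Q0 : 0 <= Q by rewrite divr_ge0 ?(ltW n0) // mulr_ge0 ?(ltW r0) //; lra.
have rQ : rho * ln (rho * n%:R) / n%:R <= Q.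
  by rewrite ler_pM2r ?invr_gt0 // ler_pM2r //; lra.
have n1 : 1 <= n%:R :> R by rewrite ler1n.
have i2a : 0 < (2 * a)^-1 by rewrite invr_gt0 mulr_gt0.
have rn : r / n%:R ^+ 2 <= Q.
  have -> : r / n%:R ^+ 2 = r * n%:R^-1 / n%:R by field; rewrite gt_eqF.
  rewrite /Q ler_pM2r ?invr_gt0 // ler_pM2l //; apply: le_trans l1.
  by rewrite invf_le1.
have rk : r * (n%:R * ln k%:R) / n%:R ^+ 2 <= (1 + (2 * a)^-1) * Q.
  have -> : r * (n%:R * ln k%:R) / n%:R ^+ 2 = r * ln k%:R / n%:R.
    by field; rewrite gt_eqF.
  have -> : (1 + (2 * a)^-1) * Q = r * ((1 + (2 * a)^-1) * ln (rho * n%:R)) / n%:R.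
    by rewrite /Q; ring.
  by rewrite ler_pM2r ?invr_gt0 // ler_pM2l.
have VV : V / n%:R ^+ 2 <= K * ((2 + (2 * a)^-1) * Q + 48 * D).
  apply: (@le_trans _ _ (K * (r * (n%:R * ln k%:R + 12 * k%:R ^+ 2 + 1)) / n%:R ^+ 2)).
    by rewrite ler_pM2r ?invr_gt0 ?exprn_gt0.
  have -> : K * (r * (n%:R * ln k%:R + 12 * k%:R ^+ 2 + 1)) / n%:R ^+ 2 =
    K * (r * (n%:R * ln k%:R) / n%:R ^+ 2 + 12 * (r * k%:R ^+ 2 / n%:R ^+ 2)
         + r / n%:R ^+ 2) by ring.
  by apply: ler_wpM2l => //; lra.
have M2 : 0 <= M ^+ 2 by exact: sqr_ge0.
set kap := (_ `^ a) ^+ 2 in hA *.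
have -> : rho ^+ 2 * (86 * M ^+ 2 * kap + (516 * M ^+ 2 + 2) * (n%:R `^ a)^-1)
   + 6 * V / n%:R ^+ 2 =
   86 * (M ^+ 2 * (rho ^+ 2 * kap)) + 516 * (M ^+ 2 * E) + 2 * E + 6 * (V / n%:R ^+ 2).
  by rewrite /E; ring.
have h1 : M ^+ 2 * (rho ^+ 2 * kap) <= M ^+ 2 * (D + Q).
  by apply: ler_wpM2l => //; lra.
have p1 : 0 <= M ^+ 2 * D by rewrite mulr_ge0.
have p2 : 0 <= M ^+ 2 * Q by rewrite mulr_ge0.
have p3 : 0 <= M ^+ 2 * E by rewrite mulr_ge0.
have p4 : 0 <= K * D by rewrite mulr_ge0.
have p5 : 0 <= K * Q by rewrite mulr_ge0.
have p6 : 0 <= K * E by rewrite mulr_ge0.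
have p7 : 0 <= (2 * a)^-1 * (K * D) by rewrite mulr_ge0 // ltW.
have p8 : 0 <= (2 * a)^-1 * (K * E) by rewrite mulr_ge0 // ltW.
move: p7 p8 VV h1; set ia := (2 * a)^-1; lra.
Qed.

(** In logarithms the density assumption reads s ln (rho n) <= rho n. As n <= 2 k m and k <= 2 s, it
    gives ln (rho n) <= 4 rho m. Dropping the nonnegative term ln y from the same assumption gives
    ln n <= 3 ln (rho n), hence the factor 12. *)
Lemma min_block_size (m : nat) :
  n%:R `^ (- (2 * a / (1 + 2 * a))) *
    ln (n%:R * rho) `^ (2 * (1 + a) / (1 + 2 * a)) <= rho ->
  k = (n %/ m)%N -> (0 < m)%N -> ln n%:R <= 12 * (rho * m%:R).
Proof.
move=> H km m_gt0.
have a20 : 0 < 1 + 2 * a by move: a0; lra.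
set y := v + u.
have y1 : 1 <= y := uv1.
have y0 : 0 < y by lra.
rewrite mulrC in H.
have {}H : - (2 * a) * u + 2 * (1 + a) * ln y <= (1 + 2 * a) * v.
  move: H; rewrite [n%:R * rho]mulrC lnx -/y !powR_expR // -expRD.
  rewrite -[X in _ <= X](lnK (x := rho)) ?posrE // ler_expR -/u -/v => H.
  have -> : - (2 * a) * u + 2 * (1 + a) * ln y = (1 + 2 * a) *
    (2 * (1 + a) / (1 + 2 * a) * ln y + - (2 * a / (1 + 2 * a)) * u).
    by field; rewrite gt_eqF.
  by rewrite ler_pM2l.
have ly0 : 0 <= ln y by exact: ln_ge0.
have uy : u <= 3 * y.
  have u0 : 0 <= u by move: v0; rewrite /y in y1; lra.
  have h : u <= (1 + 2 * a) * y.
    have : 0 <= (1 + a) * ln y by rewrite mulr_ge0 // ltW.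
    by rewrite /y; move: H; lra.
  by apply: le_trans h _; rewrite ler_pM2r //; move: a1; lra.
have ys : y * s <= rho * n%:R.
  rewrite -[X in X * s](lnK (x := y)) ?posrE // -expRD.
  rewrite -[leRHS](lnK (x := rho * n%:R)) ?posrE ?mulr_gt0 // lnx ler_expR.
  have -> : ln y + (v / 2 + u) / (1 + a) = (2 * (1 + a) * ln y + v + 2 * u) / (2 * (1 + a)).
    by field; rewrite gt_eqF.
  rewrite ler_pdivrMr ?mulr_gt0 //; move: H; lra.
have m0 : 0 < m%:R :> R by rewrite ltr0n.
(* Rounding down gives n < (k + 1) m, and k >= 1. *)
have nk : n%:R <= 2 * k%:R * m%:R :> R.
  have : (n < k.+1 * m)%N by rewrite km -ltn_divLR.
  have := block_number_gt0; rewrite -/k => k0.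
  rewrite -natrM -natrM ler_nat => h; apply: leq_trans (ltnW h) _.
  by rewrite leq_mul2r mul2n -addnn -addn1 leq_add2l k0 orbT.
have h1 : n%:R <= 4 * s * m%:R.
  apply: le_trans nk _; rewrite ler_pM2r //; have := block_number_le_s; lra.
have h2 : y * s <= rho * (4 * s * m%:R).
  by apply: le_trans ys _; rewrite ler_pM2l.
have sp : 0 < s by exact: expR_gt0.
have : y <= 4 * (rho * m%:R).
  rewrite -(ler_pM2r sp); apply: le_trans h2 _.
  by rewrite le_eqVlt; apply/orP; left; apply/eqP; ring.
rewrite -/u; lra.
Qed.

End Rates.

(** * Assembly of the two risk bounds *)

Lemma block_maps_leq n k n0 (z : 'I_n -> 'I_k) : block_maps n0 z -> (n0 * k <= n)%N.
Proof.
move=> zP; rewrite -[X in (_ <= X)%N]card_ord -sum1_card (partition_big z xpredT) //=.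
rewrite mulnC -[X in (X * _)%N]card_ord -sum_nat_const.
by apply: leq_sum => b _; rewrite sum1_card; exact: zP.
Qed.

Lemma ls_fit_sym (R : realType) n k (S : 'M[R]_k -> Prop) n0 b Th :
  @ls_fit R n k S n0 b Th -> exists g, Th = sym_mx 0 g.
Proof. by move=> [Q [z [_ _ _ ->]]]; eexists. Qed.

Lemma noise_level_le (R : realType) (r x y : R) : 0 <= r -> 0 <= x -> 0 <= y ->
  32 * r * (x + y * ln 12 + 1) + 16 * r * (x + 1) <= 48 * (r * (x + 12 * y + 1)).
Proof.
move=> r0 x0 y0; have l12 : ln 12 <= 12 :> R by apply/ltW/ln_sublinear.
have : r * (y * ln 12) <= r * (y * 12) by rewrite ler_wpM2l // ler_wpM2l.
have : 0 <= r * (y * 12) by rewrite mulr_ge0 // mulr_ge0.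
have : 0 <= r * x by rewrite mulr_ge0.
lra.
Qed.

Lemma noise_level_ge0 (R : realType) (r x y : R) : 0 <= r -> 0 <= x -> 0 <= y ->
  0 <= 32 * r * (x + y * ln 12 + 1) + 16 * r * (x + 1).
Proof.
move=> r0 x0 y0; have l12 : 0 <= ln 12 :> R by rewrite ln_ge0 // ler1n.
by rewrite addr_ge0 // mulr_ge0 ?addr_ge0 ?mulr_ge0.
Qed.

Theorem corollary3p6 (R : realType) (alpha L : R)
    (alpha_gt0 : 0 < alpha) (L_gt0 : 0 < L) :
  let a := Num.min alpha 1 in
  (exists C1 : R, 0 < C1 /\
     forall (n : nat) (rho : R) (W0 : R * R -> R)
       (d : measure_display) (Omega : measurableType d)
       (P : probability Omega R)
       (xi : 'I_n -> {RV P >-> R}) (A : 'I_n -> 'I_n -> {RV P >-> bool}),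
     (0 < n)%N -> 4 / n%:R < rho -> rho <= 1 ->
     graphon W0 -> holder_class alpha L W0 ->
     sparse_graphon_model rho W0 xi A ->
     n%:R `^ (- (2 * a / (1 + 2 * a)))
       * ln (n%:R * rho) `^ (2 * (1 + a) / (1 + 2 * a)) <= rho ->
     forall (n0 : nat) (est : 'M[bool]_n -> 'M[R]_n),
     (2 <= n0)%N -> block_number alpha rho n = (n %/ n0)%N ->
     least_squares_estimator (block_number alpha rho n) n0 est ->
     (\int[P]_w delta2 (empirical_graphon (est (adjacency A w)))
                       (fun z => (rho * W0 z)%R)
      <= (C1 * (rho `^ ((2 + a) / (1 + a)) * n%:R `^ (- (2 * a / (1 + a)))
                + rho * ln (rho * n%:R) / n%:R
                + rho ^+ 2 / n%:R `^ a))%:E)%E)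
  /\
  (forall c0 : R, 0 < c0 -> exists C2 : R, 0 < C2 /\
     forall (n : nat) (rho : R) (W0 : R * R -> R)
       (d : measure_display) (Omega : measurableType d)
       (P : probability Omega R)
       (xi : 'I_n -> {RV P >-> R}) (A : 'I_n -> 'I_n -> {RV P >-> bool}),
     (0 < n)%N -> 4 / n%:R < rho -> rho <= 1 ->
     graphon W0 -> holder_class alpha L W0 ->
     sparse_graphon_model rho W0 xi A ->
     forall (r : R) (est : 'M[bool]_n -> 'M[R]_n),
     r <= 1 -> rho <= r -> c0 / n%:R <= rho ->
     restricted_least_squares_estimator (block_number alpha rho n) r est ->
     (\int[P]_w delta2 (empirical_graphon (est (adjacency A w)))
                       (fun z => (rho * W0 z)%R)
      <= (C2 * (r `^ ((2 + a) / (1 + a)) * n%:R `^ (- (2 * a / (1 + a)))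
                + r * ln (rho * n%:R) / n%:R
                + rho ^+ 2 / n%:R `^ a))%:E)%E).
Proof.
move=> a; have [M M0 HM] := holder_modulus alpha_gt0 L_gt0.
have a0 : 0 < a by rewrite lt_min alpha_gt0 ltr01.
have a1 : a <= 1 by rewrite ge_min lexx orbT.
have ia : 0 < (2 * a)^-1 by rewrite invr_gt0 mulr_gt0.
have C0 (K : R) : 0 <= K -> 0 < 602 * M ^+ 2 + 2 + 6 * K * (50 + (2 * a)^-1).
  move=> K0; have : 0 <= K * (50 + (2 * a)^-1) by rewrite mulr_ge0 // addr_ge0 // ltW.
  by have := sqr_ge0 M; lra.
split.
  (* 48 r with r = 2304 rho bounds the noise level, and 2 accounts for the bad blocks. *)
  have [K0 [Kpos KE]] : exists K : R, 0 <= K /\ K = 48 * 2304 + 2.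
    by eexists; split; last reflexivity; lra.
  exists (602 * M ^+ 2 + 2 + 6 * K0 * (50 + (2 * a)^-1)); split; first exact: C0.
  move=> n rho W0 d Omega P xi A n_gt0 rho_gt rho1 W0g W0h model H n0 est n0_ge2 kE estP.
  have rho0 : 0 < rho by apply: le_lt_trans rho_gt; rewrite divr_ge0.
  set k := block_number alpha rho n in kE estP.
  have k0 : (0 < k)%N by exact: block_number_gt0.
  have k1 : 1 <= k%:R :> R by rewrite ler1n.
  have lnk : 0 <= n%:R * ln k%:R :> R by rewrite mulr_ge0 // ln_ge0.
  have lnn := min_block_size alpha_gt0 n_gt0 rho_gt rho1 H kE (ltnW n0_ge2).
  have n5 := sample_size_ge5 n_gt0 rho_gt rho1.
  pose r := 2304 * rho; have rE : r = 2304 * rho by [].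
  have r0 : 0 <= r by rewrite rE; lra.
  clearbody r.
  pose V : R := 32 * r * (n%:R * ln k%:R + k%:R ^+ 2 * ln 12 + 1)
    + 16 * r * (n%:R * ln k%:R + 1) + 2 * (k%:R ^+ 2 * rho).
  have n0k : (n0 * k <= n)%N by rewrite kE mulnC leq_divM.
  have V0 : 0 <= V.
    apply: addr_ge0; first exact: noise_level_ge0.
    by rewrite mulr_ge0 // mulr_ge0 ?sqr_ge0 // ltW.
  apply: le_trans (risk_bound rho0 rho1 W0g model n_gt0 a0 a1 (ltW M0) (HM _ W0h)
    (fun b => ls_fit_sym (estP b)) k0 n0k V0 _) _.
    move=> t Qs zs t0 QsT _ zsP.
    by have := least_squares_network_bound t0 rho0 rho1 n0_ge2 rE n5 lnn estP QsT zsP;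
      rewrite /V; lra.
  rewrite lee_fin; apply: (rate_bound alpha_gt0 n_gt0 rho_gt rho1 M Kpos (lexx _)).
  have := noise_level_le r0 lnk (sqr_ge0 k%:R); rewrite -/k /V KE rE => h.
  have h1 : 0 <= rho * (n%:R * ln k%:R) by rewrite mulr_ge0 // ltW.
  have h2 : 0 <= rho * k%:R ^+ 2 by rewrite mulr_ge0 ?sqr_ge0 // ltW.
  move: h h1 h2 rho0; lra.
move=> c0 _.
exists (602 * M ^+ 2 + 2 + 6 * 48 * (50 + (2 * a)^-1)); split; first exact: C0.
move=> n rho W0 d Omega P xi A n_gt0 rho_gt rho1 W0g W0h model r est _ rr _ estP.
have rho0 : 0 < rho by apply: le_lt_trans rho_gt; rewrite divr_ge0.
set k := block_number alpha rho n in estP.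
have k0 : (0 < k)%N by exact: block_number_gt0.
have k1 : 1 <= k%:R :> R by rewrite ler1n.
have lnk : 0 <= n%:R * ln k%:R :> R by rewrite mulr_ge0 // ln_ge0.
have r0 : 0 <= r by rewrite (le_trans (ltW rho0)).
pose V : R := 32 * r * (n%:R * ln k%:R + k%:R ^+ 2 * ln 12 + 1)
  + 16 * r * (n%:R * ln k%:R + 1).
(* The existence of a fit gives k <= n: the labelling fitted to the empty graph already uses every
   block. *)
have n0k : (1 * k <= n)%N.
  by have [Q [z [_ zP _ _]]] := estP (const_mx false); exact: block_maps_leq zP.
have V0 : 0 <= V by exact: noise_level_ge0.
apply: le_trans (risk_bound rho0 rho1 W0g model n_gt0 a0 a1 (ltW M0) (HM _ W0h)
  (fun b => ls_fit_sym (estP b)) k0 n0k V0 _) _.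
  move=> t Qs zs t0 QsT Qsr zsP.
  have := restricted_network t0 rho0 rho1 rr estP QsT _ zsP.
  by rewrite addrA; apply=> b c; exact: le_trans (Qsr b c) rr.
rewrite lee_fin; apply: (rate_bound alpha_gt0 n_gt0 rho_gt rho1 M _ rr) => //.
exact: (noise_level_le r0 lnk (sqr_ge0 k%:R)).
Qed.
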